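(* For each $N\in\mathbb N$ let $\mathbf c^N:[0,\infty)\to\mathcal P(\mathcal X^N)$ be a solution of the $N$-particle evolution $\dot{\mathbf c}^N(t)=\mathbf c^N(t)\bm Q^N$. Let $\mathbb C(0)\in\mathcal P(\mathcal P(\mathcal X))$ and assume the initial data are well-prepared: $$\frac1N\bm{\mathcal F}^N(\mathbf c^N(0))\to\mathbb F(\mathbb C(0))-\mathcal F_0\quad\text{and}\quad L^N_\#\mathbf c^N(0)\rightharpoonup\mathbb C(0)\quad\text{as }N\to\infty.$$ Then $L^N_\#\mathbf c^N(t)\rightharpoonup\mathbb C(t)$ for all $t\in(0,\infty)$, where $\mathbb C$ is a weak solution of the Liouville equation starting from $\mathbb C(0)$, and moreover $\frac1N\bm{\mathcal F}^N(\mathbf c^N(t))\to\mathbb F(\mathbb C(t))-\mathcal F_0$ for all $t\in(0,\infty)$.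
   Context: Let $\mathcal X=\{1,\dots,d\}$ be finite, $\mathcal P(\mathcal X)\subset\mathbb R^{\mathcal X}$ the probability measures on $\mathcal X$. Let $K:\mathcal P(\mathcal X)\times\mathcal X\to\mathbb R$ with each $K_x$ twice continuously differentiable on a neighbourhood of $\mathcal P(\mathcal X)$; $U(\mu)=\sum_x\mu_xK_x(\mu)$, $H_x=\partial_{\mu_x}U$, $\pi_x(\mu)=e^{-H_x(\mu)}/\sum_ze^{-H_z(\mu)}$. Free energy $\mathcal F(\mu)=\sum_x\mu_x\log\mu_x+U(\mu)$, $\mathcal F_0=\inf_{\mu\in\mathcal P(\mathcal X)}\mathcal F(\mu)$, and for $\mathbb M\in\mathcal P(\mathcal P(\mathcal X))$, $\mathbb F(\mathbb M)=\int\mathcal F\,d\mathbb M$. Particle system: for $\bm x=(x_1,\dots,x_N)\in\mathcal X^N$ let $L^N(\bm x)=\frac1N\sum_i\delta_{x_i}$, $\mathcal P_N(\mathcal X)=L^N(\mathcal X^N)$, and $\bm x^{i;y}$ the configuration with $x_i$ replaced by $y$. Let $\bm\pi^N_{\bm x}=\exp(-NU(L^N\bm x))/\bm Z^N$ with $\bm Z^N$ the normalization. Let $\{A(\mu)\}_{\mu\in\mathcal P(\mathcal X)}$ be irreducible symmetric matrices with nonnegative entries, depending Lipschitz continuously on $\mu$, and $\{A^N(\mu)\}$ irreducible symmetric nonnegative matrices with $A^N_{xy}\to A_{xy}$ uniformly on $\mathcal P(\mathcal X)$ for all $x,y$. For $\mu\in\mathcal P_N(\mathcal X)$ with $\mu_x>0$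 and $y\ne x$ set $Q^N_{xy}(\mu)=\exp\big(-\frac N2(U(\mu+\frac{\delta_y-\delta_x}{N})-U(\mu))\big)A^N_{xy}(\mu)$, and let $\bm Q^N\in\mathbb R^{\mathcal X^N\times\mathcal X^N}$ have off-diagonal entries $\bm Q^N_{\bm x,\bm x^{i;y}}=Q^N_{x_i,y}(L^N\bm x)$ ($y\ne x_i$), all other off-diagonal entries $0$, and rows summing to $0$. Relative entropy: $\bm{\mathcal F}^N(\bm\mu)=\sum_{\bm x}\bm\mu_{\bm x}\log(\bm\mu_{\bm x}/\bm\pi^N_{\bm x})$. $L^N_\#\bm\mu\in\mathcal P(\mathcal P(\mathcal X))$ is the push-forward; $\rightharpoonup$ is weak convergence. Limit rates: $Q_{xy}(\mu)=\sqrt{\pi_y(\mu)/\pi_x(\mu)}\,A_{xy}(\mu)$ for $x\ne y$, $Q_{xx}=-\sum_{y\ne x}Q_{xy}$. Weak solution of the Liouville equation $\partial_t\mathbb C+\mathrm{div}(\mathbb C\,b)=0$, $b_x(\nu)=\sum_y\nu_yQ_{yx}(\nu)$: a weakly continuous curve $t\mapsto\mathbb C(t)\in\mathcal P(\mathcal P(\mathcal X))$ with the given $\mathbb C(0)$ such that $\int\int(\partial_t\varphi(t,\nu)+\langle\nabla\varphi(t,\nu),b(\nu)\rangle)\mathbb C(t,d\nu)dt=0$ for all $\varphi\in C^1_c((0,\infty)\times\mathbb R^{\mathcal X})$. *)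

(* Defs.v *)
From HB Require Import structures.
From mathcomp Require Import all_boot all_order all_algebra.
From mathcomp Require Import all_classical all_reals all_analysis.
Set Implicit Arguments.
Unset Strict Implicit.
Unset Printing Implicit Defensive.
Import Order.TTheory GRing.Theory Num.Theory.
Import numFieldNormedType.Exports.
Local Open Scope classical_set_scope.
Local Open Scope ring_scope.

(* State space X = 'I_d ; vectors in R^X are row vectors 'rV[R]_d,    *)
(* with entry mu_x written  mu 0 x.                                    *)

Section Defs.
Variables (R : realType) (d : nat).

Definition vec := 'rV[R]_d.

Definition dlt (x : 'I_d) : vec := delta_mx 0 x.

Definition simplex : set vec :=
  [set mu | (forall x, 0 <= mu 0 x) /\ \sum_x mu 0 x = 1].

Definition pder (x : 'I_d) (f : vec -> R) : vec -> R := 'D_(dlt x) f.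

Definition C1_on (O : set vec) (f : vec -> R) : Prop :=
  (forall mu, O mu -> {for mu, continuous f}) /\
  forall x, (forall mu, O mu -> derivable f mu (dlt x)) /\
            (forall mu, O mu -> {for mu, continuous (pder x f)}).

Definition C2_on (O : set vec) (f : vec -> R) : Prop :=
  C1_on O f /\ forall x, C1_on O (pder x f).

Variable K : 'I_d -> vec -> R.

Definition U (mu : vec) : R := \sum_x mu 0 x * K x mu.
Definition H (x : 'I_d) : vec -> R := pder x U.
Definition piX (mu : vec) (x : 'I_d) : R :=
  expR (- H x mu) / \sum_z expR (- H z mu).

Definition entropy (mu : vec) : R := \sum_x mu 0 x * ln (mu 0 x).
Definition freeF (mu : vec) : R := entropy mu + U mu.
Definition F0 : R := inf [set freeF mu | mu in simplex].

(* Borel sigma-algebra on R^X; elements of P(P(X)) are probability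
   measures on it giving full mass to the simplex. *)
Definition borelT := g_sigma_algebraType (@open vec).

Definition PP (M : probability borelT R) : Prop := M simplex = 1%E.

Definition integ (M : probability borelT R) (f : vec -> R) : R :=
  Rintegral M simplex f.

Definition bigF (M : probability borelT R) : R := integ M freeF.

Definition irr_sym_nonneg (B : 'M[R]_d) : Prop :=
  (forall x y, 0 <= B x y) /\ (forall x y, B x y = B y x) /\
  (forall x y, connect (fun u v => 0 < B u v) x y).

Variable A : vec -> 'M[R]_d.

Definition Qlim (mu : vec) (x y : 'I_d) : R :=
  if x == y then 0 (* diagonal entries are not used *)
  else Num.sqrt (piX mu y / piX mu x) * A mu x y.

Definition Qfull (mu : vec) (x y : 'I_d) : R :=
  if x == y then - \sum_(z | z != x) Qlim mu x z else Qlim mu x y.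

Definition drift (nu : vec) (x : 'I_d) : R := \sum_y nu 0 y * Qfull nu y x.

Definition config (N : nat) := {ffun 'I_N -> 'I_d}.

Definition LN (N : nat) (bx : config N) : vec :=
  \row_y (#|[set i | bx i == y]|%:R / N%:R).

Definition piN (N : nat) (bx : config N) : R :=
  expR (- N%:R * U (LN bx)) / \sum_(bz : config N) expR (- N%:R * U (LN bz)).

Variable AN : nat -> vec -> 'M[R]_d.

Definition QN (N : nat) (mu : vec) (x y : 'I_d) : R :=
  expR (- (N%:R / 2) * (U (mu + N%:R^-1 *: (dlt y - dlt x)) - U mu)) * AN N mu x y.

Definition rateN (N : nat) (bx bw : config N) : R :=
  \sum_(i < N) (if (bw i != bx i) && [forall j, (j != i) ==> (bw j == bx j)]
               then QN N (LN bx) (bx i) (bw i) else 0).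

Definition bQN (N : nat) (bx bw : config N) : R :=
  if bx == bw then - \sum_(bz | bz != bx) rateN bx bz else rateN bx bw.

Definition relentN (N : nat) (m : config N -> R) : R :=
  \sum_bx m bx * ln (m bx / piN bx).

Definition push_integ (N : nat) (m : config N -> R) (f : vec -> R) : R :=
  \sum_bx m bx * f (LN bx).

Definition probN (N : nat) (m : config N -> R) : Prop :=
  (forall bx, 0 <= m bx) /\ \sum_bx m bx = 1.

Definition master_sol (N : nat) (c : R -> config N -> R) : Prop :=
  (forall t, 0 <= t -> probN (c t)) /\
  (forall bw, {within [set t : R | 0 <= t], continuous (fun s => c s bw)}) /\
  (forall t : R, 0 < t -> forall bw,
     is_derive t 1 (fun s => c s bw) (\sum_bx c t bx * bQN bx bw)).

Definition test_fun (f : vec -> R) : Prop :=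
  continuous f /\ exists B : R, forall nu, `|f nu| <= B.

Definition weak_conv (m : forall N : nat, config N -> R)
  (M : probability borelT R) : Prop :=
  forall f, test_fun f ->
    (fun N : nat => push_integ (m N) f) @ \oo --> integ M f.

Definition dtime (phi : R -> vec -> R) (t : R) (nu : vec) : R :=
  'D_1 (fun s => phi s nu) t.
Definition dspace (phi : R -> vec -> R) (x : 'I_d) (t : R) (nu : vec) : R :=
  pder x (phi t) nu.

Definition C1c (phi : R -> vec -> R) : Prop :=
  (forall t nu, derivable (fun s => phi s nu) t 1) /\
  (forall t nu x, derivable (phi t) nu (dlt x)) /\
  continuous (fun p : R * vec => phi p.1 p.2) /\
  continuous (fun p : R * vec => dtime phi p.1 p.2) /\
  (forall x, continuous (fun p : R * vec => dspace phi x p.1 p.2)) /\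
  exists a b r : R, 0 < a /\
    forall t nu, phi t nu != 0 -> (a <= t <= b) /\ `|nu| <= r.

(* weak solution of the Liouville equation d_t C + div(C b) = 0 *)
Definition liouville_weak (C0 : probability borelT R)
  (C : R -> probability borelT R) : Prop :=
  C 0 = C0 /\
  (forall t, 0 <= t -> PP (C t)) /\
  (forall f, test_fun f ->
     {within [set t : R | 0 <= t], continuous (fun t => integ (C t) f)}) /\
  forall phi, C1c phi ->
    (\int[@lebesgue_measure R]_(t in [set t : R | (0 < t)%R])
       (integ (C t) (fun nu => dtime phi t nu +
                               \sum_x dspace phi x t nu * drift nu x))%R%:E
     = 0)%E.

End Defs.

(* Main.v *)
(** Neither reversibility of the rates nor dissipation of the free energy is used.

    The drift is Lipschitz on the simplex and points inwards, so Euler polygons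
    converge to a flow [Phi], and [C t] is the image of [C0] under [Phi t].
    A second-moment estimate along Euler steps of the master equation bounds the
    spread of the empirical measure started at [mu] around [Phi t mu], which gives
    the weak convergence at every time.

    For the entropy, let [symm m] be the average of [m] over permutations of the
    particles.  Counting configurations of a given type (Stirling) yields
    [1/N relentN m = 1/N kl m (symm m) + push_integ m freeF + 1/N ln Z_N + o(1)],
    with [1/N ln Z_N] tending to [- F0].  Hence well-preparedness at time [t] means
    that [1/N kl (c t) (symm (c t))] vanishes in the limit.  Since [symm (c t)]
    solves the same master equation as [c t], this quantity is nonincreasing in
    time, and well-preparedness propagates. *)

Require Import Defs.
From HB Require Import structures.
From mathcomp Require Import all_boot all_order all_algebra fingroup perm.
From mathcomp Require Import all_classical all_reals all_analysis measurable_realfun.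
From mathcomp Require Import ring lra zify.
Import Order.TTheory GRing.Theory Num.Theory.
Import numFieldNormedType.Exports.
Set Implicit Arguments.
Unset Strict Implicit.
Unset Printing Implicit Defensive.
Local Open Scope classical_set_scope.
Local Open Scope ring_scope.


(** * Compactness and mean values *)

(** The splitting of the entropy works because [symm m] is constant on each type class: integrating
    [ln (symm m)] against [m] involves only the law of [LN] under [m], up to errors logarithmic in
    N. As [piN] is a function of [LN] as well, the relative entropy is a part seen by the weak limit
    plus [kl m (symm m)], which that limit cannot see. Since [freeF] is continuous on the simplex,
    the visible part converges as soon as the laws do. Facts about the N-particle evolution are
    proved for Euler steps, with N fixed and the step going to 0. A short Euler step is a stochastic
    kernel, so entropy decay is an inequality between finite sums, and x ln x is never
    differentiated at mass 0. The limit law need not be a point mass. The second-moment estimate is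
    therefore made for the chain started at a single configuration, uniformly in it, and mixed over
    the initial law by linearity. Rates and flow are controlled on the simplex only, while measures
    and test functions live on the whole space; the retraction [rtr] mediates between the two. *)

Section compactness.
Variables (R : realType) (V : normedModType R) (S : set V).
Hypothesis cS : compact S.

(** A Lebesgue number. The point [y] ranges over the ambient space; this is what later keeps a whole
    neighbourhood of the simplex inside the open set where [K] is regular. *)
Lemma compact_near_uniform (P : V -> Prop) :
  (forall x, S x -> \forall y \near x, P y) ->
  exists2 e : R, 0 < e & forall x y, S x -> `|y - x| < e -> P y.
Proof.
move=> HP.
have /compact_near_coveringP cov := cS.
have := cov R (0^'+) (fun e x => forall y, `|y - x| < e -> P y) _.
have H : forall x, S x -> \forall x' \near x & e \near 0^'+,
    forall y, `|y - x'| < e -> P y.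
  move=> x Sx; have := HP x Sx; move/nbhs_ballP => [e /= e0 He].
  exists (ball x (e / 2), [set u : R | u < e / 2]) => /=.
    split; first by apply: nbhsx_ballx; rewrite divr_gt0.
    by apply: nbhs_right_lt; rewrite divr_gt0.
  move=> [x' u] /= [Hx' Hu] y Hy; apply: He.
  rewrite -ball_normE /= in Hx' *.
  rewrite (le_lt_trans (ler_distD x' _ _))// (splitr e) ltrD//.
  by rewrite distrC (lt_trans Hy).
move=> /(_ _ H) [].
move=> e /= e0 He; exists (e / 2); first by rewrite divr_gt0.
move=> x y Sx Hxy; apply: (He (e / 2)) Hxy => //=; last by rewrite divr_gt0.
by rewrite sub0r normrN gtr0_norm ?divr_gt0// gtr_pMr// invf_lt1// ltr1n.
Qed.

Variable W : normedModType R.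

(** Heine-Cantor with continuity in the ambient space at the points of [S], so that only one of the
    two points has to lie in [S]. *)
Lemma compact_unif_cont (g : V -> W) :
  (forall x, S x -> {for x, continuous g}) ->
  forall e : R, 0 < e ->
  exists2 r : R, 0 < r &
    forall x y, S x -> `|y - x| < r -> `|g y - g x| < e.
Proof.
move=> gc e e0.
have /compact_near_coveringP cov := cS.
have := cov R (0^'+) (fun r x => forall y, `|y - x| < r -> `|g y - g x| < e) _.
have H : forall x, S x -> \forall x' \near x & r \near 0^'+,
    forall y, `|y - x'| < r -> `|g y - g x'| < e.
  move=> x Sx; have e20 : 0 < e / 2 by rewrite divr_gt0.
  have /cvgr_dist_lt/(_ _ e20) := gc x Sx.
  move/nbhs_ballP => [r /= r0 Hr].
  exists (ball x (r / 2), [set u : R | u < r / 2]) => /=.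
    split; first by apply: nbhsx_ballx; rewrite divr_gt0.
    by apply: nbhs_right_lt; rewrite divr_gt0.
  move=> [x' u] /= [Hx' Hu] y Hy.
  rewrite -ball_normE /= in Hx'.
  have gx' : `|g x - g x'| < e / 2.
    apply: Hr; rewrite -ball_normE /= (lt_trans Hx')//.
    by rewrite gtr_pMr// invf_lt1// ltr1n.
  have gy : `|g x - g y| < e / 2.
    apply: Hr; rewrite -ball_normE /=.
    rewrite (le_lt_trans (ler_distD x' _ _))// (splitr r) ltrD//.
    by rewrite distrC (lt_trans Hy).
  by rewrite (le_lt_trans (ler_distD (g x) _ _))// (splitr e) ltrD// distrC.
move=> /(_ _ H) [].
move=> r /= r0 Hr; exists (r / 2); first by rewrite divr_gt0.
move=> x y Sx Hxy; apply: (Hr (r / 2)) Hxy => //=; last by rewrite divr_gt0.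
by rewrite sub0r normrN gtr0_norm ?divr_gt0// gtr_pMr// invf_lt1// ltr1n.
Qed.

(** The bound reaches slightly beyond [S] because the intermediate points of mean value arguments
    may leave it. *)
Lemma compact_bounded_near (g : V -> W) :
  (forall x, S x -> {for x, continuous g}) ->
  exists B r : R, [/\ 0 <= B, 0 < r &
    forall x y, S x -> `|y - x| < r -> `|g y| <= B].
Proof.
move=> gc.
have [r r0 Hr] := compact_unif_cont gc ltr01.
have /compact_near_coveringP cov := cS.
have := cov R (+oo%R) (fun B x => `|g x| <= B) _.
have H : forall x, S x -> \forall x' \near x & B \near +oo%R, `|g x'| <= B.
  move=> x Sx.
  exists (ball x r, [set u : R | `|g x| + 1 <= u]) => /=.
    by split; [exact: nbhsx_ballx | exact: nbhs_pinfty_ge].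
  move=> [x' u] /= [Hx' Hu]; apply: le_trans Hu.
  rewrite -ball_normE /= in Hx'; rewrite distrC in Hx'.
  rewrite -lerBlDl (le_trans (lerB_dist _ _))// ltW//.
  exact: Hr.
move=> /(_ _ H) [B0 [_ HB0]].
exists (`|B0| + 2), r; split=> // x y Sx yx.
rewrite -[g y](subrK (g x)) (le_trans (ler_normD _ _))//.
have := Hr _ _ Sx yx => /ltW h1.
have : `|g x| <= `|B0| + 1.
  by apply: HB0 => //=; rewrite (le_lt_trans (ler_norm _))// ltrDl.
lra.
Qed.

End compactness.

Section mvt.
Variables (R : realType) (V : normedModType R).

Lemma is_derive_line (f : V -> R) (a v : V) (u : R) :
  derivable f (a + u *: v) v ->
  is_derive u 1 (fun u => f (a + u *: v)) ('D_v f (a + u *: v)).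
Proof.
move=> df; have := @derivableP _ _ _ f (a + u *: v) v df.
have E : (fun h : R => h^-1 *: (((fun u => f (a + u *: v)) \o shift u) (h *: 1) - f (a + u *: v)))
  = (fun h : R => h^-1 *: ((f \o shift (a + u *: v)) (h *: v) - f (a + u *: v))).
  apply/funext => h /=; congr (_ *: (f _ - _)).
  by rewrite [h%:A]mulr1 scalerDl addrCA.
move=> [d1 d2]; split.
  by rewrite /derivable E.
by rewrite /derive E.
Qed.

(** The segment is parametrized by [0, 1] and not by [0, t], so that [t] may have either sign. *)
Lemma mvt_dir (f : V -> R) (a v : V) (t : R) :
  (forall s, 0 <= s <= 1 -> derivable f (a + (s * t) *: v) v) ->
  exists2 s, 0 <= s <= 1 & f (a + t *: v) - f a = t * 'D_v f (a + (s * t) *: v).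
Proof.
move=> df.
have dg (s : R) : 0 <= s <= 1 ->
    is_derive s 1 (fun s => f (a + (s * t) *: v)) (t * 'D_v f (a + (s * t) *: v)).
  move=> s01.
  have D1 : is_derive (s * t) 1 (fun u => f (a + u *: v)) ('D_v f (a + (s * t) *: v)).
    exact/is_derive_line/df.
  have D2 : is_derive s 1 (fun s : R => s * t) t.
    have : is_derive s 1 (t \*: (id : R -> R)) (t *: 1) by apply: is_deriveZ.
    rewrite [t *: 1]mulr1.
    suff -> : (fun s : R => s * t) = (t \*: (id : R -> R)) by [].
    by apply/funext => z; rewrite /= mulrC.
  have := @is_derive1_comp R (fun u => f (a + u *: v)) (fun s : R => s * t) s _ _ D1 D2.
  by rewrite mulrC.
have [c c01 Hc] : exists2 c, c \in `]0, 1[%R &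
  f (a + (1 * t) *: v) - f (a + (0 * t) *: v) = t * 'D_v f (a + (c * t) *: v) * (1 - 0).
  apply: (@MVT R (fun s => f (a + (s * t) *: v))
     (fun s => t * 'D_v f (a + (s * t) *: v)) 0 1 ltr01).
    by move=> x; rewrite in_itv /= => /andP[x0 x1]; apply: dg; rewrite !ltW.
  apply: derivable_within_continuous => x; rewrite in_itv /= => x01.
  by have [] := dg x x01.
move: c01; rewrite in_itv /= => /andP[c0 c1].
exists c; first by rewrite !ltW.
by move: Hc; rewrite mul1r mul0r scale0r addr0 subr0 mulr1.
Qed.

End mvt.

Lemma ler_mxnorm (R : realType) m n (v : 'M[R]_(m, n)) (B : R) : 0 <= B ->
  (forall i j, `|v i j| <= B) -> `|v| <= B.
Proof.
move=> B0 H; rewrite [leLHS]/Num.norm /= mx_normrE; apply/bigmax_leP; split => // -[i j] _; apply: H.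
Qed.

Lemma mxnorm_ge (R : realType) m n (v : 'M[R]_(m, n)) i j : `|v i j| <= `|v|.
Proof.
by rewrite [leRHS]/Num.norm /= mx_normrE; apply/bigmax_geP; right; exists (i, j).
Qed.

Lemma row_sum_dlt (R : realType) d (v : vec R d) : v = \sum_x v 0 x *: dlt R x.
Proof. exact: row_sum_delta. Qed.

(** Telescoping along the path that changes one coordinate at a time, since [C1_on] speaks of
    partial derivatives only. The price is one intermediate point per coordinate; in the max norm
    all of them stay within [|v|] of [mu]. *)
Lemma mvt_coord (R : realType) d (f : vec R d -> R) (mu v : vec R d) :
  (forall nu : vec R d, `|nu - mu| <= `|v| -> forall x, derivable f nu (dlt R x)) ->
  exists xi : 'I_d -> vec R d, (forall x, `|xi x - mu| <= `|v|) /\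
    f (mu + v) - f mu = \sum_x v 0 x * pder x f (xi x).
Proof.
move=> df.
pose w (k : nat) : vec R d := mu + \sum_(x < d | (x < k)%N) v 0 x *: dlt R x.
have wS (x : 'I_d) : w x.+1 = w x + v 0 x *: dlt R x.
  rewrite /w -addrA; congr (_ + _).
  rewrite (bigD1 x) //= addrC; congr (_ + _).
  by apply: eq_bigl => y; rewrite ltnS ltn_neqAle andbC.
have wn (x : 'I_d) (s : R) : 0 <= s <= 1 -> `|w x + (s * v 0 x) *: dlt R x - mu| <= `|v|.
  move=> /andP[s0 s1]; apply: ler_mxnorm => // i j.
  rewrite ord1 /w addrAC [mu + _]addrC addrK !mxE /= summxE.
  have E : \sum_(i0 < d | (i0 < x)%N) (v 0 i0 *: dlt R i0) 0 j = if (j < x)%N then v 0 j else 0.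
    rewrite (eq_bigr (fun y => if y == j then v 0 j else 0)); last first.
      move=> y _; rewrite !mxE eqxx /= eq_sym; case: eqP => [->|_]; first by rewrite mulr1.
      by rewrite mulr0.
    rewrite -big_mkcondr /=; case: ifP => jx.
      by rewrite (bigD1 j) ?jx ?eqxx //= big1 ?addr0 // => y /andP[/andP[_ ->]].
    by rewrite big1 // => y /andP[+ /eqP yj]; rewrite yj jx.
  rewrite E; case: ifP => jx.
    case: eqP => [ej|_]; first by rewrite ej ltnn in jx.
    by rewrite mulr0 addr0 mxnorm_ge.
  rewrite add0r; case: eqP => [_|_]; last by rewrite mulr0 normr0 normr_ge0.
  rewrite mulr1 normrM ger0_norm // (le_trans _ (mxnorm_ge v 0 x)) //.
  by rewrite ler_piMl.
have step (x : 'I_d) : exists s : R, 0 <= s <= 1 /\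
    f (w x.+1) - f (w x) = v 0 x * pder x f (w x + (s * v 0 x) *: dlt R x).
  have [|s s01 Hs] := @mvt_dir R _ f (w x) (dlt R x) (v 0 x).
    by move=> s s01; apply: df; apply: wn.
  by exists s; split => //; rewrite wS Hs.
have [s Hs] := choice step.
exists (fun x : 'I_d => w x + (s x * v 0 x) *: dlt R x); split.
  by move=> x; apply: wn; case: (Hs x).
have -> : mu + v = w d.
  rewrite /w {1}[v]row_sum_dlt; congr (_ + _); apply: eq_bigl => x.
  by rewrite ltn_ord.
have -> : mu = w 0%N by rewrite /w big_pred0 ?addr0.
rewrite -(telescope_sumr (fun k => f (w k)) (leq0n d)) big_mkord.
by apply: eq_bigr => x _; case: (Hs x).
Qed.

(** * Flows as limits of Euler polygons *)

Lemma near_mul_harmonic_lt (R : realType) (K e : R) : 0 < e ->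
  \forall n \near \oo, K * n.+1%:R^-1 < e.
Proof.
move=> e0.
have : K * harmonic n @[n --> \oo] --> K * 0 by apply: cvgMr; exact: cvg_harmonic.
rewrite mulr0 => /cvgr_lt; exact.
Qed.

Lemma ler_dist_step (R : realDomainType) (V : normedZmodType R)
    (x' x p y' y q : V) :
  `|x' - y'| <= `|x' - x - p| + `|x - y| + `|p - q| + `|y' - y - q|.
Proof.
have -> : x' - x - p = x' - (x + p) by rewrite opprD addrA.
have -> : y' - y - q = y' - (y + q) by rewrite opprD addrA.
have h1 := ler_distD (x + p) x' y'; have h2 := ler_distD (y + q) (x + p) y'.
have h3 : `|x + p - (y + q)| <= `|x - y| + `|p - q|.
  by rewrite opprD addrACA ler_normD.
rewrite [`|y + q - y'|]distrC in h2.
lra.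
Qed.

Section flow.
Variables (R : realType) (V : completeNormedModType R) (S : set V) (b : V -> V).
Variables (L B h0 : R).
Hypothesis Sclosed : closed S.
Hypothesis L0 : 0 <= L.
Hypothesis B0 : 0 <= B.
Hypothesis bL : forall x y, S x -> S y -> `|b x - b y| <= L * `|x - y|.
Hypothesis bB : forall x, S x -> `|b x| <= B.
Hypothesis h00 : 0 < h0.
Hypothesis Sinv : forall h x, 0 <= h <= h0 -> S x -> S (x + h *: b x).

(* [dl] is the mesh: an Euler polygon, taken piecewise constant in time, is
   consistent with the equation only up to its step. *)
Definition consistent (C dl : R) (X : R -> V) :=
  (forall t, 0 <= t -> S (X t)) /\
  (forall t s, 0 <= t -> 0 <= s ->
     `|X (t + s) - X t - s *: b (X t)| <= C * (s ^+ 2 + dl)).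

(** Discrete Gronwall over [n.+1] steps of length [t / n.+1], each adding a defect
    [2 * C * (s ^+ 2 + dl)]. The number of steps is a free parameter: the quadratic part decreases
    with [n] and the mesh part increases, so [n] is chosen first and [dl] small afterwards. *)
Lemma consistent_gronwall C dl X Y (t : R) n :
  0 <= C -> 0 <= dl -> consistent C dl X -> consistent C dl Y -> 0 <= t ->
  `|X t - Y t| <= expR (L * t) *
     (`|X 0 - Y 0| + 2 * C * (t ^+ 2 / n.+1%:R + n.+1%:R * dl)).
Proof.
move=> C0 dl0 [XS HX] [YS HY] t0.
pose s := t / n.+1%:R.
have n0 : 0 < n.+1%:R :> R by rewrite ltr0n.
have s0 : 0 <= s by rewrite divr_ge0 // ltW.
pose a := `|X 0 - Y 0|; pose c := 2 * C * (s ^+ 2 + dl).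
have c0 : 0 <= c by rewrite /c !mulr_ge0 // addr_ge0 // sqr_ge0.
have q1 : 1 <= 1 + L * s by rewrite lerDl mulr_ge0.
have H k : `|X (k%:R * s) - Y (k%:R * s)| <= (1 + L * s) ^+ k * (a + k%:R * c).
  elim: k => [|k IH]; first by rewrite !mul0r expr0 mul1r addr0.
  set tk := k%:R * s in IH *.
  have tk0 : 0 <= tk by rewrite mulr_ge0.
  have -> : k.+1%:R * s = tk + s by rewrite -natr1 mulrDl mul1r.
  apply: (le_trans (ler_dist_step _ (X tk) (s *: b (X tk)) _ (Y tk) (s *: b (Y tk)))).
  have h1 := HX tk s tk0 s0; have h2 := HY tk s tk0 s0.
  rewrite -scalerBr normrZ ger0_norm //.
  have h3 : s * `|b (X tk) - b (Y tk)| <= s * (L * `|X tk - Y tk|).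
    by rewrite ler_wpM2l // bL; auto.
  have h4 : (1 + L * s) * `|X tk - Y tk| <= (1 + L * s) ^+ k.+1 * (a + k%:R * c).
    by rewrite exprS -mulrA ler_wpM2l // (le_trans _ q1).
  have h5 : c <= (1 + L * s) ^+ k.+1 * c by rewrite ler_peMl // exprn_ege1.
  have -> : (1 + L * s) ^+ k.+1 * (a + k.+1%:R * c) =
     (1 + L * s) ^+ k.+1 * (a + k%:R * c) + (1 + L * s) ^+ k.+1 * c.
    by rewrite -natr1; ring.
  move: h1 h2 h3 h4 h5; rewrite {2}/c => h1 h2 h3 h4 h5.
  by nra.
have := H n.+1; rewrite /s mulrCA mulfV ?gt_eqF // mulr1 => /le_trans; apply.
apply: ler_pM.
- by rewrite exprn_ge0 // (le_trans _ q1).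
- exact: addr_ge0 (normr_ge0 _) (mulr_ge0 (ler0n _ _) c0).
- have -> : L * t = n.+1%:R * (L * s).
    by rewrite /s mulrCA [n.+1%:R * _]mulrCA mulfV ?gt_eqF // mulr1.
  rewrite expRM_natl; apply: lerXn2r; rewrite ?nnegrE ?expR_ge0 ?expR_ge1Dx //.
  exact: le_trans _ q1.
- rewrite lerD2l /c /s; rewrite le_eqVlt; apply/orP; left; apply/eqP.
  by field; rewrite gt_eqF.
Qed.

Definition estep (h : R) (x : V) : V := x + h *: b x.

Lemma iter_estepS h k x : 0 <= h <= h0 -> S x -> S (iter k (estep h) x).
Proof. by move=> hh Sx; elim: k => //= k IH; apply: Sinv. Qed.

Lemma iter_estep_dist h k x : 0 <= h <= h0 -> S x ->
  `|iter k (estep h) x - x| <= k%:R * h * B.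
Proof.
move=> hh Sx; have h_ge0 : 0 <= h by case/andP: hh.
elim: k => [|k IH] /=; first by rewrite subrr normr0 !mul0r.
rewrite {1}/estep addrAC (le_trans (ler_normD _ _)) // normrZ ger0_norm //.
have := ler_wpM2l h_ge0 (bB (iter_estepS k hh Sx)).
by rewrite -natr1 !mulrDl mul1r => H; rewrite lerD.
Qed.

(** The drift varies by at most [L] times the distance travelled, hence an error quadratic in the
    total time [k * h], uniformly in the mesh. *)
Lemma iter_estep_lin h k x : 0 <= h <= h0 -> S x ->
  `|iter k (estep h) x - x - (k%:R * h) *: b x| <= L * B * (k%:R * h) ^+ 2.
Proof.
move=> hh Sx; have h_ge0 : 0 <= h by case/andP: hh.
elim: k => [|k IH] /=.
  by rewrite subrr mul0r scale0r subr0 normr0 expr0n /= mulr0.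
rewrite {1}/estep.
have -> : iter k (estep h) x + h *: b (iter k (estep h) x) - x - (k.+1%:R * h) *: b x =
  (iter k (estep h) x - x - (k%:R * h) *: b x) + h *: (b (iter k (estep h) x) - b x).
  rewrite -natr1 [(k%:R + 1) * _]mulrDl mul1r [(_ + h) *: _]scalerDl opprD scalerBr.
  by rewrite [in LHS](addrAC _ (h *: _)) -!addrA; congr (_ + (_ + _)); rewrite addrCA.
rewrite (le_trans (ler_normD _ _)) // normrZ ger0_norm //.
have h1 := ler_wpM2l h_ge0 (bL (iter_estepS k hh Sx) Sx).
have h2 := ler_wpM2l (mulr_ge0 h_ge0 L0) (iter_estep_dist k hh Sx).
rewrite -natr1.
have k0 : 0 <= k%:R :> R by [].
have : 0 <= L * B * h ^+ 2 by rewrite !mulr_ge0.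
have : 0 <= L * B * h ^+ 2 * k%:R by rewrite !mulr_ge0.
move: IH h1 h2.
nra.
Qed.

Definition estep_path (h : R) (x : V) (t : R) : V :=
  iter (Num.truncn (t / h)) (estep h) x.

(** The number of steps made during [s] equals [s / h] up to rounding. Rounding costs at most
    [h * B], and it replaces [s ^+ 2] by at most [2 * (s ^+ 2 + h)] in [iter_estep_lin]; this gives
    the constant. *)
Lemma estep_path_consistent h x : 0 < h <= h0 -> h <= 1 -> S x ->
  consistent (2 * L * B + B) h (estep_path h x).
Proof.
move=> /andP[hp hh0] h1 Sx; have hh : 0 <= h <= h0 by rewrite hh0 ltW.
split=> [t t0|t s t0 s0]; first exact: iter_estepS.
rewrite /estep_path; set k := Num.truncn (t / h); set k' := Num.truncn _.
have /andP[k1 k2] : k%:R <= t / h < k.+1%:R.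
  by apply: truncn_itv; rewrite divr_ge0 // ltW.
have /andP[k3 k4] : k'%:R <= (t + s) / h < k'.+1%:R.
  by apply: truncn_itv; rewrite divr_ge0 ?addr_ge0 // ltW.
have kk' : (k <= k')%N.
  by apply: le_truncn; rewrite ler_pM2r ?invr_gt0 // lerDl.
rewrite -(subnK kk'); set j := (k' - k)%N.
rewrite iterD; set y := iter k _ x.
have Sy : S y by apply: iter_estepS.
have jh : `|j%:R * h - s| <= h.
  rewrite /j natrB //.
  move: k1 k2 k3 k4; rewrite ler_pdivlMr // ltr_pdivrMr // ler_pdivlMr // ltr_pdivrMr //.
  rewrite -!natr1 ler_norml => *; apply/andP; split; lra.
have jh0 : 0 <= j%:R * h by rewrite mulr_ge0 // ltW.
have -> : iter j (estep h) y - y - s *: b y =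
  (iter j (estep h) y - y - (j%:R * h) *: b y) + (j%:R * h - s) *: b y.
  by rewrite scalerBl addrA subrK.
rewrite (le_trans (ler_normD _ _)) // normrZ.
have H1 := iter_estep_lin j hh Sy.
have H2 : `|j%:R * h - s| * `|b y| <= h * B by apply: ler_pM => //; apply: bB.
have H3 : (j%:R * h) ^+ 2 <= 2 * (s ^+ 2 + h).
  have : j%:R * h <= s + h by move: jh; rewrite ler_norml => /andP[_]; lra.
  move=> H; have : (j%:R * h) ^+ 2 <= (s + h) ^+ 2.
    by apply: lerXn2r; rewrite ?nnegrE // (le_trans jh0).
  have : h ^+ 2 <= h by rewrite expr2 ler_piMr // ltW.
  have := sqr_ge0 (s - h); lra.
have H4 := ler_wpM2l (mulr_ge0 L0 B0) H3.
have H5 : 0 <= B * s ^+ 2 by rewrite mulr_ge0 // sqr_ge0.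
nra.
Qed.

Let C := 2 * L * B + B.
Let C0 : 0 <= C. Proof. by rewrite addr_ge0 // !mulr_ge0. Qed.

Let hm (m : nat) : R := Num.min h0 1 * harmonic m.

Let hm_gt0 m : 0 < hm m.
Proof. by rewrite mulr_gt0 ?invr_gt0 ?ltr0n // lt_min h00 ltr01. Qed.

Let hm_le m n : (m <= n)%N -> hm n <= hm m.
Proof.
move=> mn; apply: ler_wpM2l; first by rewrite le_min ler01 ltW.
by rewrite /harmonic lef_pV2 ?posrE ?ltr0n // ler_nat.
Qed.

Let hm_min m : 0 < hm m <= h0 /\ hm m <= 1.
Proof.
have H : hm m <= Num.min h0 1.
  apply: ler_piMr; first by rewrite le_min ler01 ltW.
  by rewrite /harmonic invf_le1 ?ltr0n // ler1n.
by move: H; rewrite le_min hm_gt0 => /andP[].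
Qed.

Let consistent_le c dl dl' X : 0 <= c -> dl <= dl' -> consistent c dl X -> consistent c dl' X.
Proof.
move=> c0 dd [XS HX]; split => // t s t0 s0.
by rewrite (le_trans (HX t s t0 s0)) // ler_wpM2l // lerD2l.
Qed.

Let pathC m x : S x -> consistent C (hm m) (estep_path (hm m) x).
Proof. by move=> Sx; have [? ?] := hm_min m; apply: estep_path_consistent. Qed.

Lemma estep_path0 h x : estep_path h x 0 = x.
Proof. by rewrite /estep_path mul0r truncn0. Qed.

(** Two polygons are both consistent at the coarser of their meshes, so [consistent_gronwall]
    compares them directly and yields a Cauchy sequence. *)
Lemma estep_path_cvg x t : S x -> 0 <= t -> cvg (estep_path (hm m) x t @[m --> \oo]).
Proof.
move=> Sx t0; apply/cauchy_cvgP/cauchy_exP => e e0.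
pose K := expR (L * t) * (2 * C).
have K0 : 0 <= K by rewrite mulr_ge0 ?expR_ge0 // mulr_ge0.
have e20 : 0 < e / 2 by rewrite divr_gt0.
have [n _ Hn] := near_mul_harmonic_lt (K * t ^+ 2) e20.
have [M _ HM] := near_mul_harmonic_lt (K * n.+1%:R * Num.min h0 1) e20.
exists (estep_path (hm M) x t); exists M => // m /= Mm.
rewrite -ball_normE /=.
have cM : consistent C (hm M) (estep_path (hm M) x).
  exact: pathC.
have cm : consistent C (hm M) (estep_path (hm m) x).
  by apply: (consistent_le C0 (hm_le Mm)); apply: pathC.
have H := @consistent_gronwall C (hm M) _ _ t n C0 (ltW (hm_gt0 M)) cM cm t0.
apply: le_lt_trans H _.
have h1 := Hn n (leqnn n); have h2 := HM M (leqnn M); rewrite /= in h1 h2.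
rewrite !estep_path0 subrr normr0 add0r mulrA -/K mulrDr (splitr e) ltrD //.
  by rewrite mulrA.
by rewrite mulrA /hm mulrA.
Qed.

(** Consistency with mesh 0, a defect quadratic in the time step, replaces the differential equation
    throughout the sequel. The Lipschitz dependence on the starting point is [consistent_gronwall]
    with [dl = 0], the number of steps going to infinity. *)
Lemma flow_exists : exists (Phi : R -> V -> V) (c : R),
  [/\ 0 <= c, forall x, S x -> Phi 0 x = x,
     forall x, S x -> consistent c 0 (Phi ^~ x) &
     forall t x y, 0 <= t -> S x -> S y ->
       `|Phi t x - Phi t y| <= expR (L * t) * `|x - y|].
Proof.
pose Phi t x := lim (estep_path (hm m) x t @[m --> \oo]).
have Phicvg x t : S x -> 0 <= t -> estep_path (hm m) x t @[m --> \oo] --> Phi t x.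
  by move=> *; apply: estep_path_cvg.
have Phi0 x : S x -> Phi 0 x = x.
  move=> Sx; rewrite /Phi; under eq_fun do rewrite estep_path0.
  exact: lim_cst.
have PhiS x t : S x -> 0 <= t -> S (Phi t x).
  move=> Sx t0; apply: (closed_cvg S Sclosed _ _ (Phicvg x t Sx t0)).
  by near=> m; have [+ _] := pathC m Sx; apply.
have Phicons x : S x -> consistent C 0 (Phi ^~ x).
  move=> Sx; split=> [t t0|t s t0 s0]; first exact: PhiS.
  have ts0 : 0 <= t + s by rewrite addr_ge0.
  have bc : b (estep_path (hm m) x t) @[m --> \oo] --> b (Phi t x).
    apply/cvgrPdist_le => e e0.
    have L10 : 0 < L + 1 by rewrite ltr_wpDl.
    have := Phicvg x t Sx t0 => /cvgr_dist_le /(_ (e / (L + 1)) (divr_gt0 e0 L10)).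
    apply: filterS => m Hm.
    have Sm : S (estep_path (hm m) x t).
      by have [+ _] := pathC m Sx; apply.
    rewrite (le_trans (bL (PhiS _ _ Sx t0) Sm)) //.
    rewrite (@le_trans _ _ ((L + 1) * (e / (L + 1)))) //.
      by apply: ler_pM => //; rewrite lerDl.
    by rewrite mulrCA mulfV ?gt_eqF // mulr1.
  have lhs : `|estep_path (hm m) x (t + s) - estep_path (hm m) x t -
      s *: b (estep_path (hm m) x t)| @[m --> \oo] -->
      `|Phi (t + s) x - Phi t x - s *: b (Phi t x)|.
    apply: cvg_norm; apply: cvgB; first by apply: cvgB; exact: Phicvg.
    by apply: cvgZr.
  have rhs : C * (s ^+ 2 + hm m) @[m --> \oo] --> C * (s ^+ 2 + 0).
    apply: cvgMr; apply: cvgD; first exact: cvg_cst.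
    rewrite -[X in _ --> X](mulr0 (Num.min h0 1)); apply: cvgMr.
    exact: cvg_harmonic.
  apply: (ler_cvg_to lhs rhs); near=> m.
  by have [_ +] := pathC m Sx; apply.
exists Phi, C; split => // t x y t0 Sx Sy.
apply/ler_addgt0Pr => e e0.
pose K := expR (L * t) * (2 * C).
have [n _ Hn] := near_mul_harmonic_lt (K * t ^+ 2) e0.
have := @consistent_gronwall C 0 (Phi ^~ x) (Phi ^~ y) t n C0 (lexx _)
   (Phicons x Sx) (Phicons y Sy) t0.
move=> /le_trans; apply; rewrite !Phi0 // mulr0 addr0 mulrDr lerD2l.
have := Hn n (leqnn n) => /= /ltW; rewrite /K.
by rewrite !mulrA.
Unshelve. all: by end_near. Qed.

End flow.

(** * Relative entropy and finite Markov chains *)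

Lemma ln_le_sub1 (R : realType) (u : R) : 0 < u -> ln u <= u - 1.
Proof.
move=> u0; have := @le_ln1Dx R (u - 1); rewrite [1 + _]addrC subrK; apply.
by rewrite ltrBrDl subrr.
Qed.

Lemma ler_sum_norm1 (R : numDomainType) (I : finType) (F : I -> R) i :
  `|F i| <= \sum_j `|F j|.
Proof. by rewrite (bigD1 i) //= lerDl sumr_ge0. Qed.

Section xlnx.
Variable R : realType.

Definition xlnx (x : R) : R := x * ln x.

Lemma xlnx_small (x : R) : 0 < x -> x <= 1 -> `|xlnx x| <= 2 * Num.sqrt x.
Proof.
move=> x0 x1; rewrite /xlnx ler0_norm; last by rewrite mulr_ge0_le0 ?ln_le0 // ltW.
set s := Num.sqrt x.
have s0 : 0 < s by rewrite sqrtr_gt0.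
have xs : x = s ^+ 2 by rewrite sqr_sqrtr // ltW.
have H : - ln s <= s^-1.
  rewrite -lnV ?posrE // (le_trans (ln_le_sub1 _)) ?invr_gt0 //.
  by rewrite lerBlDr lerDl.
rewrite xs expr2 lnM ?posrE //.
have -> : - (s * s * (ln s + ln s)) = 2 * (s * (s * - ln s)) by ring.
rewrite ler_pM2l //; apply: ler_piMr (ltW s0) _.
by have := ler_wpM2l (ltW s0) H; rewrite mulfV ?gt_eqF //.
Qed.

(** As [ln] is 0 on nonpositive reals, [xlnx] vanishes there and carries the convention 0 ln 0 = 0;
    only the limit at 0 from the right takes work, by the square root bound. *)
Lemma xlnx_continuous : continuous xlnx.
Proof.
move=> x; have [x0|x0|<-] := ltgtP 0 x.
- by apply: cvgM; [exact: cvg_id | exact: continuous_ln].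
- have : (cst (0 : R)) y @[y --> x] --> xlnx x.
    by rewrite /xlnx ln0 ?mulr0 ?ltW //; exact: cvg_cst.
  apply: cvg_trans; apply: near_eq_cvg.
  near=> y; rewrite /xlnx ln0 ?mulr0 //.
  by rewrite ltW //; near: y; apply: lt_nbhsl.
- rewrite /continuous_at /xlnx mul0r; apply/cvgrPdist_le => e e0.
  near=> y; rewrite sub0r normrN.
  have [y0|y0] := leP y 0; first by rewrite ln0 // mulr0 normr0 ltW.
  apply: le_trans (xlnx_small y0 _) _.
    by rewrite ltW //; near: y; apply: lt_nbhsl.
  have ye : y < (e / 2) ^+ 2.
    by near: y; apply: lt_nbhsl; rewrite exprn_gt0 // divr_gt0.
  have : Num.sqrt y <= e / 2.
    have e2 : 0 <= e / 2 by rewrite divr_ge0 // ltW.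
    by rewrite -(ger0_norm e2) -sqrtr_sqr ler_wsqrtr // ltW.
  by rewrite ler_pdivlMr // mulrC.
Unshelve. all: by end_near. Qed.

End xlnx.

(** The convex function behind relative entropy lies above its tangent at the ratio [u]. Taking
    [u = 1] gives positivity of [kl]. *)
Lemma kl_term_ge (R : realType) (a b u : R) : 0 <= a -> 0 <= b -> (b = 0 -> a = 0) -> 0 < u ->
  a * ln u + a - b * u <= a * ln (a / b).
Proof.
move=> a0 b0 ab u0.
have [->|an0] := eqVneq a 0.
  by rewrite !mul0r addr0 add0r oppr_le0 mulr_ge0 // ltW.
have ap : 0 < a by rewrite lt_neqAle eq_sym an0.
have bp : 0 < b.
  by rewrite lt_neqAle b0 andbT eq_sym; apply/eqP => /ab /eqP; rewrite (negbTE an0).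
have abp : 0 < a / b by rewrite divr_gt0.
have := ln_le_sub1 (divr_gt0 u0 abp); rewrite [ln (u / _)]ln_div ?posrE //.
move=> /(ler_wpM2l a0).
have -> : a * (u / (a / b) - 1) = b * u - a by field; rewrite an0 gt_eqF.
lra.
Qed.

(** Where [q] vanishes and [m] does not, the term is 0 and not infinite, because division by 0 and
    [ln 0] both give 0. Absolute continuity is therefore an explicit hypothesis of the lemmas. *)
Definition kl (R : realType) (T : finType) (m q : T -> R) : R :=
  \sum_x m x * ln (m x / q x).

Lemma kl_ge0 (R : realType) (T : finType) (m q : T -> R) : (forall x, 0 <= m x) -> (forall x, 0 <= q x) ->
  (forall x, q x = 0 -> m x = 0) -> \sum_x m x = \sum_x q x -> 0 <= kl m q.
Proof.
move=> m0 q0 mq mass.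
have : \sum_x (m x * ln 1 + m x - q x * 1) <= kl m q.
  by apply: ler_sum => x _; apply: kl_term_ge; rewrite // => /mq.
rewrite big_split /= big_split /= ln1.
under eq_bigr => x _ do rewrite mulr0.
by rewrite sumrN big1 // add0r mass; under [X in _ - X]eq_bigr do rewrite mulr1; rewrite subrr.
Qed.

Section finite_markov.
Variables (R : realType) (T : finType) (Q : T -> T -> R).

Definition mstep (h : R) (m : T -> R) : T -> R :=
  fun y => m y + h * \sum_x m x * Q x y.

Definition mker (h : R) (x y : T) : R := (x == y)%:R + h * Q x y.

Lemma mstepE h m y : mstep h m y = \sum_x m x * mker h x y.
Proof.
rewrite /mstep /mker mulr_sumr.
under [RHS]eq_bigr => x _ do rewrite mulrDr mulrCA.
rewrite big_split /=; congr (_ + _).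
rewrite (bigD1 y) //= eqxx mulr1 big1 ?addr0 // => x /negbTE ->.
by rewrite mulr0.
Qed.

(** Moves the step from the measure to the test function, on which the generator acts. *)
Lemma mstep_dual h m (g : T -> R) :
  \sum_y mstep h m y * g y = \sum_x m x * (g x + h * \sum_y Q x y * g y).
Proof.
rewrite /mstep; under eq_bigr => y _ do rewrite mulrDl -mulrA mulr_suml mulr_sumr.
rewrite big_split /= exchange_big /= -big_split /=; apply: eq_bigr => x _.
rewrite mulrDr; congr (_ + _); rewrite !mulr_sumr; apply: eq_bigr => y _; ring.
Qed.

Lemma mstep_lin h (I : finType) (a : I -> R) (m : I -> T -> R) :
  mstep h (fun y => \sum_i a i * m i y) = fun y => \sum_i a i * mstep h (m i) y.
Proof.
apply/funext => y; rewrite /mstep.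
under [RHS]eq_bigr => i _ do rewrite mulrDr.
rewrite big_split /=; congr (_ + _).
under eq_bigr => x _ do rewrite mulr_suml.
rewrite exchange_big mulr_sumr; apply: eq_bigr => i _ /=.
by rewrite mulrCA; congr (_ * _); rewrite mulr_sumr; apply: eq_bigr => x _; ring.
Qed.

Lemma iter_mstep_lin h k (I : finType) (a : I -> R) (m : I -> T -> R) :
  iter k (mstep h) (fun y => \sum_i a i * m i y) =
  fun y => \sum_i a i * iter k (mstep h) (m i) y.
Proof. by elim: k => //= k ->; rewrite mstep_lin. Qed.

Variables (M : R).
Hypothesis Qoff : forall x y, x != y -> 0 <= Q x y.
Hypothesis Qrow : forall x, \sum_y Q x y = 0.
Hypothesis QM : forall x, - M <= Q x x.

Section one_step.
Variable h : R.
Hypothesis h0 : 0 <= h.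
Hypothesis hM : h * M <= 1.

(** [M] bounds the exit rates, and [h * M <= 1] keeps the holding probability on the diagonal
    nonnegative: [mker h] is then a stochastic matrix. *)
Lemma mker_ge0 x y : 0 <= mker h x y.
Proof.
rewrite /mker; case: eqVneq => [<-|xy]; last by rewrite add0r mulr_ge0 // Qoff.
have := ler_wpM2l h0 (QM x); rewrite mulrN; move: hM; rewrite /=; lra.
Qed.

Lemma mker_row x : \sum_y mker h x y = 1.
Proof.
rewrite /mker big_split /= -mulr_sumr Qrow mulr0 addr0.
by rewrite (bigD1 x) //= eqxx big1 ?addr0 // => y; rewrite eq_sym => /negbTE ->.
Qed.

Lemma mstep_ge0 m : (forall x, 0 <= m x) -> forall y, 0 <= mstep h m y.
Proof.
by move=> m0 y; rewrite mstepE sumr_ge0 // => x _; rewrite mulr_ge0 // mker_ge0.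
Qed.

Lemma mstep_mass m : \sum_y mstep h m y = \sum_y m y.
Proof.
under eq_bigr => y _ do rewrite mstepE.
by rewrite exchange_big /=; apply: eq_bigr => x _; rewrite -mulr_sumr mker_row mulr1.
Qed.

Lemma mstep_norm (m q : T -> R) :
  \sum_y `|mstep h m y - mstep h q y| <= \sum_x `|m x - q x|.
Proof.
have H y : `|mstep h m y - mstep h q y| <= \sum_x `|m x - q x| * mker h x y.
  rewrite !mstepE -sumrB (le_trans (ler_norm_sum _ _ _)) // ler_sum // => x _.
  by rewrite -mulrBl normrM [X in _ * X]ger0_norm // mker_ge0.
rewrite (le_trans (ler_sum _ (fun y _ => H y))) // exchange_big /=.
by apply: ler_sum => x _; rewrite -mulr_sumr mker_row mulr1.
Qed.

End one_step.

(* Log-sum inequality, tangent-line form: each term is bounded below by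
   [kl_term_ge] at the ratio of the image masses. *)
Lemma kl_mstep h m q : 0 <= h -> h * M <= 1 -> (forall x, 0 <= m x) -> (forall x, 0 <= q x) ->
  (forall x, q x = 0 -> m x = 0) -> kl (mstep h m) (mstep h q) <= kl m q.
Proof.
move=> h0 hM m0 q0 mq.
have Hy y : mstep h m y * ln (mstep h m y / mstep h q y) <=
    \sum_x m x * ln (m x / q x) * mker h x y.
  have k0 x : 0 <= mker h x y by apply: mker_ge0.
  have := mstep_ge0 h0 hM m0 y; rewrite le_eqVlt => /predU1P[A0|Ap].
    rewrite -A0 mul0r.
    rewrite big1 // => x _.
    have : m x * mker h x y = 0.
      move: A0; rewrite mstepE => /esym/eqP; rewrite psumr_eq0.
        by move=> /allP /(_ x (mem_index_enum _)) /= /eqP.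
      by move=> z _; rewrite mulr_ge0.
    by rewrite mulrAC => ->; rewrite mul0r.
  have Bp : 0 < mstep h q y.
    rewrite lt_neqAle (mstep_ge0 h0 hM q0) andbT; apply/eqP => B0.
    suff : mstep h m y = 0 by move=> E; rewrite E ltxx in Ap.
    rewrite mstepE big1 // => x _.
    have : q x * mker h x y = 0.
      move: B0; rewrite mstepE => /esym/eqP; rewrite psumr_eq0.
        by move=> /allP /(_ x (mem_index_enum _)) /= /eqP.
      by move=> z _; rewrite mulr_ge0.
    by move=> /eqP; rewrite mulf_eq0 => /orP[/eqP/mq ->|/eqP ->]; rewrite ?mul0r ?mulr0.
  set A := mstep h m y in Ap *; set B := mstep h q y in Bp *.
  have : \sum_x (m x * ln (A / B) + m x - q x * (A / B)) * mker h x y <=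
     \sum_x m x * ln (m x / q x) * mker h x y.
    apply: ler_sum => x _; apply: ler_wpM2r => //; apply: kl_term_ge => //.
      exact: mq.
    exact: divr_gt0.
  apply: le_trans.
  under eq_bigr => x _ do rewrite mulrBl mulrDl mulrAC [q x * _ * _]mulrAC.
  rewrite !big_split /= sumrN -!mulr_suml -!mstepE -/A -/B.
  by rewrite mulrCA mulfV ?gt_eqF // mulr1 addrK.
rewrite /kl (le_trans (ler_sum _ (fun y _ => Hy y))) // exchange_big /=.
by apply: ler_sum => x _; rewrite -mulr_sumr mker_row ?mulr1.
Qed.

Section euler.
Variable c : R -> T -> R.
Hypothesis c01 : forall t x, 0 <= t -> 0 <= c t x <= 1.
Hypothesis cc : forall x, {within [set t : R | 0 <= t], continuous (fun s => c s x)}.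
Hypothesis cd : forall (t : R) y, 0 < t ->
  is_derive t 1 (fun s => c s y) (\sum_x c t x * Q x y).

Let M0 : R := \sum_x \sum_y `|Q x y|.

Let M00 : 0 <= M0.
Proof. by rewrite sumr_ge0 // => x _; rewrite sumr_ge0. Qed.

Let sumQ_le (u : T -> R) (B : R) y : 0 <= B -> (forall x, `|u x| <= B) ->
  `|\sum_x u x * Q x y| <= B * M0.
Proof.
move=> B0 uB; rewrite (le_trans (ler_norm_sum _ _ _)) // /M0 mulr_sumr.
apply: ler_sum => x _; rewrite normrM; apply: ler_pM => //.
exact: (ler_sum_norm1 (Q x)).
Qed.

(** The derivative is given at positive times only. The mean value theorem asks for it inside the
    interval, and one-sided continuity covers the start at 0. *)
Let c_mvt (t h : R) y : 0 <= t -> 0 < h ->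
  exists2 xi, t < xi < t + h & c (t + h) y - c t y = h * \sum_x c xi x * Q x y.
Proof.
move=> t0 h0.
have [] := @MVT R (fun s => c s y) (fun s => \sum_x c s x * Q x y) t (t + h).
- by rewrite ltrDl.
- by move=> x; rewrite in_itv /= => /andP[tx _]; apply: cd; apply: le_lt_trans tx.
- have sub : `[t, t + h] `<=` [set t : R | 0 <= t].
    by move=> x /=; rewrite in_itv /= => /andP[tx _]; apply: le_trans tx.
  exact: continuous_subspaceW sub (@cc y).
move=> xi; rewrite in_itv /= => xih H; exists xi => //.
by rewrite H addrAC subrr add0r mulrC.
Qed.

(** Two uses of [c_mvt]: one for the increment of [c], one to compare the velocity at the
    intermediate time with that at [t]. Each yields a factor [h * M0]. *)
Let c_step (t h : R) y : 0 <= t -> 0 <= h ->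
  `|c (t + h) y - mstep h (c t) y| <= M0 ^+ 2 * h ^+ 2.
Proof.
move=> t0; rewrite le_eqVlt => /predU1P[<-|h0].
  by rewrite /mstep addr0 mul0r addr0 subrr normr0 expr0n mulr0.
have [xi /andP[txi xih] H] := c_mvt y t0 h0.
rewrite /mstep opprD addrA H -mulrBr -sumrB.
under eq_bigr => x _ do rewrite -mulrBl.
rewrite normrM gtr0_norm //.
have D x : `|c xi x - c t x| <= h * M0.
  have h'0 : 0 < xi - t by rewrite subr_gt0.
  have [z /andP[tz _]] := c_mvt x t0 h'0.
  rewrite [t + _]addrC subrK => ->; rewrite normrM gtr0_norm //.
  apply: ler_pM => //; first by rewrite ltW.
    by rewrite lerBlDl ltW.
  rewrite -[leRHS]mul1r; apply: sumQ_le => // w.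
  have z0 : 0 <= z by rewrite ltW // (le_lt_trans t0).
  by have /andP[? ?] := c01 w z0; rewrite ger0_norm.
have := sumQ_le y (mulr_ge0 (ltW h0) M00) D => /(ler_wpM2l (ltW h0)) /le_trans; apply.
by rewrite le_eqVlt; apply/orP; left; apply/eqP; ring.
Qed.

Let euler_err k (h : R) : 0 <= h -> h * M <= 1 ->
  \sum_y `|c (k%:R * h) y - iter k (mstep h) (c 0) y| <=
  k%:R * (#|T|%:R * (M0 ^+ 2 * h ^+ 2)).
Proof.
move=> h0 hM; elim: k => [|k IH].
  by rewrite !mul0r big1 // => y _; rewrite /= subrr normr0.
have kh0 : 0 <= k%:R * h by rewrite mulr_ge0.
rewrite /= -natr1 mulrDl mul1r [leRHS]mulrDl mul1r.
rewrite (@le_trans _ _ (\sum_y (`|c (k%:R * h + h) y - mstep h (c (k%:R * h)) y| +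
  `|mstep h (c (k%:R * h)) y - mstep h (iter k (mstep h) (c 0)) y|))) //.
  by apply: ler_sum => y _; apply: ler_distD.
rewrite big_split /= addrC; apply: lerD.
  by rewrite (le_trans (mstep_norm h0 hM _ _)).
rewrite (le_trans (ler_sum _ (fun y _ => c_step y kh0 h0))) //.
by rewrite sumr_const -[leLHS]mulr_natl.
Qed.

(** Local errors quadratic in the step, accumulated without amplification by the contraction
    [mstep_norm], leave a total of order 1/n. *)
Lemma euler_cvg (t : R) y : 0 <= t ->
  iter n.+1 (mstep (t / n.+1%:R)) (c 0) y @[n --> \oo] --> c t y.
Proof.
move=> t0; apply/cvgrPdist_le => e e0.
near=> n.
have n0 : 0 < n.+1%:R :> R by rewrite ltr0n.
have h0 : 0 <= t / n.+1%:R by rewrite divr_ge0 // ltW.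
have hM : t / n.+1%:R * M <= 1.
  rewrite mulrAC ltW //; near: n; apply: near_mul_harmonic_lt; exact: ltr01.
have H := euler_err n.+1 h0 hM.
have E : n.+1%:R * (t / n.+1%:R) = t by rewrite mulrCA mulfV ?gt_eqF // mulr1.
rewrite E in H.
apply: le_trans (le_trans (ler_sum_norm1 (fun y => _ - _) y) H) _.
rewrite ltW //; have -> : n.+1%:R * (#|T|%:R * (M0 ^+ 2 * (t / n.+1%:R) ^+ 2)) =
   #|T|%:R * M0 ^+ 2 * t ^+ 2 * n.+1%:R^-1 by field; rewrite gt_eqF.
by near: n; apply: near_mul_harmonic_lt.
Unshelve. all: by end_near. Qed.

End euler.
End finite_markov.

(** * Configurations and their symmetrization *)

Section configurations.
Variables (R : realType) (d N : nat).
Notation config := (config d N).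
Implicit Types (bx bw : config).

Definition cnt bx (y : 'I_d) : nat := #|[pred i | bx i == y]|.

Lemma LNE bx y : LN R bx 0 y = (cnt bx y)%:R / N%:R.
Proof.
rewrite mxE; congr (_%:R / _); apply: eq_card => i.
by apply/idP/idP => [/set_mem|H]; [|exact/mem_set].
Qed.

Lemma big_cnt (V : nmodType) bx (f : 'I_d -> V) :
  \sum_i f (bx i) = \sum_x f x *+ cnt bx x.
Proof.
rewrite (partition_big bx predT) //=; apply: eq_bigr => x _.
rewrite (eq_bigr (fun _ => f x)) => [|i /eqP -> //].
by rewrite sumr_const.
Qed.

Lemma sum_cnt bx : (\sum_y cnt bx y = N)%N.
Proof.
have := big_cnt bx (fun=> 1%N); rewrite sum_nat_const card_ord muln1 => {1}->.
by apply: eq_bigr => x _; rewrite -[RHS]/(1 *+ cnt bx x)%R natn.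
Qed.

Lemma cnt_le bx y : (cnt bx y <= N)%N.
Proof. by rewrite -[leqRHS](sum_cnt bx) (bigD1 y) //= leq_addr. Qed.

Lemma LN_simplex bx : (0 < N)%N -> @simplex R d (LN R bx).
Proof.
move=> N0; split=> [y|]; first by rewrite LNE divr_ge0.
under eq_bigr do rewrite LNE.
rewrite -mulr_suml -natr_sum sum_cnt mulfV // pnatr_eq0.
by rewrite -lt0n.
Qed.

Definition upd bx (i : 'I_N) (y : 'I_d) : config := [ffun j => if j == i then y else bx j].

(** Stated additively to avoid truncated subtraction; it also covers [y = bx i]. *)
Lemma cnt_upd bx i y z : (cnt (upd bx i y) z + (bx i == z) = cnt bx z + (y == z))%N.
Proof.
have H (bw : config) : cnt bw z = ((bw i == z) + #|[pred j | (j != i) && (bw j == z)]|)%N.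
  rewrite /cnt (cardD1 i) inE; congr (_ + _)%N.
rewrite !H ffunE eqxx addnAC [RHS]addnAC; congr (_ + _)%N; first by rewrite addnC.
apply: eq_card => j; rewrite !inE ffunE.
by case: (j == i).
Qed.

Lemma LN_upd bx i y :
  LN R (upd bx i y) = LN R bx + N%:R^-1 *: (dlt R y - dlt R (bx i)).
Proof.
apply/rowP => z; rewrite LNE [RHS]mxE LNE !mxE /= mulrBr.
have /(congr1 (fun n => n%:R : R)) := cnt_upd bx i y z.
rewrite !natrD eq_sym [y == z]eq_sym => H.
have {H} -> : (cnt (upd bx i y) z)%:R = (cnt bx z)%:R + (z == y)%:R - (z == bx i)%:R :> R by lra.
by rewrite mulrBl mulrDl ![_ / N%:R]mulrC addrA.
Qed.

Variables (K : 'I_d -> vec R d -> R) (AN : nat -> vec R d -> 'M[R]_d).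

(** The diagonal entry turns values of [g] into differences, and the configurations contributing to
    [rateN] through particle [i] are exactly the [upd bx i y] with [y != bx i]. *)
Lemma bQN_gen bx (g : config -> R) :
  \sum_bw bQN K AN bx bw * g bw =
  \sum_i \sum_(y | y != bx i) QN K AN N (LN R bx) (bx i) y * (g (upd bx i y) - g bx).
Proof.
rewrite (bigD1 bx) //= {1}/bQN eqxx.
transitivity (\sum_(bw | bw != bx) rateN K AN bx bw * (g bw - g bx)).
  rewrite mulNr mulr_suml addrC -sumrB; apply: eq_bigr => bw bwx.
  by rewrite /bQN eq_sym (negbTE bwx) mulrBr.
under [LHS]eq_bigr => bw _ do rewrite /rateN mulr_suml.
rewrite exchange_big /=; apply: eq_bigr => i _.
transitivity (\sum_(bw : config | (bw i != bx i) && [forall j, (j != i) ==> (bw j == bx j)])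
   QN K AN N (LN R bx) (bx i) (bw i) * (g bw - g bx)).
  rewrite big_mkcond [RHS]big_mkcond /=; apply: eq_bigr => bw _.
  case: ifP => [_|/negbT]; first by case: ifP => _; rewrite ?mul0r.
  by rewrite negbK => /eqP ->; rewrite eqxx.
rewrite (reindex_onto (upd bx i) (fun bw => bw i)) /=.
  apply: eq_big => [y|y _]; last by rewrite ffunE eqxx.
  rewrite ffunE !eqxx andbT.
  have -> : [forall j, (j != i) ==> (upd bx i y j == bx j)]; last by rewrite andbT.
  by apply/forallP => j; apply/implyP => /negbTE ji; rewrite ffunE ji.
move=> bw /andP[_ /forallP H]; apply/ffunP => j; rewrite ffunE.
by case: eqP => [->//|/eqP ji]; have /implyP/(_ ji)/eqP := H j.
Qed.

(** Particles in the same state contribute equally and there are [N%:R * LN R bx 0 x] of them at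
    [x]: on functions of [LN] the generator is that of a jump process on the simplex. *)
Lemma bQN_gen_LN bx (G : vec R d -> R) : (0 < N)%N ->
  \sum_bw bQN K AN bx bw * G (LN R bw) =
  \sum_x \sum_(y | y != x) N%:R * LN R bx 0 x * QN K AN N (LN R bx) x y *
     (G (LN R bx + N%:R^-1 *: (dlt R y - dlt R x)) - G (LN R bx)).
Proof.
move=> N0; rewrite bQN_gen.
under eq_bigr => i _ do under eq_bigr => y _ do rewrite LN_upd.
rewrite (big_cnt bx (fun x => \sum_(y | y != x) QN K AN N (LN R bx) x y *
     (G (LN R bx + N%:R^-1 *: (dlt R y - dlt R x)) - G (LN R bx)))).
apply: eq_bigr => x _; rewrite -[LHS]mulr_natl mulr_sumr; apply: eq_bigr => y _.
rewrite !mulrA; congr (_ * _ * _).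
by rewrite LNE mulrCA mulfV ?mulr1 // pnatr_eq0 -lt0n.
Qed.

Lemma bQN_off bx bw : (forall x y, 0 <= AN N (LN R bx) x y) -> bx != bw ->
  0 <= bQN K AN bx bw.
Proof.
move=> A0 /negbTE xw; rewrite /bQN xw sumr_ge0 // => i _; case: ifP => // _.
by rewrite mulr_ge0 // expR_ge0.
Qed.

Lemma bQN_row bx : \sum_bw bQN K AN bx bw = 0.
Proof.
rewrite (bigD1 bx) //= {1}/bQN eqxx addrC; apply/eqP; rewrite subr_eq0; apply/eqP.
by apply: eq_bigr => bw; rewrite /bQN eq_sym => /negbTE ->.
Qed.

(** Precomposition is a left action here, since a product of permutations applies its left factor
    first. *)
Definition pact (s : {perm 'I_N}) bx : config := [ffun i => bx (s i)].

Lemma pactM s t bx : pact s (pact t bx) = pact (s * t)%g bx.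
Proof. by apply/ffunP => i; rewrite !ffunE permM. Qed.

Lemma pact1 bx : pact 1%g bx = bx.
Proof. by apply/ffunP => i; rewrite !ffunE perm1. Qed.

Lemma pactK s : cancel (pact s) (pact s^-1).
Proof. by move=> bx; rewrite pactM mulVg pact1. Qed.

Lemma pactVK s : cancel (pact s^-1) (pact s).
Proof. by move=> bx; rewrite pactM mulgV pact1. Qed.

Lemma big_pact (V : nmodType) s (F : config -> V) :
  \sum_bx F (pact s bx) = \sum_bx F bx.
Proof. by rewrite [RHS](reindex (pact s)) //; exists (pact s^-1) => bx _; rewrite ?pactK ?pactVK. Qed.

Lemma cnt_pact s bx : cnt (pact s bx) =1 cnt bx.
Proof.
move=> y; rewrite /cnt -[RHS](card_imset _ (@perm_inj _ s^-1%g)); apply: eq_card => i.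
rewrite !inE ffunE; apply/idP/imsetP => [H|[j]].
  by exists (s i); rewrite ?inE // permK.
by rewrite inE => H ->; rewrite permKV.
Qed.

Lemma LN_pact s bx : LN R (pact s bx) = LN R bx.
Proof. by apply/rowP => y; rewrite !LNE cnt_pact. Qed.

(** Exchangeability: a rate sees the configuration only through [LN], which is invariant, and
    through the old and new state of the moving particle, whose label is merely renamed. *)
Lemma rateN_pact s bx bw : rateN K AN (pact s bx) (pact s bw) = rateN K AN bx bw.
Proof.
rewrite /rateN [RHS](reindex_inj (@perm_inj _ s)); apply: eq_bigr => i _.
rewrite LN_pact !ffunE.
have -> : [forall j, (j != i) ==> (pact s bw j == pact s bx j)] =
   [forall j, (j != s i) ==> (bw j == bx j)]; last by [].
apply/forallP/forallP => H j; apply/implyP => ji.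
  have := H (s^-1%g j); rewrite !ffunE permKV => /implyP; apply.
  by apply: contra ji => /eqP <-; rewrite permKV.
rewrite !ffunE; have /implyP := H (s j); apply.
by apply: contra ji => /eqP/perm_inj ->.
Qed.

Lemma bQN_pact s bx bw : bQN K AN (pact s bx) (pact s bw) = bQN K AN bx bw.
Proof.
rewrite /bQN (can_eq (pactK s)); case: ifP => _; last exact: rateN_pact.
congr (- _); rewrite big_mkcond [RHS]big_mkcond -[LHS](big_pact s) /=.
by apply: eq_bigr => bz _; rewrite (can_eq (pactK s)) rateN_pact.
Qed.

(** The average runs over the whole group and not over orbits, so no stabilizer has to be
    counted. *)
Definition symm (m : config -> R) : config -> R :=
  fun bx => #|{perm 'I_N}|%:R^-1 * \sum_s m (pact s bx).

Let G0 : #|{perm 'I_N}|%:R != 0 :> R.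
Proof. by rewrite pnatr_eq0 -lt0n; apply/card_gt0P; exists 1%g. Qed.

Lemma symm_pact m s bx : symm m (pact s bx) = symm m bx.
Proof.
rewrite /symm; congr (_ * _); rewrite [RHS](reindex_inj (mulIg s)) /=.
by apply: eq_bigr => t _; rewrite pactM.
Qed.

Lemma symm_ge0 m : (forall bx, 0 <= m bx) -> forall bx, 0 <= symm m bx.
Proof. by move=> m0 bx; rewrite mulr_ge0 ?invr_ge0 // sumr_ge0. Qed.

(** The identity is among the permutations averaged. This supplies the absolute continuity that
    [kl m (symm m)] requires. *)
Lemma symm_eq0 m bx : (forall bx, 0 <= m bx) -> symm m bx = 0 -> m bx = 0.
Proof.
move=> m0 /eqP; rewrite mulf_eq0 invr_eq0 (negbTE G0) /= psumr_eq0 //.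
by move=> /allP/(_ 1%g (mem_index_enum _)) /=; rewrite pact1 => /eqP.
Qed.

Lemma sum_symm m (g : config -> R) : (forall s bx, g (pact s bx) = g bx) ->
  \sum_bx symm m bx * g bx = \sum_bx m bx * g bx.
Proof.
move=> gi; rewrite /symm.
under eq_bigr => bx _ do rewrite -mulrA mulr_suml.
rewrite -mulr_sumr exchange_big /=.
rewrite (eq_bigr (fun=> \sum_bx m bx * g bx)); last first.
  by move=> s _; rewrite -[RHS](big_pact s); apply: eq_bigr => bx _; rewrite gi.
by rewrite sumr_const -[X in _ * X = _]mulr_natl mulKf.
Qed.

Lemma symm_mstep h m : symm (mstep (bQN K AN (N := N)) h m) = mstep (bQN K AN (N := N)) h (symm m).
Proof.
apply/funext => bw; rewrite /symm.
transitivity (#|{perm 'I_N}|%:R^-1 * \sum_s mstep (bQN K AN (N := N)) h (m \o pact s) bw).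
  congr (_ * _); apply: eq_bigr => s _; rewrite /mstep /=; congr (_ + _ * _).
  by rewrite -(big_pact s); apply: eq_bigr => bx _; rewrite bQN_pact.
have -> : (fun bx => #|{perm 'I_N}|%:R^-1 * \sum_s m (pact s bx)) =
   (fun bx => \sum_s #|{perm 'I_N}|%:R^-1 * (m \o pact s) bx).
  by apply/funext => bx; rewrite mulr_sumr.
by rewrite mstep_lin mulr_sumr.
Qed.

(** [ln (symm m)] is permutation invariant, so [m] may be replaced by [symm m] in front of it. The
    resulting difference of entropies contains no quotient and is continuous up to zero masses,
    which allows limits in [m]. *)
Lemma kl_symmE m : (forall bx, 0 <= m bx) ->
  kl m (symm m) = \sum_bx xlnx (m bx) - \sum_bx xlnx (symm m bx).
Proof.
move=> m0; have -> : \sum_bx xlnx (symm m bx) = \sum_bx m bx * ln (symm m bx).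
  by apply: sum_symm => s bx; rewrite symm_pact.
rewrite -sumrB; apply: eq_bigr => bx _.
have := m0 bx; rewrite le_eqVlt => /predU1P[<-|mp]; first by rewrite /xlnx !mul0r subrr.
rewrite -mulrBr; congr (_ * _); rewrite ln_div ?posrE //.
rewrite lt_neqAle symm_ge0 // andbT eq_sym.
by apply/eqP => /(symm_eq0 m0) E; rewrite E ltxx in mp.
Qed.

Lemma kl_symm_ge0 m : (forall bx, 0 <= m bx) -> 0 <= kl m (symm m).
Proof.
move=> m0; apply: kl_ge0 => //; first exact: symm_ge0.
  by move=> bx; apply: symm_eq0.
have := @sum_symm m (fun=> 1) (fun _ _ => erefl).
by under eq_bigr do rewrite mulr1; under [RHS]eq_bigr do rewrite mulr1.
Qed.

Lemma master_sol_euler (c : R -> config -> R) : (0 < N)%N ->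
  (forall mu, @simplex R d mu -> irr_sym_nonneg (AN N mu)) -> master_sol K AN c ->
  exists M, [/\ forall bx bw, bx != bw -> 0 <= bQN K AN bx bw,
    forall bx, - M <= bQN K AN bx bx &
    forall t bx, 0 <= t ->
      iter n.+1 (mstep (bQN K AN (N := N)) (t / n.+1%:R)) (c 0) bx @[n --> \oo] --> c t bx].
Proof.
move=> N0 ANs [cp [cc cd]].
have Qoff bx bw : bx != bw -> 0 <= bQN K AN bx bw.
  apply: bQN_off; have [A0 _] := ANs _ (LN_simplex bx N0); exact: A0.
pose M := \sum_(bx : config) `|bQN K AN bx bx|.
have QM bx : - M <= bQN K AN bx bx.
  rewrite lerNl (le_trans (ler_norm _)) // normrN.
  exact: (ler_sum_norm1 (fun bx : config => bQN K AN bx bx)).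
have c01 (s : R) bx : 0 <= s -> 0 <= c s bx <= 1.
  move=> s0; have [c0 c1] := cp s s0; rewrite c0 /= -c1 (bigD1 bx) //= lerDl.
  by rewrite sumr_ge0.
exists M; split => // t bx t0.
exact: (@euler_cvg R _ _ M Qoff bQN_row QM c c01 cc (fun t y t0 => cd t t0 y) t bx t0).
Qed.

(** Along Euler steps [m] and [symm m] are moved by the same kernel, so [kl_mstep] applies at each
    step; [kl_symmE] and continuity of [xlnx] carry the inequality to the solution. *)
Lemma kl_symm_decreasing (c : R -> config -> R) t : (0 < N)%N ->
  (forall mu, @simplex R d mu -> irr_sym_nonneg (AN N mu)) ->
  master_sol K AN c -> 0 <= t -> kl (c t) (symm (c t)) <= kl (c 0) (symm (c 0)).
Proof.
move=> N0 ANs csol t0; have [cp _] := csol.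
have [M [Qoff QM /(_ t _ t0) ecvg]] := master_sol_euler N0 ANs csol.
pose p n := iter n.+1 (mstep (bQN K AN (N := N)) (t / n.+1%:R)) (c 0).
have p0 n : t / n.+1%:R * M <= 1 -> forall k bx, 0 <= iter k (mstep (bQN K AN (N := N)) (t / n.+1%:R)) (c 0) bx.
  move=> hM; elim=> [|k IH] bx /=; first by have [] := cp 0 (lexx _).
  by apply: (mstep_ge0 Qoff QM _ hM IH); rewrite divr_ge0.
have scvg bx : symm (p n) bx @[n --> \oo] --> symm (c t) bx.
  apply: cvgMl_tmp; apply: cvg_big => [|s _]; last exact: ecvg.
  exact: add_continuous.
have klcvg : (\sum_bx xlnx (p n bx) - \sum_bx xlnx (symm (p n) bx)) @[n --> \oo] -->
    kl (c t) (symm (c t)).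
  rewrite kl_symmE; last by have [] := cp t t0.
  apply: cvgB; (apply: cvg_big => [|bx _]; first exact: add_continuous).
    by apply: continuous_cvg; [exact: xlnx_continuous | exact: ecvg].
  by apply: continuous_cvg; [exact: xlnx_continuous | exact: scvg].
apply: (ler_cvg_to klcvg (cvg_cst (kl (c 0) (symm (c 0))))).
near=> n.
have hM : t / n.+1%:R * M <= 1.
  rewrite mulrAC ltW //; near: n; apply: near_mul_harmonic_lt; exact: ltr01.
rewrite -kl_symmE; last exact: p0.
have h0 : 0 <= t / n.+1%:R by rewrite divr_ge0.
have ph := p0 n hM; move: ph hM h0; rewrite /p; set h := t / _ => ph hM h0.
elim: (n.+1) => //= k IH.
apply: le_trans IH; rewrite symm_mstep.
apply: (kl_mstep Qoff bQN_row QM h0 hM (ph k)).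
- by apply: symm_ge0; exact: ph.
- by move=> bx; apply: symm_eq0; exact: ph.
Unshelve. all: by end_near. Qed.

End configurations.

(** * Type counting *)

Lemma ln_prod (R : realType) (I : finType) (F : I -> R) : (forall i, 0 < F i) ->
  ln (\prod_i F i) = \sum_i ln (F i).
Proof.
move=> F0; suff [] : 0 < \prod_i F i /\ ln (\prod_i F i) = \sum_i ln (F i) by [].
apply: (big_ind2 (fun a b => 0 < a /\ ln a = b)) => [|a x b y [a0 <-] [b0 <-]|i _] //.
  by rewrite ln1.
by rewrite mulr_gt0 // lnM ?posrE.
Qed.

Section stirling.
Variable R : realType.

Lemma ln_ratio_ge (a b : R) : 0 < a -> 0 < b -> 1 - a / b <= ln b - ln a.
Proof.
move=> a0 b0; have := ln_le_sub1 (divr_gt0 a0 b0).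
rewrite ln_div ?posrE //; lra.
Qed.

(** One half of a crude Stirling formula. Logarithmic errors suffice because everything is divided
    by N in the end. *)
Lemma ln_fact_ge n : xlnx (n%:R : R) - n%:R <= ln n`!%:R.
Proof.
elim: n => [|n IH]; first by rewrite /xlnx mul0r subr0 fact0 ln1.
rewrite factS natrM lnM ?posrE ?ltr0n ?fact_gt0 //.
move: IH; rewrite /xlnx -[n.+1%:R]natr1.
have [->|n0] := posnP n; first by rewrite !add0r ln1 mulr0 mul0r; lra.
have n0R : 0 < n%:R :> R by rewrite ltr0n.
have n1R : 0 < n%:R + 1 :> R by rewrite addr_gt0.
have := ln_ratio_ge n1R n0R => H.
have : n%:R * (ln (n%:R + 1) - ln n%:R) <= 1 :> R.
  have := ler_wpM2l (ltW n0R) H.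
  have -> : n%:R * (1 - (n%:R + 1) / n%:R) = -1 :> R by field; rewrite gt_eqF.
  lra.
lra.
Qed.

Lemma ln_fact_le n : ln n`!%:R <= xlnx (n%:R : R) - n%:R + 1 + 2 * ln n.+1%:R.
Proof.
elim: n => [|n IH]; first by rewrite /xlnx mul0r subr0 fact0 ln1 mulr0; lra.
rewrite factS natrM lnM ?posrE ?ltr0n ?fact_gt0 //.
move: IH; rewrite /xlnx -[n.+2%:R]natr1 -![n.+1%:R]natr1.
have n0R : 0 <= n%:R :> R by [].
have n1R : 0 < n%:R + 1 :> R by rewrite ltr_wpDl.
have n2R : 0 < n%:R + 1 + 1 :> R by rewrite ltr_wpDl // ltW.
have H2 := ln_ratio_ge n1R n2R.
have H1 : n%:R / (n%:R + 1) <= n%:R * (ln (n%:R + 1) - ln n%:R) :> R.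
  have [->|n0] := posnP n; first by rewrite !mul0r.
  have n0R' : 0 < n%:R :> R by rewrite ltr0n.
  have := ler_wpM2l n0R (ln_ratio_ge n0R' n1R).
  have -> // : n%:R * (1 - n%:R / (n%:R + 1)) = n%:R / (n%:R + 1) :> R.
  by field; rewrite gt_eqF.
(* Here the coefficient 2 of the logarithm is decided: 2/(n+2) makes up for the missing 1/(n+1),
   while 1/(n+2) would not. *)
have H3 : 1 <= n%:R / (n%:R + 1) + 2 * (1 - (n%:R + 1) / (n%:R + 1 + 1)) :> R.
  rewrite -subr_ge0.
  have -> : n%:R / (n%:R + 1) + 2 * (1 - (n%:R + 1) / (n%:R + 1 + 1)) - 1 =
     n%:R / ((n%:R + 1) * (n%:R + 1 + 1)) :> R.
    by field; rewrite !gt_eqF.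
  by rewrite divr_ge0 // mulr_ge0 // ltW.
lra.
Qed.

End stirling.

Section type_counting.
Variable d : nat.

Definition ccons N (x : 'I_d) (bw : config d N) : config d N.+1 :=
  [ffun i => if unlift ord0 i is Some j then bw j else x].

Lemma cnt_ccons N x (bw : config d N) y : cnt (ccons x bw) y = ((x == y) + cnt bw y)%N.
Proof.
rewrite /cnt -!sum1_card.
rewrite big_mkcond big_ord_recl /= inE /ccons ffunE unlift_none; congr (_ + _)%N.
rewrite [RHS]big_mkcond; apply: eq_bigr => i _.
by rewrite !inE ffunE liftK.
Qed.

Lemma card_ccons N (P : pred (config d N.+1)) :
  #|P| = (\sum_x #|[pred bw : config d N | P (ccons x bw)]|)%N.
Proof.
rewrite -sum1_card.
rewrite (reindex (fun p : 'I_d * config d N => ccons p.1 p.2)) /=.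
  rewrite (eq_bigl (fun p : 'I_d * config d N => P (ccons p.1 p.2))) //.
  rewrite -(pair_big_dep predT (fun x (bw : config d N) => P (ccons x bw)) (fun _ _ => 1%N)) /=.
  by apply: eq_bigr => x _; rewrite sum1_card.
exists (fun bw => (bw ord0, [ffun j => bw (lift ord0 j)])) => [[x bw]|bw] _ /=.
  rewrite ffunE unlift_none; congr (_, _); apply/ffunP => j.
  by rewrite !ffunE liftK.
by apply/ffunP => i; rewrite ffunE; case: unliftP => [j|] ->; rewrite ?ffunE.
Qed.

Definition type_class N (k : 'I_d -> nat) : pred (config d N) :=
  fun bw => [forall y, cnt bw y == k y].

(** The multinomial coefficient, written without division. Induction on the first particle: if it is
    in state [x], the others form the class with [k x] lowered by one, which contributes [k x * N!];
    the sum over [x] is [N.+1 * N!]. *)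
Lemma card_type_class N (k : 'I_d -> nat) : (\sum_y k y = N)%N ->
  (#|@type_class N k| * \prod_y (k y)`! = N`!)%N.
Proof.
elim: N k => [|N IH] k kN.
  have k0 y : k y = 0%N by apply/eqP; move/eqP: kN; rewrite sum_nat_eq0 => /forallP/(_ y)/implyP; exact.
  rewrite big1 => [|y _]; last by rewrite k0.
  rewrite muln1 fact0 (@eq_card _ _ predT); first by rewrite card_ffun !card_ord expn0.
  move=> bw; rewrite !inE; apply/forallP => y; rewrite k0 /cnt; apply/eqP.
  by apply: eq_card0 => -[].
rewrite card_ccons big_distrl /=.
rewrite (eq_bigr (fun x => k x * N`!))%N => [|x _].
  by rewrite -big_distrl /= kN factS.
have [kx0|kx] := posnP (k x).
  rewrite kx0 mul0n eq_card0 // => bw; rewrite !inE.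
  apply/negbTE/negP => /forallP/(_ x); rewrite cnt_ccons eqxx kx0 //.
pose k' y := (k y - (x == y))%N.
have k'N : (\sum_y k' y = N)%N.
  have E : (\sum_(i < d | i != x) k' i = \sum_(i < d | i != x) k i)%N.
    by apply: eq_bigr => y; rewrite /k' eq_sym => /negbTE ->; rewrite subn0.
  have E' : (k x + \sum_(i < d | i != x) k i = N.+1)%N by rewrite -kN [RHS](bigD1 x).
  rewrite (bigD1 x) //= E {1}/k' eqxx.
  by move: E' kx; set S := (\sum_(i < d | _) _)%N; lia.
rewrite -(IH k' k'N) mulnCA; congr (_ * _)%N.
  apply: eq_card => bw; rewrite !inE /type_class; apply: eq_forallb => y.
  rewrite cnt_ccons /k'; case: (eqVneq x y) => [<-|_]; last by rewrite subn0.
  by apply/eqP/eqP; lia.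
rewrite (bigD1 x) //= [in RHS](bigD1 x) //= mulnA; congr (_ * _)%N.
  by rewrite /k' eqxx subn1 -{1}(prednK kx) factS prednK.
by apply: eq_bigr => y; rewrite /k' eq_sym => /negbTE ->; rewrite subn0.
Qed.

End type_counting.

(** * Entropy of symmetrized laws through types *)

Section types.
Variables (R : realType) (d N : nat).
Hypothesis N0 : (0 < N)%N.
Notation config := (config d N).
Implicit Types (bx bw : config).

(** The occupation numbers as an element of a finite type of size [N.+1 ^ d], so that sums can be
    partitioned by type; [inord] loses nothing because counts are at most N. *)
Definition typ bx : {ffun 'I_d -> 'I_N.+1} := [ffun y => inord (cnt bx y)].

Lemma typP bx bw : reflect (cnt bx =1 cnt bw) (typ bx == typ bw).
Proof.
apply: (iffP eqP) => [/ffunP H y|H]; last by apply/ffunP => y; rewrite !ffunE H.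
by have := H y; rewrite !ffunE => /(congr1 val); rewrite /= !inordK // ltnS cnt_le.
Qed.

Lemma typ_LN bx bw : typ bx == typ bw -> LN R bx = LN R bw.
Proof. by move/typP => H; apply/rowP => y; rewrite !LNE H. Qed.

Definition tcard bx : nat := #|[pred bw | typ bw == typ bx]|.

Lemma tcard_gt0 bx : (0 < tcard bx)%N.
Proof. by apply/card_gt0P; exists bx; rewrite inE. Qed.

Lemma tcard_eq bx bw : typ bx == typ bw -> tcard bx = tcard bw.
Proof. by move=> /eqP E; rewrite /tcard E. Qed.

Lemma tcardE bx : (tcard bx * \prod_y (cnt bx y)`! = N`!)%N.
Proof.
rewrite -(card_type_class (sum_cnt bx)); congr (_ * _)%N; apply: eq_card => bw.
rewrite !inE /type_class; apply/typP/forallP => H y; first by rewrite H.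
exact/eqP.
Qed.

Lemma entropy_LN bx : N%:R * entropy (LN R bx) = \sum_y xlnx (cnt bx y)%:R - xlnx N%:R.
Proof.
have NR : 0 < N%:R :> R by rewrite ltr0n.
have -> : xlnx (N%:R : R) = \sum_y (cnt bx y)%:R * ln N%:R.
  by rewrite -mulr_suml -natr_sum sum_cnt.
rewrite /entropy mulr_sumr -sumrB; apply: eq_bigr => y _; rewrite LNE /xlnx.
have [->|cy] := posnP (cnt bx y); first by rewrite !mul0r mulr0 subr0.
rewrite ln_div ?posrE ?ltr0n //.
by field; rewrite gt_eqF.
Qed.

(* [d.+1] Stirling errors, plus the logarithm of the at most [N.+1 ^ d] types. *)
Definition cerr : R := (d.*2.+1)%:R * (1 + 2 * ln N.+1%:R).

(** Stirling applied to the multinomial coefficient: the linear terms cancel because the counts add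
    up to N, and the x ln x terms combine into the entropy. *)
Lemma ln_tcard bx : `|ln (tcard bx)%:R + N%:R * entropy (LN R bx)| <=
  d.+1%:R * (1 + 2 * ln N.+1%:R).
Proof.
have E : ln (tcard bx)%:R + \sum_y ln (cnt bx y)`!%:R = ln N`!%:R :> R.
  rewrite -(tcardE bx) natrM lnM ?posrE ?ltr0n ?tcard_gt0 //; last first.
    by apply: prodn_gt0 => y; exact: fact_gt0.
  congr (_ + _); rewrite natr_prod.
  by rewrite ln_prod // => y; rewrite ltr0n fact_gt0.
rewrite entropy_LN.
have lN : 0 <= ln N.+1%:R :> R by rewrite ln_ge0 // ler1n.
have h1 : \sum_y ln (cnt bx y)`!%:R >= \sum_y (xlnx (cnt bx y)%:R - (cnt bx y)%:R) :> R.
  by apply: ler_sum => y _; apply: ln_fact_ge.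
have h2 : \sum_y ln (cnt bx y)`!%:R <=
   \sum_y (xlnx (cnt bx y)%:R - (cnt bx y)%:R + (1 + 2 * ln N.+1%:R)) :> R.
  apply: ler_sum => y _; apply: le_trans (ln_fact_le R _) _.
  rewrite -addrA lerD2l lerD2l ler_pM2l // ler_ln ?posrE ?ltr0n //.
  by rewrite ler_nat ltnS cnt_le.
rewrite big_split /= in h2; rewrite sumrB -natr_sum sum_cnt in h1 h2.
rewrite sumr_const card_ord -[_ *+ d]mulr_natl in h2.
have h3 := ln_fact_ge R N; have h4 := ln_fact_le R N.
rewrite -natr1 mulrDl mul1r ler_norml.
have : 0 <= d%:R * (1 + 2 * ln N.+1%:R) :> R by rewrite mulr_ge0 // addr_ge0 // mulr_ge0.
move: E h1 h2 h3 h4; set S1 := \sum_y ln _; set S2 := \sum_y xlnx _.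
by move=> *; apply/andP; split; lra.
Qed.

(** Type classes are the orbits of the particle permutations, hence [symm m] is constant on them. *)
Lemma typ_pact bx bw : typ bx == typ bw -> exists s, bx = pact s bw.
Proof.
move=> /typP H.
have : perm_eq [tuple bx i | i < N] [tuple bw i | i < N].
  apply/allP => y _ /=.
  have C (b : config) : count_mem y [tuple b i | i < N] = cnt b y.
    rewrite /= count_map /cnt cardE /enum_mem !size_filter count_filter -enumT.
    by apply: eq_count => i; rewrite !inE /= andbT.
  by rewrite !C H.
move=> /tuple_permP [s E]; exists s; apply/ffunP => i; rewrite ffunE.
have /val_inj/(congr1 (fun t => tnth t i)) := E.
by rewrite !tnth_mktuple.
Qed.

Lemma card_typ_le (F : config -> R) : (forall bx, \sum_(bw | typ bw == typ bx) F bw <= 1) ->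
  \sum_bx F bx <= (N.+1 ^ d)%:R.
Proof.
move=> HF; rewrite (partition_big typ predT) //=.
rewrite (@le_trans _ _ (\sum_(k : {ffun 'I_d -> 'I_N.+1}) 1)) //; last first.
  by rewrite sumr_const card_ffun !card_ord.
apply: ler_sum => k _.
have [/existsP[bx /eqP <-]|/existsPn H] := boolP [exists bx, typ bx == k]; first exact: HF.
by rewrite big1 // => bw E; have := H bw; rewrite E.
Qed.

Lemma sum_tcardV : \sum_bx (tcard bx)%:R^-1 <= (N.+1 ^ d)%:R :> R.
Proof.
apply: card_typ_le => bx.
rewrite (eq_bigr (fun=> (tcard bx)%:R^-1)) => [|bw E]; last by rewrite (tcard_eq E).
rewrite sumr_const -[_ *+ _]mulr_natl mulfV //.
by rewrite pnatr_eq0 -lt0n tcard_gt0.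
Qed.

Definition tmass (m : config -> R) bx : R := \sum_(bw | typ bw == typ bx) m bw.

Lemma symm_tmass m bx : (tcard bx)%:R * symm m bx = tmass m bx.
Proof.
have : \sum_bw symm m bw * (typ bw == typ bx)%:R = \sum_bw m bw * (typ bw == typ bx)%:R.
  apply: sum_symm => s bw; congr (_%:R); congr nat_of_bool.
  by apply/typP/typP => H y; rewrite -H cnt_pact.
have Ti (g : config -> R) : \sum_bw g bw * (typ bw == typ bx)%:R = \sum_(bw | typ bw == typ bx) g bw.
  rewrite [RHS]big_mkcond; apply: eq_bigr => bw _.
  by case: (_ == _); rewrite ?mulr1 ?mulr0.
rewrite !Ti /tmass => <-.
rewrite (eq_bigr (fun=> symm m bx)) => [|bw /typ_pact [s ->]]; last by rewrite symm_pact.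
by rewrite sumr_const -[RHS]mulr_natl.
Qed.

(** The sum is minus the Shannon entropy of the law of the type, and an entropy is at most the
    logarithm of the number of values. The lower bound is Gibbs' inequality against the uniform law
    on [N.+1 ^ d] types. *)
Lemma sum_ln_tmass (m : config -> R) : probN m ->
  - (d%:R * ln N.+1%:R) <= \sum_bx m bx * ln (tmass m bx) <= 0.
Proof.
move=> [m0 m1].
have tm0 bx : m bx <= tmass m bx.
  by rewrite /tmass (bigD1 bx) //= lerDl sumr_ge0.
have tm1 bx : tmass m bx <= 1.
  rewrite -m1 /tmass [leRHS](bigID (fun bw => typ bw == typ bx)) /= lerDl sumr_ge0 //.
apply/andP; split; last first.
  by apply: sumr_le0 => bx _; rewrite mulr_ge0_le0 // ln_le0.
pose k : R := (N.+1 ^ d)%:R.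
have k0 : 0 < k by rewrite ltr0n expn_gt0.
have lk : ln k = d%:R * ln N.+1%:R.
  by rewrite /k natrX lnXn ?posrE ?ltr0n // -[LHS]mulr_natl.
rewrite -lk lerNl -sumrN -subr_ge0 -[ln k]mul1r -m1 mulr_suml -sumrB.
have : \sum_bx (m bx - m bx / tmass m bx / k) <= \sum_bx (m bx * ln k - - (m bx * ln (tmass m bx))).
  apply: ler_sum => bx _.
  have := m0 bx; rewrite le_eqVlt => /predU1P[<-|mp]; first by rewrite !mul0r oppr0 subr0.
  have tp : 0 < tmass m bx := lt_le_trans mp (tm0 bx).
  rewrite opprK -mulrDr.
  have -> : m bx - m bx / tmass m bx / k = m bx * (1 - 1 / (tmass m bx * k)).
    by rewrite mulrBr mulr1 mul1r invfM mulrA.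
  rewrite ler_pM2l // [ln k + _]addrC -lnM ?posrE //.
  by have := ln_ratio_ge ltr01 (mulr_gt0 tp k0); rewrite ln1 subr0.
apply: le_trans; rewrite sumrB m1 subr_ge0 -mulr_suml ler_pdivrMr // mul1r.
apply: card_typ_le => bx.
rewrite (eq_bigr (fun bw => m bw / tmass m bx)) => [|bw E]; last by rewrite /tmass (eqP E).
rewrite -mulr_suml -/(tmass m bx).
have : 0 <= tmass m bx by rewrite (le_trans (m0 bx)).
rewrite le_eqVlt => /predU1P[<-|tp]; first by rewrite mul0r.
by rewrite mulfV // gt_eqF.
Qed.

(** [symm m] spreads the mass of a type uniformly over its class, so its logarithm is [ln (tmass m)]
    minus [ln (tcard)]. The first is controlled by [sum_ln_tmass], the second by [ln_tcard]. *)
Lemma symm_entropy (m : config -> R) : probN m ->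
  `|\sum_bx xlnx (symm m bx) - N%:R * push_integ m (@entropy R d)| <= cerr.
Proof.
move=> mp; have [m0 m1] := mp.
have lN : 0 <= ln N.+1%:R :> R by rewrite ln_ge0 // ler1n.
have -> : \sum_bx xlnx (symm m bx) = \sum_bx m bx * ln (symm m bx).
  by apply: sum_symm => s bx; rewrite symm_pact.
have -> : \sum_bx m bx * ln (symm m bx) =
   \sum_bx m bx * ln (tmass m bx) - \sum_bx m bx * ln (tcard bx)%:R.
  rewrite -sumrB; apply: eq_bigr => bx _.
  have := m0 bx; rewrite le_eqVlt => /predU1P[<-|mbp]; first by rewrite !mul0r subr0.
  rewrite -mulrBr -symm_tmass lnM ?posrE ?ltr0n ?tcard_gt0 //.
    by rewrite addrAC subrr add0r.
  rewrite lt_neqAle symm_ge0 // andbT eq_sym.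
  by apply/eqP => /(symm_eq0 m0) E; rewrite E ltxx in mbp.
have /andP[h1 h2] := sum_ln_tmass mp.
have h3 : `|\sum_bx m bx * (ln (tcard bx)%:R + N%:R * entropy (LN R bx))| <=
    d.+1%:R * (1 + 2 * ln N.+1%:R).
  rewrite (le_trans (ler_norm_sum _ _ _)) //.
  rewrite -[leRHS]mul1r -[X in X * _]m1 mulr_suml; apply: ler_sum => bx _.
  by rewrite normrM (ger0_norm (m0 bx)) ler_wpM2l // ln_tcard.
have E : \sum_bx m bx * (ln (tcard bx)%:R + N%:R * entropy (LN R bx)) =
  \sum_bx m bx * ln (tcard bx)%:R + N%:R * push_integ m (@entropy R d).
  rewrite /push_integ mulr_sumr -big_split /=; apply: eq_bigr => bx _; ring.
rewrite E in h3; move: h3; rewrite !ler_norml => /andP[h3 h4].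
have -> : cerr = d%:R * (1 + 2 * ln N.+1%:R) + d.+1%:R * (1 + 2 * ln N.+1%:R).
  by rewrite /cerr -mulrDl -natrD -addnn addnS.
have d0 : 0 <= d%:R :> R by [].
have : d%:R * ln N.+1%:R <= d%:R * (1 + 2 * ln N.+1%:R) :> R by rewrite ler_wpM2l //; lra.
have : 0 <= d%:R * (1 + 2 * ln N.+1%:R) :> R by rewrite mulr_ge0 //; lra.
by move=> *; apply/andP; split; lra.
Qed.

End types.

(** * Functions on the simplex *)

Section simplex.
Variables (R : realType) (d : nat).
Local Notation V := (vec R d).
Local Notation S := (@simplex R d).

Lemma simplex_coord (mu : V) x : S mu -> 0 <= mu 0 x <= 1.
Proof.
by move=> [mu0 mu1]; rewrite mu0 -mu1 (bigD1 x) //= lerDl sumr_ge0.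
Qed.

Lemma simplex_norm (mu : V) : S mu -> `|mu| <= 1.
Proof.
move=> Smu; apply: ler_mxnorm => // i x; rewrite ord1.
by have /andP[h0 h1] := simplex_coord x Smu; rewrite ger0_norm.
Qed.

Lemma simplex_dist (mu nu : V) : S mu -> S nu -> `|mu - nu| <= 1.
Proof.
move=> Smu Snu; apply: ler_mxnorm => // i x; rewrite ord1 !mxE ler_norml.
have := simplex_coord x Smu; have := simplex_coord x Snu.
by move=> /andP[? ?] /andP[? ?]; apply/andP; split; lra.
Qed.

Lemma continuous_sum (T : topologicalType) (I : finType) (f : I -> T -> R) :
  (forall i, continuous (f i)) -> continuous (fun x => \sum_i f i x).
Proof.
move=> fc x; apply: cvg_big => [|i _]; first exact: add_continuous.
exact: fc.
Qed.

Lemma simplex_closed : closed (S : set V).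
Proof.
have -> : (S : set V) = (\bigcap_(x in [set: 'I_d]) [set mu : V | 0 <= mu 0 x]) `&`
    (fun mu : V => \sum_x mu 0 x) @^-1` [set 1].
  apply/seteqP; split=> mu /=; first by move=> [h1 h2]; split => // x _; exact: h1.
  by move=> [h1 h2]; split => // x; apply: h1.
apply: closedI.
  apply: closed_bigI => x _.
  have /continuous_closedP/(_ _ (@closed_ge R 0)) := @coord_continuous R 1 d 0 x.
  by [].
have /continuous_closedP : continuous (fun mu : V => \sum_x mu 0 x).
  by apply: continuous_sum => x; apply: coord_continuous.
apply; exact: closed_eq.
Qed.

Lemma simplex_compact : compact (S : set V).
Proof.
apply: bounded_closed_compact; last exact: simplex_closed.
exists 1; split => // B B1 mu Smu.
exact: le_trans (simplex_norm Smu) (ltW B1).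
Qed.

Lemma row_continuous (T : topologicalType) (f : 'I_d -> T -> R) (t : T) :
  (forall x, {for t, continuous (f x)}) -> {for t, continuous (fun t => (\row_x f x t) : V)}.
Proof.
move=> fc; apply/cvgrPdist_le => e e0.
have : \forall s \near t, forall x, `|f x t - f x s| <= e.
  by apply: filter_forall => x; have /cvgrPdist_le := fc x; apply.
apply: filterS => s H; apply: ler_mxnorm; first exact: ltW.
by move=> i x; rewrite !mxE.
Qed.

(* Excess mass is normalized away, missing mass is put on [x0]. *)
Definition rtr (x0 : 'I_d) (mu : V) : V :=
  let s := \sum_x Num.max 0 (mu 0 x) in
  \row_x ((Num.max 0 (mu 0 x) + (x == x0)%:R * Num.max 0 (1 - s)) / Num.max 1 s).

Lemma rtr_simplex x0 mu : S (rtr x0 mu).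
Proof.
rewrite /rtr; set s := \sum_x _; have m0 : 0 < Num.max 1 s by rewrite lt_max ltr01.
split=> [x|].
  rewrite mxE divr_ge0 ?(ltW m0) // addr_ge0 ?le_max ?lexx //.
  by rewrite mulr_ge0 // le_max lexx.
under eq_bigr do rewrite mxE.
rewrite -mulr_suml big_split /= -/s -mulr_suml.
rewrite (bigD1 x0) //= eqxx big1 => [|x /negbTE -> //]; rewrite addr0 mul1r.
have -> : s + Num.max 0 (1 - s) = Num.max 1 s.
  by case: (leP 0 (1 - s)) => h1; case: (leP 1 s) => h2; lra.
by rewrite mulfV // gt_eqF.
Qed.

Lemma rtr_id x0 mu : S mu -> rtr x0 mu = mu.
Proof.
move=> [mu0 mu1]; apply/rowP => x; rewrite mxE.
have E y : Num.max 0 (mu 0 y) = mu 0 y by apply/max_idPr.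
under eq_bigr do rewrite E.
by rewrite mu1 subrr !maxxx mulr0 addr0 divr1 E.
Qed.

Lemma rtr_continuous x0 : continuous (rtr x0).
Proof.
have H (T : topologicalType) (g : 'I_d -> T -> R) x : (forall y, continuous (g y)) ->
    continuous (fun t => (Num.max 0 (g x t) + (x == x0)%:R *
      Num.max 0 (1 - \sum_y Num.max 0 (g y t))) / Num.max 1 (\sum_y Num.max 0 (g y t))).
  move=> gc.
  have mc (a : R) (f : T -> R) : continuous f -> continuous (fun t => Num.max a (f t)).
    move=> fc t; apply: (@continuous_comp _ _ _ f (Num.max a)); first exact: fc.
    by apply: continuous_max; [exact: cvg_cst | exact: cvg_id].
  have sc : continuous (fun t => \sum_y Num.max 0 (g y t)).
    by apply: continuous_sum => y; apply: mc.
  have s1 : continuous (fun t => 1 - \sum_y Num.max 0 (g y t)).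
    by move=> t; apply: cvgB; [exact: cvg_cst | exact: sc].
  move=> t; apply: cvgM.
    by apply: cvgD; [exact: mc | apply: cvgMl_tmp; exact: mc].
  apply: cvgV; last exact: mc.
  by rewrite gt_eqF // lt_max ltr01.
move=> mu; apply: row_continuous => x; apply: H => y.
exact: coord_continuous.
Qed.

(** Values off the simplex are ignored. The class contains [freeF] and is stable under composition
    with the flow, two kinds of functions not known to be continuous on the whole space. *)
Definition ucS (g : V -> R) := forall e : R, 0 < e -> exists2 r : R, 0 < r &
  forall mu nu, S mu -> S nu -> `|nu - mu| < r -> `|g nu - g mu| < e.

Lemma ucS_continuous g : (forall mu, S mu -> {for mu, continuous g}) -> ucS g.
Proof.
move=> gc e e0; have [r r0 Hr] := compact_unif_cont simplex_compact gc e0.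
by exists r => // mu nu Smu _; exact: Hr.
Qed.

Lemma ucS_comp (T : topologicalType) (f : T -> V) (g : V -> R) :
  ucS g -> continuous f -> (forall t, S (f t)) -> continuous (g \o f).
Proof.
move=> gu fc fS t; apply/cvgrPdist_lt => e e0; have [r r0 Hr] := gu e e0.
have /cvgrPdist_lt/(_ _ r0) := fc t.
by apply: filterS => s H; apply: Hr.
Qed.

Lemma ucS_rtr x0 g : ucS g -> continuous (g \o rtr x0).
Proof.
move=> gu; apply: ucS_comp => //; first exact: rtr_continuous.
exact: rtr_simplex.
Qed.

Lemma ucS_bounded g : 'I_d -> ucS g -> exists2 B, 0 <= B & forall mu, S mu -> `|g mu| <= B.
Proof.
move=> x0 gu.
have [B [r [B0 r0 H]]] := compact_bounded_near simplex_compact (fun mu _ => @ucS_rtr x0 g gu mu).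
exists B => // mu Smu; have := H mu mu Smu; rewrite subrr normr0 => /(_ r0) /=.
by rewrite rtr_id.
Qed.

(** Lets weak convergence be tested on [ucS] functions, as [rtr] does not change values on the
    simplex. *)
Lemma test_fun_rtr x0 g : ucS g -> test_fun (g \o rtr x0).
Proof.
move=> gu; split; first exact: ucS_rtr.
by have [B _ HB] := ucS_bounded x0 gu; exists B => nu; apply/HB/rtr_simplex.
Qed.

Definition lipS (g : V -> R) := exists2 L : R, 0 <= L &
  forall mu nu, S mu -> S nu -> `|g mu - g nu| <= L * `|mu - nu|.

Lemma lipS_ucS g : lipS g -> ucS g.
Proof.
move=> [L L0 HL] e e0; have L10 : 0 < L + 1 by rewrite ltr_wpDl.
exists (e / (L + 1)); first by rewrite divr_gt0.
move=> mu nu Smu Snu H; apply: le_lt_trans (HL _ _ Snu Smu) _.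
rewrite (@le_lt_trans _ _ ((L + 1) * `|nu - mu|)) //; first by rewrite ler_wpM2r // lerDl.
by rewrite mulrC -ltr_pdivlMr.
Qed.

Lemma lipS_bounded g : lipS g -> exists2 B, 0 <= B & forall mu, S mu -> `|g mu| <= B.
Proof.
move=> [L L0 HL].
have [[mu0 S0]|NS] := pselect (exists mu0, S mu0); last first.
  by exists 0 => // mu Smu; exfalso; apply: NS; exists mu.
exists (`|g mu0| + L); first by rewrite addr_ge0.
move=> mu Smu; rewrite -[g mu](subrK (g mu0)) (le_trans (ler_normD _ _)) // addrC lerD2l.
by rewrite (le_trans (HL _ _ Smu S0)) // ler_piMr // simplex_dist.
Qed.

Lemma eq_lipS f g : (forall mu, S mu -> f mu = g mu) -> lipS f -> lipS g.
Proof. by move=> E [L L0 HL]; exists L => // mu nu Smu Snu; rewrite -!E //; exact: HL. Qed.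

Lemma lipS_cst (a : R) : lipS (fun=> a).
Proof. by exists 0 => // mu nu _ _; rewrite subrr normr0 mul0r. Qed.

Lemma lipS_coord x : lipS (fun mu => mu 0 x).
Proof.
exists 1 => // mu nu _ _; rewrite mul1r.
by have := mxnorm_ge (mu - nu) 0 x; rewrite !mxE.
Qed.

Lemma lipS_add f g : lipS f -> lipS g -> lipS (fun mu => f mu + g mu).
Proof.
move=> [L L0 HL] [M M0 HM]; exists (L + M) => [|mu nu Smu Snu]; first exact: addr_ge0.
rewrite opprD addrACA (le_trans (ler_normD _ _)) // mulrDl lerD //; by [exact: HL|exact: HM].
Qed.

Lemma lipS_mul f g : lipS f -> lipS g -> lipS (fun mu => f mu * g mu).
Proof.
move=> lf lg; have [B B0 HB] := lipS_bounded lf; have [C C0 HC] := lipS_bounded lg.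
move: lf lg => [L L0 HL] [M M0 HM].
exists (B * M + C * L) => [|mu nu Smu Snu]; first by rewrite addr_ge0 // mulr_ge0.
have -> : f mu * g mu - f nu * g nu = f mu * (g mu - g nu) + (f mu - f nu) * g nu by ring.
rewrite (le_trans (ler_normD _ _)) // !normrM mulrDl lerD //.
  by rewrite -mulrA ler_pM //; [exact: HB|exact: HM].
by rewrite mulrC -mulrA ler_pM //; [exact: HC|exact: HL].
Qed.

Lemma lipS_opp f : lipS f -> lipS (fun mu => - f mu).
Proof.
move=> lf; apply: eq_lipS (lipS_mul (lipS_cst (-1)) lf) => mu _ /=.
by rewrite mulN1r.
Qed.

Lemma lipS_sum (I : finType) (P : pred I) (f : I -> V -> R) :
  (forall i, lipS (f i)) -> lipS (fun mu => \sum_(i | P i) f i mu).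
Proof.
move=> lf; elim: (index_enum I) => [|i s IH].
  by apply: eq_lipS (lipS_cst 0) => mu _; rewrite big_nil.
have [Pi|Pi] := boolP (P i).
  by apply: eq_lipS (lipS_add (lf i) IH) => mu _; rewrite big_cons Pi.
by apply: eq_lipS IH => mu _; rewrite big_cons (negbTE Pi).
Qed.

Lemma expR_lip (a b B : R) : a <= B -> b <= B -> `|expR a - expR b| <= expR B * `|a - b|.
Proof.
wlog ab : a b / b <= a => [W aB bB|aB bB].
  have [ab|/ltW ab] := leP b a; first exact: W.
  by rewrite distrC [`|a - b|]distrC; apply: W.
rewrite !ger0_norm ?subr_ge0 ?ler_expR //.
have E : expR b = expR a * expR (b - a) by rewrite -expRD addrC subrK.
have H : expR a * (1 + (b - a)) <= expR a * expR (b - a).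
  by rewrite ler_wpM2l ?expR_ge0 // expR_ge1Dx.
have : expR a * (a - b) <= expR B * (a - b).
  by rewrite ler_wpM2r ?subr_ge0 // ler_expR.
rewrite E; lra.
Qed.

Lemma lipS_exp f : lipS f -> lipS (fun mu => expR (f mu)).
Proof.
move=> lf; have [B B0 HB] := lipS_bounded lf; move: lf => [L L0 HL].
exists (expR B * L) => [|mu nu Smu Snu]; first by rewrite mulr_ge0 ?expR_ge0.
have H mu' : S mu' -> f mu' <= B by move=> h; rewrite (le_trans (ler_norm _)) // HB.
rewrite (le_trans (expR_lip (H _ Smu) (H _ Snu))) // -mulrA ler_wpM2l ?expR_ge0 //.
exact: HL.
Qed.

(** Points closer than [r] are compared by [mvt_coord], whose intermediate points leave the simplex
    but stay in [O]. For distant points boundedness suffices and contributes the constant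
    [2 * B / r]. *)
Lemma C1_on_lipS (O : set V) (f : V -> R) : open O -> S `<=` O -> C1_on O f -> lipS f.
Proof.
move=> Oo SO [fc fd].
have [e e0 He] : exists2 e : R, 0 < e & forall mu nu, S mu -> `|nu - mu| < e -> O nu.
  by apply: (compact_near_uniform simplex_compact) => mu Smu; apply: open_nbhs_nbhs; split => //; exact: SO.
have /choice [g Hg] : forall x, exists Br : R * R, [/\ 0 <= Br.1, 0 < Br.2 &
    forall mu nu, S mu -> `|nu - mu| < Br.2 -> `|pder x f nu| <= Br.1].
  move=> x; have [_ dc] := fd x.
  have [B [r [B0 r0 H]]] := compact_bounded_near simplex_compact (fun mu Smu => dc mu (SO _ Smu)).
  by exists (B, r).
pose M := \sum_x (g x).1.
have M0 : 0 <= M by apply: sumr_ge0 => x _; case: (Hg x).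
pose r := \big[Num.min/e]_x (g x).2.
have r0 : 0 < r by apply: (big_ind (fun u => 0 < u)) => // [a b a0 b0|x _]; [rewrite lt_min a0 | case: (Hg x)].
have re : r <= e by apply: bigmin_le_id.
have rg x : r <= (g x).2 by apply: bigmin_le_cond.
have fb : exists2 B, 0 <= B & forall mu, S mu -> `|f mu| <= B.
  have [B [r' [B0 r'0 H]]] := compact_bounded_near simplex_compact (fun mu Smu => fc mu (SO _ Smu)).
  by exists B => // mu Smu; apply: (H mu) => //; rewrite subrr normr0.
have [B B0 HB] := fb.
exists (M + 2 * B / r) => [|mu nu Smu Snu]; first by rewrite addr_ge0 // divr_ge0 ?mulr_ge0 // ltW.
have [h|h] := ltP `|mu - nu| r; last first.
  rewrite mulrDl (@le_trans _ _ (2 * B / r * `|mu - nu|)) // ?lerDr ?mulr_ge0 //.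
  rewrite mulrAC ler_pdivlMr // (@le_trans _ _ (2 * B * r)) //.
    rewrite ler_wpM2r ?(ltW r0) // (le_trans (ler_normB _ _)) //.
    by have := HB _ Smu; have := HB _ Snu; lra.
  by rewrite ler_wpM2l // mulr_ge0.
have Onear xi : `|xi - nu| <= `|mu - nu| -> O xi.
  by move=> hx; apply: (He nu) => //; rewrite (le_lt_trans hx) // (lt_le_trans h).
have [xi [Hxi]] := @mvt_coord R d f nu (mu - nu) (fun xi hx x => (fd x).1 _ (Onear xi hx)).
rewrite [nu + _]addrC subrK => ->.
rewrite (le_trans (ler_norm_sum _ _ _)) //.
rewrite (@le_trans _ _ (M * `|mu - nu|)) //; last first.
  by rewrite ler_wpM2r // lerDl divr_ge0 ?mulr_ge0 // ltW.
rewrite /M mulr_suml; apply: ler_sum => x _; rewrite normrM mulrC ler_pM //; last exact: mxnorm_ge.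
have [_ _ H] := Hg x; apply: (H nu) => //.
by rewrite (le_lt_trans (Hxi x)) // (lt_le_trans h).
Qed.

End simplex.

(** * Rates and drift *)

Lemma expR_mul_close (R : realType) (a b C e p q D : R) :
  `|a - b| <= e -> e <= 1 -> b <= C -> `|p - q| < e -> `|q| <= D ->
  `|expR a * p - expR b * q| < expR (C + 1) * (D + 2) * e.
Proof.
move=> ab e1 bC pq qD.
have e0 : 0 < e by exact: le_lt_trans pq.
have aC : a <= C + 1 by move: ab; rewrite ler_norml => /andP[_]; lra.
have h1 : `|expR a - expR b| <= expR (C + 1) * e.
  rewrite (le_trans (@expR_lip _ _ _ (C + 1) _ _)) //; first by lra.
  by rewrite ler_wpM2l // expR_ge0.
have h2 : expR b <= expR (C + 1) by rewrite ler_expR; lra.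
have h3 : `|p| < D + 1.
  by have := ler_normD (p - q) q; rewrite subrK; lra.
have -> : expR a * p - expR b * q = (expR a - expR b) * p + expR b * (p - q) by ring.
apply: le_lt_trans (ler_normD _ _) _; rewrite !normrM (ger0_norm (expR_ge0 b)).
have E0 := expR_gt0 (C + 1).
have h4 : `|expR a - expR b| * `|p| <= expR (C + 1) * e * (D + 1).
  by apply: ler_pM => //; exact: ltW.
have h5 : expR b * `|p - q| < expR (C + 1) * e.
  apply: (@le_lt_trans _ _ (expR (C + 1) * `|p - q|)); first by rewrite ler_wpM2r.
  by rewrite ltr_pM2l.
by apply: (lt_le_trans (ler_ltD h4 h5)); lra.
Qed.

Lemma half_close (R : realType) (n u h e : R) :
  `|n * u - h| < e -> `|- (n / 2) * u - - (h / 2)| <= e.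
Proof.
have -> : - (n / 2) * u - - (h / 2) = - ((n * u - h) / 2) by field.
rewrite normrN normrM [`|2^-1|]ger0_norm ?invr_ge0 // => H.
by have := normr_ge0 (n * u - h); lra.
Qed.

Section model.
Variables (R : realType) (d : nat).
Local Notation V := (vec R d).
Local Notation S := (@simplex R d).
Variables (K : 'I_d -> V -> R) (A : V -> 'M[R]_d) (AN : nat -> V -> 'M[R]_d) (O : set V).
Hypothesis Oopen : open O.
Hypothesis SO : S `<=` O.
Hypothesis KC2 : forall x, C2_on O (K x).
Hypothesis Anonneg : forall mu, S mu -> forall x y, 0 <= A mu x y.
Hypothesis Alip : exists L : R, forall mu nu, S mu -> S nu ->
     forall x y, `|A mu x y - A nu x y| <= L * `|mu - nu|.
Hypothesis ANnonneg : forall N mu, S mu -> forall x y, 0 <= AN N mu x y.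
Hypothesis ANcvg : forall x y (eps : R), 0 < eps ->
     \forall N \near \oo, forall mu, S mu -> `|AN N mu x y - A mu x y| < eps.

Lemma is_derive_coord (mu v : V) y : is_derive mu v (fun m : V => m 0 y) (v 0 y).
Proof.
have C : (fun h : R => h^-1 *: (((fun m : V => m 0 y) \o shift mu) (h *: v) - mu 0 y)) @ 0^' --> v 0 y.
  apply: cvg_near_cst; near=> h.
  have h0 : h != 0 by near: h; exact: nbhs_dnbhs_neq.
  by rewrite /= !mxE addrK scalerA mulVf // scale1r.
split; first by apply/cvg_ex; exists (v 0 y).
by rewrite /derive; apply: cvg_lim.
Unshelve. all: by end_near. Qed.

(** The product rule for [U]. It agrees with [H] on [O] only; continuity and Lipschitz bounds of [H]
    are read off it. *)
Definition gradU x (mu : V) : R := K x mu + \sum_y mu 0 y * pder x (K y) mu.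

Lemma is_derive_U mu x : O mu -> is_derive mu (dlt R x) (U K) (gradU x mu).
Proof.
move=> Omu.
have -> : U K = \sum_(y < d) ((fun m : V => m 0 y) * K y).
  by apply/funext => m; rewrite fct_sumE.
have D y : is_derive mu (dlt R x) ((fun m : V => m 0 y) * K y)
    (mu 0 y *: pder x (K y) mu + K y mu *: (dlt R x 0 y)).
  apply: is_deriveM; first exact: is_derive_coord.
  by apply: derivableP; have [[_ /(_ x) [H _]] _] := KC2 y; apply: H.
apply: is_derive_eq (is_derive_sum D) _.
rewrite big_split /= addrC; congr (_ + _).
rewrite (bigD1 x) //= big1 => [|y yx]; rewrite !mxE eqxx /=.
  by rewrite eqxx addr0 [_ *: _]mulr1.
by rewrite (negbTE yx) [_ *: _]mulr0.
Qed.

Lemma HE mu x : O mu -> H K x mu = gradU x mu.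
Proof. by move=> Omu; have [_ E] := is_derive_U x Omu; rewrite /H /pder E. Qed.

Lemma H_lipS x : lipS (H K x).
Proof.
apply: (@eq_lipS _ _ (gradU x)) => [mu /SO Omu|]; first by rewrite HE.
apply: lipS_add; first by apply: (C1_on_lipS Oopen SO); case: (KC2 x).
apply: lipS_sum => y; apply: lipS_mul; first exact: lipS_coord.
by apply: (C1_on_lipS Oopen SO); case: (KC2 y) => _; apply.
Qed.

Lemma U_continuous mu : S mu -> {for mu, continuous (U K)}.
Proof.
move=> /SO Omu.
have gen (T : topologicalType) (m k : 'I_d -> T -> R) t :
    (forall y, {for t, continuous (m y)}) -> (forall y, {for t, continuous (k y)}) ->
    {for t, continuous (fun t => \sum_y m y t * k y t)}.
  move=> mc kc; apply: cvg_big => [|y _]; first exact: add_continuous.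
  by apply: cvgM; [exact: mc | exact: kc].
apply: gen => y; first exact: coord_continuous.
by have [[H _] _] := KC2 y; apply: H.
Qed.

Lemma gradU_continuous mu x : S mu -> {for mu, continuous (gradU x)}.
Proof.
move=> /SO Omu.
have gen (T : topologicalType) (k : T -> R) (m p : 'I_d -> T -> R) t :
    {for t, continuous k} ->
    (forall y, {for t, continuous (m y)}) -> (forall y, {for t, continuous (p y)}) ->
    {for t, continuous (fun t => k t + \sum_y m y t * p y t)}.
  move=> kc mc pc; apply: cvgD; first exact: kc.
  apply: cvg_big => [|y _]; first exact: add_continuous.
  by apply: cvgM; [exact: mc | exact: pc].
apply: gen => [|y|y]; last by have [[_ /(_ x) [_ H]] _] := KC2 y; apply: H.
  by have [[H _] _] := KC2 x; apply: H.
exact: coord_continuous.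
Qed.

Lemma O_uniform : exists2 e : R, 0 < e & forall mu nu : V, S mu -> `|nu - mu| < e -> O nu.
Proof.
apply: (compact_near_uniform (@simplex_compact R d)) => mu Smu.
by apply: open_nbhs_nbhs; split => //; exact: SO.
Qed.

Lemma H_unif (e : R) : 0 < e -> exists2 r : R, 0 < r &
  forall mu nu : V, S mu -> `|nu - mu| < r -> forall x, O nu /\ `|H K x nu - H K x mu| < e.
Proof.
move=> e0; have [r0 r00 Hr0] := O_uniform.
have /choice [g Hg] : forall x, exists r : R, 0 < r /\
    forall mu nu : V, S mu -> `|nu - mu| < r -> `|gradU x nu - gradU x mu| < e.
  move=> x; have [r rp Hr] := compact_unif_cont (@simplex_compact R d) (fun mu Smu => @gradU_continuous mu x Smu) e0.
  by exists r.
pose r := \big[Num.min/r0]_x g x.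
exists r; first by apply: (big_ind (fun u => 0 < u)) => // [a b a0 b0|x _]; [rewrite lt_min a0 | case: (Hg x)].
move=> mu nu Smu h x.
have Onu : O nu by apply: (Hr0 mu) => //; rewrite (lt_le_trans h) //; exact: bigmin_le_id.
split => //; rewrite !HE //; last exact: SO.
have [_ Hx] := Hg x; apply: Hx => //; rewrite (lt_le_trans h) //; exact: bigmin_le_cond.
Qed.

(** Only the coordinates [x] and [y] move, so the mean value formula has two terms. The displaced
    point may have a negative coordinate, hence the use of estimates in a neighbourhood of the
    simplex. *)
Lemma U_slope (e : R) : 0 < e -> \forall N \near \oo, forall mu, S mu -> forall x y, x != y ->
  `|N%:R * (U K (mu + N%:R^-1 *: (dlt R y - dlt R x)) - U K mu) - (H K y mu - H K x mu)| < e.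
Proof.
move=> e0; have e20 : 0 < e / 2 by rewrite divr_gt0.
have [r r0 Hr] := H_unif e20.
near=> N.
have N0 : (0 < N)%N by near: N; exact: nbhs_infty_gt.
have NR : 0 < N%:R :> R by rewrite ltr0n.
have Nr : N%:R^-1 < r.
  rewrite -[ltRHS]invrK ltf_pV2 ?posrE ?invr_gt0 //.
  by near: N; exact: nbhs_infty_gtr.
move=> mu Smu x y xy; set v := N%:R^-1 *: _.
have vx z : v 0 z = N%:R^-1 * ((z == y)%:R - (z == x)%:R) by rewrite !mxE.
have nv : `|v| <= N%:R^-1.
  apply: ler_mxnorm => [|i z]; first by rewrite invr_ge0.
  rewrite ord1 vx normrM ger0_norm ?invr_ge0 // ler_piMr ?invr_ge0 //.
  case: (eqVneq z y) => [->|_]; case: (eqVneq _ x) => _; rewrite ?subrr ?subr0 ?sub0r ?normrN ?normr0 ?normr1 //.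
have Ov (nu : V) : `|nu - mu| <= `|v| -> forall x, O nu /\ `|H K x nu - H K x mu| < e / 2.
  by move=> h z; apply: Hr => //; rewrite (le_lt_trans h) // (le_lt_trans nv).
have [xi [Hxi ->]] := @mvt_coord R d (U K) mu v (fun nu h x => let: DeriveDef D _ := is_derive_U x (Ov nu h x).1 in D).
have -> : N%:R * (\sum_z v 0 z * pder z (U K) (xi z)) = H K y (xi y) - H K x (xi x).
  rewrite mulr_sumr (bigD1 y) //= (bigD1 x) //= big1 => [|z /andP[zy zx]].
    rewrite !vx !eqxx (negbTE xy) eq_sym (negbTE xy) addr0 subr0 sub0r mulr1 mulrN1 mulNr mulrN.
    by rewrite !mulVKf ?mulKf // ?gt_eqF // !mulrA mulfV ?gt_eqF // !mul1r.
  by rewrite vx (negbTE zy) (negbTE zx) subrr mulr0 mul0r mulr0.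
have [_ hy] := Ov _ (Hxi y) y; have [_ hx] := Ov _ (Hxi x) x.
move: hy hx; move: (H K y _) (H K y _) (H K x _) (H K x _) => a b c f.
rewrite !ltr_norml => /andP[? ?] /andP[? ?]; apply/andP; split; lra.
Unshelve. all: by end_near. Qed.

(** The normalization of [piX] cancels in the quotient and the square root halves the exponent. This
    is the shape of [QN], with the slope of [U] replaced by its limit. *)
Lemma QlimE mu x y : x != y -> Qlim K A mu x y = expR (- ((H K y mu - H K x mu) / 2)) * A mu x y.
Proof.
move=> /negbTE xy; rewrite /Qlim xy; congr (_ * _).
have Z0 : \sum_z expR (- H K z mu) != 0.
  rewrite gt_eqF // (bigD1 x) //=; apply: ltr_pwDl; first exact: expR_gt0.
  by apply: sumr_ge0 => z _; exact: expR_ge0.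
have -> : piX K mu y / piX K mu x = expR (- ((H K y mu - H K x mu) / 2)) ^+ 2.
  rewrite -expRM_natl /piX; move: Z0; set Z := \sum_z _ => Z0.
  move: (H K y mu) (H K x mu) => a b.
  have -> : 2 * - ((a - b) / 2) = - a - (- b) by field.
  by rewrite expRB; field; rewrite Z0 gt_eqF ?expR_gt0.
by rewrite sqrtr_sqr ger0_norm // expR_ge0.
Qed.

Lemma A_lipS x y : lipS (fun mu => A mu x y).
Proof.
have [L HL] := Alip; exists `|L| => // mu nu Smu Snu.
by rewrite (le_trans (HL _ _ Smu Snu x y)) // ler_wpM2r // ler_norm.
Qed.

Lemma Qlim_lipS x y : lipS (fun mu => Qlim K A mu x y).
Proof.
have [->|xy] := eqVneq x y.
  by apply: eq_lipS (lipS_cst d (0 : R)) => mu _; rewrite /Qlim eqxx.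
apply: (@eq_lipS _ _ (fun mu => expR (- ((H K y mu - H K x mu) * 2^-1)) * A mu x y)).
  by move=> mu _; rewrite QlimE.
apply: lipS_mul; last exact: A_lipS.
apply: lipS_exp; apply: lipS_opp; apply: lipS_mul; last exact: lipS_cst.
by apply: lipS_add; [exact: H_lipS | apply: lipS_opp; exact: H_lipS].
Qed.

Lemma Qlim_ge0 mu x y : S mu -> 0 <= Qlim K A mu x y.
Proof.
by move=> Smu; rewrite /Qlim; case: ifP => // _; rewrite mulr_ge0 ?sqrtr_ge0 // Anonneg.
Qed.

Lemma Qlim_bounded : exists2 B, 0 <= B & forall mu x y, S mu -> Qlim K A mu x y <= B.
Proof.
have /choice [g Hg] : forall p : 'I_d * 'I_d, exists B : R, 0 <= B /\
    forall mu, S mu -> `|Qlim K A mu p.1 p.2| <= B.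
  by move=> p; have [B B0 HB] := lipS_bounded (Qlim_lipS p.1 p.2); exists B.
exists (\sum_p g p) => [|mu x y Smu]; first by apply: sumr_ge0 => p _; case: (Hg p).
rewrite (le_trans (ler_norm _)) //; have [_ /(_ mu Smu) h] := Hg (x, y).
rewrite (le_trans h) // (bigD1 (x, y)) //= lerDl sumr_ge0 // => p _.
by case: (Hg p).
Qed.

(** The drift as a sum over jumps, shaped like [bQN_gen_LN] so that both generators can be compared
    jump by jump. *)
Lemma drift_dual mu (w : 'I_d -> R) :
  \sum_z drift K A mu z * w z =
  \sum_x \sum_(y | y != x) mu 0 x * Qlim K A mu x y * (w y - w x).
Proof.
rewrite /drift; under eq_bigr do rewrite mulr_suml.
rewrite exchange_big /=; apply: eq_bigr => x _.
rewrite (bigD1 x) //= {1}/Qfull eqxx mulrN mulNr -mulrA mulr_suml mulr_sumr addrC -sumrB.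
apply: eq_bigr => y yx; rewrite /Qfull eq_sym (negbTE yx).
ring.
Qed.

Lemma drift_sum mu : \sum_z drift K A mu z = 0.
Proof.
have := drift_dual mu (fun=> 1); under eq_bigr do rewrite mulr1.
by move=> ->; rewrite big1 // => x _; rewrite big1 // => y _; rewrite subrr mulr0.
Qed.

Lemma drift_lipS x : lipS (fun mu => drift K A mu x).
Proof.
apply: lipS_sum => y; apply: lipS_mul; first exact: lipS_coord.
rewrite /Qfull; case: (y == x); last exact: Qlim_lipS.
by apply: lipS_opp; apply: lipS_sum => z; exact: Qlim_lipS.
Qed.

(** The outflow from [x] is proportional to the mass at [x]; this is the quantitative form of
    pointing inwards that keeps short Euler steps in the simplex. *)
Lemma drift_ge : exists2 M, 0 <= M & forall mu x, S mu -> - (M * mu 0 x) <= drift K A mu x.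
Proof.
have [B B0 HB] := Qlim_bounded.
exists (B *+ d) => [|mu x Smu]; first by rewrite mulrn_wge0.
rewrite /drift (bigD1 x) //= {1}/Qfull eqxx.
have h1 : 0 <= \sum_(i < d | i != x) mu 0 i * Qfull K A mu i x.
  apply: sumr_ge0 => i /negbTE ix; rewrite /Qfull ix mulr_ge0 ?Qlim_ge0 //.
  by have [] := Smu.
have h2 : \sum_(z < d | z != x) Qlim K A mu x z <= B *+ d.
  rewrite -[X in _ *+ X]card_ord -sumr_const [leRHS](bigID (fun z => z != x)) /=.
  rewrite (@le_trans _ _ (\sum_(z < d | z != x) B)) ?lerDl ?sumr_ge0 //.
  by apply: ler_sum => z _; exact: HB.
have [mu0 _] := Smu; have := ler_wpM2l (mu0 x) h2.
rewrite mulrN; lra.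
Qed.

Lemma QN_cvg (e : R) : 0 < e -> \forall N \near \oo, forall mu, S mu -> forall x y, x != y ->
  `|QN K AN N mu x y - Qlim K A mu x y| < e.
Proof.
move=> e0.
have /choice [g Hg] : forall x, exists B : R, 0 <= B /\ forall mu, S mu -> `|H K x mu| <= B.
  by move=> x; have [B B0 HB] := lipS_bounded (H_lipS x); exists B.
have /choice [a Ha] : forall p : 'I_d * 'I_d, exists B : R, 0 <= B /\
    forall mu, S mu -> `|A mu p.1 p.2| <= B.
  by move=> p; have [B B0 HB] := lipS_bounded (A_lipS p.1 p.2); exists B.
pose C := \sum_x g x; pose CA := \sum_p a p.
have C0 : 0 <= C by apply: sumr_ge0 => x _; case: (Hg x).
have CA0 : 0 <= CA by apply: sumr_ge0 => x _; case: (Ha x).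
have HC mu x : S mu -> `|H K x mu| <= C.
  move=> Smu; have [_ h] := Hg x; rewrite (le_trans (h _ Smu)) // /C (bigD1 x) //= lerDl.
  by apply: sumr_ge0 => z _; case: (Hg z).
have HA mu x y : S mu -> `|A mu x y| <= CA.
  move=> Smu; have [_ h] := Ha (x, y); rewrite (le_trans (h _ Smu)) // /CA (bigD1 (x, y)) //= lerDl.
  by apply: sumr_ge0 => z _; case: (Ha z).
(* The factor by which [expR_mul_close] magnifies the error [e']. *)
pose D := expR (C + 1) * (CA + 2).
have D0 : 0 < D by rewrite mulr_gt0 ?expR_gt0 // ltr_wpDl.
pose e' := Num.min 1 (e / D).
have e'0 : 0 < e' by rewrite lt_min ltr01 divr_gt0.
have e'1 : e' <= 1 by rewrite ge_min lexx.
have e'D : D * e' <= e by rewrite mulrC -ler_pdivlMr // ge_min lexx orbT.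
have ANu : \forall N \near \oo, forall x y, forall mu, S mu -> `|AN N mu x y - A mu x y| < e'.
  by apply: filter_forall => x; apply: filter_forall => y; exact: ANcvg.
near=> N => mu Smu x y xy.
have hU : `|N%:R * (U K (mu + N%:R^-1 *: (dlt R y - dlt R x)) - U K mu) - (H K y mu - H K x mu)| < e'.
  move: mu Smu x y xy; near: N; exact: U_slope.
have hA : `|AN N mu x y - A mu x y| < e' by move: x y {xy hU} mu Smu; near: N.
rewrite QlimE // /QN.
set a' := - (N%:R / 2) * _; set a0 := - (_ / 2).
have da : `|a' - a0| <= e' by apply: half_close; exact: hU.
have a0C : a0 <= C.
  have := HC mu x Smu; have := HC mu y Smu; rewrite /a0.
  move: (H K y mu) (H K x mu) => h1 h2; rewrite !ler_norml.
  by move=> /andP[? ?] /andP[? ?]; lra.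
exact: lt_le_trans (expR_mul_close da e'1 a0C hA (HA mu x y Smu)) e'D.
Unshelve. all: by end_near. Qed.

End model.

(** * Asymptotics of the partition function *)

Section partition_function.
Variables (R : realType) (d : nat).
Local Notation V := (vec R d).
Local Notation S := (@simplex R d).
Variable K : 'I_d -> V -> R.
Hypothesis Uc : forall mu, S mu -> {for mu, continuous (U K)}.

Lemma entropy_continuous : continuous (@entropy R d).
Proof.
apply: continuous_sum => x mu.
apply: (@continuous_comp _ _ _ (fun mu : V => mu 0 x) (@xlnx R)); last exact: xlnx_continuous.
exact: coord_continuous.
Qed.

Lemma freeF_ucS : ucS (freeF K).
Proof.
apply: ucS_continuous => mu Smu.
have gen (T : topologicalType) (f g : T -> R) t : {for t, continuous f} ->
    {for t, continuous g} -> {for t, continuous (fun t => f t + g t)}.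
  by move=> *; exact: cvgD.
by apply: gen; [exact: entropy_continuous | exact: Uc].
Qed.

Variable x0 : 'I_d.

Lemma F0_le mu : S mu -> F0 K <= freeF K mu.
Proof.
move=> Smu; have [B B0 HB] := ucS_bounded x0 freeF_ucS.
apply: ge_inf; last by exists mu.
exists (- B) => _ [nu Snu <-]; have := HB nu Snu.
by rewrite ler_norml => /andP[].
Qed.

Lemma F0_adherent (e : R) : 0 < e -> exists2 mu, S mu & freeF K mu < F0 K + e.
Proof.
move=> e0; have [B B0 HB] := ucS_bounded x0 freeF_ucS.
have hi : has_inf [set freeF K mu | mu in S].
  split; last first.
    by exists (- B) => _ [nu Snu <-]; have := HB nu Snu; rewrite ler_norml => /andP[].
  by exists (freeF K (rtr x0 0)), (rtr x0 0) => //; exact: rtr_simplex.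
by have [_ [mu Smu <-] h] := inf_adherent e0 hi; exists mu.
Qed.

(** The numbers [N * mu x] are rounded down for [x != x0] and [x0] receives the rest. The type so
    prescribed is realized because its class has nonzero size by [card_type_class]. *)
Lemma type_approx N mu : (0 < N)%N -> S mu ->
  exists bx : config d N, `|LN R bx - mu| <= d%:R / N%:R.
Proof.
move=> N0 Smu; have NR : 0 < N%:R :> R by rewrite ltr0n.
have mu01 x := simplex_coord x Smu.
have mu0 x : 0 <= N%:R * mu 0 x by have /andP[h _] := mu01 x; rewrite mulr_ge0.
pose f x := Num.truncn (N%:R * mu 0 x).
have fle x : (f x)%:R <= N%:R * mu 0 x by have /andP[] := truncn_itv (mu0 x).
have flt x : N%:R * mu 0 x < (f x)%:R + 1 by have /andP[_] := truncn_itv (mu0 x); rewrite natr1.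
pose s := (\sum_(x | x != x0) f x)%N.
have [_ mu1] := Smu; rewrite (bigD1 x0) //= in mu1.
have sE : s%:R = \sum_(x | x != x0) (f x)%:R :> R by rewrite natr_sum.
have subE : 1 - mu 0 x0 = \sum_(x | x != x0) mu 0 x.
  by rewrite -[X in X - _]mu1 addrAC subrr add0r.
have sle : s%:R <= N%:R * (1 - mu 0 x0).
  rewrite subE mulr_sumr sE.
  by apply: ler_sum => x _; exact: fle.
have sge : N%:R * (1 - mu 0 x0) <= s%:R + (d.-1)%:R.
  rewrite subE mulr_sumr sE.
  have -> : (d.-1)%:R = \sum_(x < d | x != x0) (1 : R).
    rewrite sumr_const; congr (_%:R).
    by have := cardC1 x0; rewrite card_ord => <-; apply: eq_card => y; rewrite !inE.
  by rewrite -big_split /=; apply: ler_sum => x _; exact/ltW/flt.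
have d0 : (0 < d)%N by rewrite -[d]card_ord; apply/card_gt0P; exists x0.
have sN : (s <= N)%N.
  rewrite -(ler_nat R); apply: le_trans sle _; apply: ler_piMr => //.
  by rewrite lerBlDr lerDl; have /andP[] := mu01 x0.
pose k x := if x == x0 then (N - s)%N else f x.
have kN : (\sum_x k x = N)%N.
  rewrite (bigD1 x0) //= {1}/k eqxx (eq_bigr f) => [|x /negbTE h]; last by rewrite /k h.
  exact: subnK.
have : (0 < #|@type_class d N k|)%N.
  by have := card_type_class kN; case: #|_| => // h; have := fact_gt0 N; rewrite -h mul0n.
move=> /card_gt0P [bx]; rewrite unfold_in => /forallP Hbx; exists bx.
apply: ler_mxnorm => [|i x]; first by rewrite divr_ge0.
rewrite ord1 mxE LNE (eqP (Hbx x)) !mxE.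
rewrite ler_pdivlMr // -{2}(gtr0_norm NR) -normrM mulrBl divfK ?gt_eqF //.
have d1 : (d.-1)%:R + 1 = d%:R :> R by rewrite natr1 prednK.
have d1' : 0 <= (d.-1)%:R :> R by [].
rewrite [_ * N%:R]mulrC /k ler_norml; case: eqP => [->|_].
  rewrite natrB //; apply/andP; split; lra.
have := fle x; have := flt x; move=> *; apply/andP; split; lra.
Qed.

Definition lnZ N : R := ln (\sum_(bz : config d N) expR (- N%:R * U K (LN R bz))).

Lemma cerr_cvg : N%:R^-1 * cerr R d N @[N --> \oo] --> (0 : R).
Proof.
apply/cvgrPdist_lt => e e0.
pose D : R := (d.*2.+1)%:R.
have D0 : 0 < D by rewrite ltr0n.
(* The logarithm lies below each of its tangents, so ln(N+1) has a linear bound of arbitrarily small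
   slope [a]; with this slope the factor [D * 2] costs [e / 4]. *)
pose a := e / (8 * D).
have a0 : 0 < a by rewrite divr_gt0 // mulr_gt0.
have e20 : 0 < e / 2 by rewrite divr_gt0.
near=> N.
have N0 : (0 < N)%N by near: N; exact: nbhs_infty_gt.
have NR : 0 < N%:R :> R by rewrite ltr0n.
have lN : 0 <= ln N.+1%:R :> R by rewrite ln_ge0 // ler1n.
have c0 : 0 <= N%:R^-1 * cerr R d N.
  by rewrite mulr_ge0 ?invr_ge0 // /cerr mulr_ge0 // addr_ge0 // mulr_ge0.
rewrite sub0r normrN ger0_norm // mulrC ltr_pdivrMr //.
have h1 : ln N.+1%:R <= a * N.+1%:R - 1 - ln a.
  have := ln_le_sub1 (mulr_gt0 a0 (ltr0Sn R N)).
  by rewrite lnM ?posrE ?ltr0n //; lra.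
have h2 : D * (1 + 2 * `|ln a|) + D * 2 * a < e / 2 * N%:R.
  rewrite [ltRHS]mulrC -ltr_pdivrMr //.
  by near: N; exact: nbhs_infty_gtr.
have h3 : D * (2 * a) * N%:R <= e / 4 * N%:R.
  rewrite ler_wpM2r // /a le_eqVlt; apply/orP; left; apply/eqP; field.
  by rewrite gt_eqF.
rewrite /cerr -/D.
have h4 : D * (1 + 2 * ln N.+1%:R) <= D * (1 + 2 * (a * N.+1%:R - 1 - ln a)).
  by rewrite ler_wpM2l ?(ltW D0) // lerD2l ler_pM2l.
have h5 : D * - ln a <= D * `|ln a| by rewrite ler_wpM2l ?(ltW D0) // -normrN ler_norm.
apply: (le_lt_trans h4); rewrite -natr1.
have : 0 < e * N%:R by rewrite mulr_gt0.
lra.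
Unshelve. all: by end_near. Qed.

(** Laplace's principle from below: a single type class is kept in the sum. *)
Lemma lnZ_ge N (bx : config d N) : (0 < N)%N ->
  - N%:R * freeF K (LN R bx) - cerr R d N <= lnZ N.
Proof.
move=> N0.
have lN : 0 <= ln N.+1%:R :> R by rewrite ln_ge0 // ler1n.
have t0 : 0 < (tcard bx)%:R :> R by rewrite ltr0n tcard_gt0.
have H : (tcard bx)%:R * expR (- N%:R * U K (LN R bx)) <=
    \sum_(bz : config d N) expR (- N%:R * U K (LN R bz)).
  rewrite [leRHS](bigID (fun bw => typ bw == typ bx)) /=.
  rewrite [X in X + _](eq_bigr (fun=> expR (- N%:R * U K (LN R bx)))); last first.
    by move=> bw /(typ_LN R) ->.
  by rewrite sumr_const -[X in _ <= X + _]mulr_natl lerDl sumr_ge0 // => z _; apply: expR_ge0.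
have Ht : 0 < (tcard bx)%:R * expR (- N%:R * U K (LN R bx)) by rewrite mulr_gt0 ?expR_gt0.
have : ln ((tcard bx)%:R * expR (- N%:R * U K (LN R bx))) <= lnZ N.
  by rewrite /lnZ ler_ln ?posrE // (lt_le_trans Ht).
rewrite lnM ?posrE ?expR_gt0 // expRK.
have := @ln_tcard R d N N0 bx; rewrite ler_norml => /andP[h _].
have : d.+1%:R * (1 + 2 * ln N.+1%:R) <= cerr R d N.
  rewrite /cerr ler_wpM2r ?addr_ge0 ?mulr_ge0 // ler_nat ltnS -addnn leq_addr //.
rewrite /freeF; lra.
Qed.

(** One error comes from the size of each class, the other from the number of classes, which is how
    the sum of the inverses of [tcard] is bounded. *)
Lemma lnZ_le N : (0 < N)%N -> lnZ N <= - N%:R * F0 K + 2 * cerr R d N.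
Proof.
move=> N0; have NR : 0 < N%:R :> R by rewrite ltr0n.
have lN : 0 <= ln N.+1%:R :> R by rewrite ln_ge0 // ler1n.
have [bx0 _] := type_approx N0 (@rtr_simplex R d x0 0).
have H (bx : config d N) : expR (- N%:R * U K (LN R bx)) <=
    (tcard bx)%:R^-1 * expR (- N%:R * F0 K + cerr R d N).
  have t0 : 0 < (tcard bx)%:R :> R by rewrite ltr0n tcard_gt0.
  rewrite ler_pdivlMl // -[(tcard bx)%:R](@lnK R) ?posrE // -expRD ler_expR.
  have := @ln_tcard R d N N0 bx; rewrite ler_norml => /andP[_ h].
  have : d.+1%:R * (1 + 2 * ln N.+1%:R) <= cerr R d N.
    rewrite /cerr ler_wpM2r ?addr_ge0 ?mulr_ge0 // ler_nat ltnS -addnn leq_addr //.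
  have := ler_wpM2l (ltW NR) (F0_le (LN_simplex R bx N0)); rewrite /freeF; lra.
have Zp : 0 < \sum_(bz : config d N) expR (- N%:R * U K (LN R bz)).
  rewrite (bigD1 bx0) //= ltr_pwDl ?expR_gt0 // sumr_ge0 // => z _; apply: expR_ge0.
have := ler_sum _ (fun bx _ => H bx) => /(_ (index_enum _) predT).
rewrite -mulr_suml => h.
have k0 : 0 < (N.+1 ^ d)%:R :> R by rewrite ltr0n expn_gt0.
have h2 : \sum_(bz : config d N) expR (- N%:R * U K (LN R bz)) <=
    (N.+1 ^ d)%:R * expR (- N%:R * F0 K + cerr R d N).
  apply: (le_trans h); rewrite ler_wpM2r ?expR_ge0 //; exact: sum_tcardV.
rewrite /lnZ (le_trans (y := ln ((N.+1 ^ d)%:R * expR (- N%:R * F0 K + cerr R d N)))) //.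
  by rewrite ler_ln ?posrE ?mulr_gt0 ?expR_gt0.
rewrite lnM ?posrE ?expR_gt0 // expRK natrX lnXn ?posrE ?ltr0n //.
rewrite -[ln _ *+ _]mulr_natl.
have : d%:R * ln N.+1%:R <= cerr R d N.
  rewrite /cerr ler_pM // ?ler_nat; last by lra.
  by rewrite -addnn -addnS leq_addr.
lra.
Qed.

Lemma lnZ_cvg : N%:R^-1 * lnZ N @[N --> \oo] --> - F0 K.
Proof.
apply/cvgrPdist_lt => e e0.
have e40 : 0 < e / 4 by rewrite divr_gt0.
have [mu Smu Hmu] := F0_adherent e40.
have [r r0 Hr] := freeF_ucS e40.
near=> N.
have N0 : (0 < N)%N by near: N; exact: nbhs_infty_gt.
have NR : 0 < N%:R :> R by rewrite ltr0n.
have [bx Hbx] := type_approx N0 Smu.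
have dN : d%:R / N%:R < r.
  rewrite ltr_pdivrMr // [ltRHS]mulrC -ltr_pdivrMr //; near: N; exact: nbhs_infty_gtr.
have h1 := Hr _ _ Smu (LN_simplex R bx N0) (le_lt_trans Hbx dN).
have h2 : N%:R^-1 * cerr R d N < e / 4.
  by near: N; apply: (cvgr_lt 0 cerr_cvg).
have h3 := lnZ_ge bx N0; have h4 := lnZ_le N0.
have h5 : - freeF K (LN R bx) - N%:R^-1 * cerr R d N <= N%:R^-1 * lnZ N.
  rewrite ler_pdivlMl // mulrBr mulVKf ?gt_eqF // mulrN -mulNr //.
have h6 : N%:R^-1 * lnZ N <= - F0 K + 2 * (N%:R^-1 * cerr R d N).
  rewrite ler_pdivrMl //; move: h4; move: (lnZ N) (F0 K) (cerr R d N) => z f c.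
  have -> // : N%:R * (- f + 2 * (N%:R^-1 * c)) = - N%:R * f + 2 * c.
  by field; rewrite gt_eqF.
move: h1 h2 h5 h6 Hmu.
move: (freeF _ _) (freeF _ _) (_ * lnZ N) (_ * cerr R d N) (F0 K) => a b z c f.
rewrite !ltr_norml => /andP[? ?] *; apply/andP; split; lra.
Unshelve. all: by end_near. Qed.

(** The decomposition would be exact with the entropy of [symm m] in place of N times the mean of
    [entropy]; the error is that of [symm_entropy]. *)
Lemma relentN_decomp N (m : config d N -> R) : (0 < N)%N -> probN m ->
  `|N%:R^-1 * relentN K m - (N%:R^-1 * kl m (symm m) + push_integ m (freeF K) + N%:R^-1 * lnZ N)| <=
   N%:R^-1 * cerr R d N.
Proof.
move=> N0 mp; have [m0 m1] := mp; have NR : 0 < N%:R :> R by rewrite ltr0n.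
have E1 : push_integ m (freeF K) = push_integ m (@entropy R d) + push_integ m (U K).
  by rewrite /push_integ -big_split /=; apply: eq_bigr => bx _; rewrite -mulrDr.
have E2 : relentN K m = \sum_bx xlnx (m bx) + N%:R * push_integ m (U K) + lnZ N.
  rewrite /relentN /push_integ mulr_sumr -[lnZ N]mul1r -[X in _ + X * _]m1 mulr_suml.
  rewrite -!big_split /=; apply: eq_bigr => bx _.
  have := m0 bx; rewrite le_eqVlt => /predU1P[<-|mp']; first by rewrite /xlnx !mul0r mulr0 !addr0.
  have Zp : 0 < \sum_(bz : config d N) expR (- N%:R * U K (LN R bz)).
    rewrite (bigD1 bx) //= ltr_pwDl ?expR_gt0 // sumr_ge0 // => z _; apply: expR_ge0.
  rewrite /piN ln_div ?posrE ?divr_gt0 ?expR_gt0 // ln_div ?posrE ?expR_gt0 // expRK /lnZ /xlnx.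
  ring.
rewrite E1 E2 kl_symmE //.
have -> : N%:R^-1 * (\sum_bx xlnx (m bx) + N%:R * push_integ m (U K) + lnZ N) -
  (N%:R^-1 * (\sum_bx xlnx (m bx) - \sum_bx xlnx (symm m bx)) +
   (push_integ m (entropy (d:=d)) + push_integ m (U K)) + N%:R^-1 * lnZ N) =
  N%:R^-1 * (\sum_bx xlnx (symm m bx) - N%:R * push_integ m (@entropy R d)).
  by field; rewrite gt_eqF.
rewrite normrM ger0_norm ?invr_ge0 // ler_wpM2l ?invr_ge0 //.
exact: symm_entropy.
Qed.

End partition_function.

(** * Second-moment estimate *)

Section squared_norm.
Variables (R : realType) (d : nat).
Local Notation V := (vec R d).

(** The squared Euclidean norm is used beside the max norm because its increment along a jump is an
    exact polynomial. *)
Definition sqd (v : V) : R := \sum_x v 0 x ^+ 2.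

Lemma sqd_ge0 (v : V) : 0 <= sqd v.
Proof. by apply: sumr_ge0 => x _; exact: sqr_ge0. Qed.

Lemma sqd_ge (v : V) x : v 0 x ^+ 2 <= sqd v.
Proof. by rewrite /sqd (bigD1 x) //= lerDl sumr_ge0 // => y _; exact: sqr_ge0. Qed.

Lemma norm_sqd (v : V) : `|v| ^+ 2 <= sqd v.
Proof.
rewrite -[leRHS]sqr_sqrtr ?sqd_ge0 // lerXn2r ?nnegrE ?sqrtr_ge0 //.
apply: ler_mxnorm => [|i x]; first exact: sqrtr_ge0.
by rewrite ord1 -sqrtr_sqr ler_wsqrtr // sqd_ge.
Qed.

Lemma sqd_edge (w : V) (a : R) x y : x != y ->
  sqd (w + a *: (dlt R y - dlt R x)) - sqd w = 2 * a * (w 0 y - w 0 x) + 2 * a ^+ 2.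
Proof.
move=> xy; rewrite /sqd -sumrB.
have E z : (w + a *: (dlt R y - dlt R x)) 0 z ^+ 2 - w 0 z ^+ 2 =
    2 * a * w 0 z * ((z == y)%:R - (z == x)%:R) + a ^+ 2 * ((z == y)%:R - (z == x)%:R) ^+ 2.
  by rewrite !mxE; ring.
rewrite (eq_bigr _ (fun z _ => E z)) (bigD1 y) //= (bigD1 x) //= big1 => [|z /andP[zy zx]].
  by rewrite !eqxx (negbTE xy) eq_sym (negbTE xy) /=; ring.
by rewrite (negbTE zy) (negbTE zx) /=; ring.
Qed.

End squared_norm.

Lemma edge_rate_split (F : fieldType) (n m q p w : F) : n != 0 ->
  n * m * q * (2 * n^-1 * w + 2 * n^-1 ^+ 2) =
  2 * (m * p * w) + m * ((q - p) * (2 * w + 2 * n^-1) + p * (2 * n^-1)).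
Proof. by move=> n0; field. Qed.

Lemma edge_bound (F : realFieldType) (a b c : F) :
  `|a| <= 1 -> `|b| <= 1 -> 0 <= c -> c <= 1 -> `|2 * (a - b) + 2 * c| <= 6.
Proof.
rewrite !ler_norml => /andP[? ?] /andP[? ?] ? ?; apply/andP; split; lra.
Qed.

(** One coordinate of empirical measure minus flow: [b] is the drift at the flow point, [b'] the
    drift at the empirical measure, [r] the defect of the flow. The terms linear in [h] combine into
    [2 * h * (u * (b' - b))], which the Lipschitz bound controls. *)
Lemma euler_coord_step (R : realFieldType) (u b b' r h L B C s : R) :
  `|u| <= 1 -> `|b| <= B -> `|b'| <= B -> `|r| <= C * h ^+ 2 -> 0 <= h <= 1 -> 0 <= C ->
  u * (b' - b) <= L * s ->
  (u - h * b - r) ^+ 2 + 2 * h * (b' * (u - h * b - r)) <=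
  u ^+ 2 + 2 * h * (L * s) + (2 * C + (B + C) ^+ 2 + 2 * B * (B + C)) * h ^+ 2.
Proof.
move=> u1 bB b'B rC /andP[h0 h1] C0 ub.
have B0 : 0 <= B := le_trans (normr_ge0 _) bB.
have k1 : `|h * b + r| <= h * (B + C).
  rewrite (le_trans (ler_normD _ _)) // mulrDr lerD //.
    by rewrite normrM ger0_norm // ler_wpM2l.
  by rewrite (le_trans rC) // mulrC expr2 ler_wpM2r // ler_piMl.
set k := h * b + r in k1 *.
have -> : u - h * b - r = u - k by rewrite /k opprD addrA.
have k2 : k ^+ 2 <= (h * (B + C)) ^+ 2.
  by rewrite -real_normK ?num_real // lerXn2r ?nnegrE // (le_trans (normr_ge0 _) k1).
have k3 : - (b' * k) <= B * (h * (B + C)).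
  by rewrite (le_trans (ler_norm _)) // normrN normrM ler_pM.
have k4 : - (u * r) <= 1 * (C * h ^+ 2).
  by rewrite (le_trans (ler_norm _)) // normrN normrM ler_pM.
have k5 := ler_wpM2l h0 ub; have k6 := ler_wpM2l h0 k3.
have -> : (u - k) ^+ 2 + 2 * h * (b' * (u - k)) =
  u ^+ 2 + 2 * (h * (u * (b' - b))) + 2 * - (u * r) + k ^+ 2 + 2 * (h * - (b' * k)).
  by rewrite /k; ring.
lra.
Qed.

Section kurtz.
Variables (R : realType) (d : nat).
Local Notation V := (vec R d).
Local Notation S := (@simplex R d).
Variables (K : 'I_d -> V -> R) (A : V -> 'M[R]_d) (AN : nat -> V -> 'M[R]_d).
Local Notation b := (drift K A).
Variables (L B BQ : R).
Hypothesis L0 : 0 <= L.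
Hypothesis bL : forall mu nu x, S mu -> S nu -> `|b mu x - b nu x| <= L * `|mu - nu|.
Hypothesis bB : forall mu x, S mu -> `|b mu x| <= B.
Hypothesis Q0 : forall mu x y, S mu -> 0 <= Qlim K A mu x y.
Hypothesis QB : forall mu x y, S mu -> Qlim K A mu x y <= BQ.
Hypothesis ANs : forall N mu, S mu -> irr_sym_nonneg (AN N mu).
Hypothesis QNQ : forall e : R, 0 < e -> \forall N \near \oo,
  forall mu, S mu -> forall x y, x != y -> `|QN K AN N mu x y - Qlim K A mu x y| < e.
Variables (Phi : R -> V -> V) (C : R).
Hypothesis C0 : 0 <= C.
Hypothesis Phi0 : forall mu, S mu -> Phi 0 mu = mu.
Hypothesis PhiS : forall t mu, 0 <= t -> S mu -> S (Phi t mu).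
Hypothesis Phistep : forall t s mu, 0 <= t -> 0 <= s -> S mu ->
  `|Phi (t + s) mu - Phi t mu - s *: (\row_x b (Phi t mu) x)| <= C * s ^+ 2.

(** The term in [e] comes from replacing [QN] by [Qlim], with 6 from [edge_bound]. The term in 1/N
    is the noise: jumps of size 1/N at a total rate of order N. *)
Lemma gen_sqd N (bx : config d N) nu (e : R) : (0 < N)%N -> S nu -> 0 <= e ->
  (forall mu, S mu -> forall x y, x != y -> `|QN K AN N mu x y - Qlim K A mu x y| < e) ->
  \sum_bw bQN K AN bx bw * sqd (LN R bw - nu) <=
  2 * (\sum_z b (LN R bx) z * (LN R bx - nu) 0 z) + d%:R * (6 * e + 2 * BQ / N%:R).
Proof.
move=> N0 Snu e0 Qe.
have NR : 0 < N%:R :> R by rewrite ltr0n.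
have NV1 : N%:R^-1 <= 1 :> R by rewrite invf_le1 ?ler1n.
rewrite (bQN_gen_LN _ _ _ (fun v => sqd (v - nu)) N0).
set mu := LN R bx; have Smu : S mu by exact: LN_simplex.
set w := mu - nu.
have w1 z : `|w 0 z| <= 1 by rewrite (le_trans (mxnorm_ge w 0 z)) // simplex_dist.
have [mu0 mu1] := Smu.
rewrite drift_dual mulr_sumr.
have dE : d%:R * (6 * e + 2 * BQ / N%:R) = \sum_x \sum_(y : 'I_d) mu 0 x * (6 * e + 2 * BQ / N%:R).
  under eq_bigr do rewrite sumr_const card_ord -[_ *+ d]mulr_natl.
  by rewrite -mulr_sumr -mulr_suml mu1 mul1r.
have BQ0 (x : 'I_d) : 0 <= BQ by apply: le_trans (Q0 x x Smu) (QB x x Smu).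
rewrite dE -big_split /=; apply: ler_sum => x _.
rewrite mulr_sumr.
have BQ0' := BQ0 x.
apply: (@le_trans _ _ (\sum_(y | y != x) (2 * (mu 0 x * Qlim K A mu x y * (w 0 y - w 0 x)) +
    mu 0 x * (6 * e + 2 * BQ / N%:R)))); last first.
  rewrite big_split /= lerD2l [leRHS](bigID (fun y => y != x)) /= lerDl sumr_ge0 // => y _.
  by rewrite mulr_ge0 // addr_ge0 // ?mulr_ge0 // ?invr_ge0.
apply: ler_sum => y yx; have xy : x != y by rewrite eq_sym.
have -> : mu + N%:R^-1 *: (dlt R y - dlt R x) - nu = w + N%:R^-1 *: (dlt R y - dlt R x).
  by rewrite addrAC.
rewrite sqd_edge //.
have := Qe mu Smu x y xy; have := Q0 x y Smu; have := QB x y Smu.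
move: (QN _ _ _ _ _ _) (Qlim _ _ _ _ _) => q p p1 p0 /ltW pq.
have := w1 x; have := w1 y; move: (w 0 x) (w 0 y) => wx wy wy1 wx1.
have E : N%:R * mu 0 x * q * (2 * N%:R^-1 * (wy - wx) + 2 * N%:R^-1 ^+ 2) =
   2 * (mu 0 x * p * (wy - wx)) + mu 0 x * ((q - p) * (2 * (wy - wx) + 2 * N%:R^-1) + p * (2 * N%:R^-1)).
  by apply: edge_rate_split; rewrite gt_eqF.
rewrite E lerD2l ler_wpM2l // lerD //.
  rewrite (le_trans (ler_norm _)) // normrM [6 * e]mulrC ler_pM //.
  by apply: edge_bound => //; rewrite invr_ge0.
by rewrite mulrCA -mulrA ler_wpM2l // ler_wpM2r ?invr_ge0.
Qed.

Let C2 : R := 2 * C + (B + C) ^+ 2 + 2 * B * (B + C).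

Lemma kurtz_step N (p : config d N -> R) (h e : R) (nu nu' : V) : (0 < N)%N -> 0 <= e ->
  (forall mu, S mu -> forall x y, x != y -> `|QN K AN N mu x y - Qlim K A mu x y| < e) ->
  0 <= h <= 1 -> probN p -> S nu -> S nu' ->
  `|nu' - nu - h *: (\row_x b nu x)| <= C * h ^+ 2 ->
  \sum_y mstep (bQN K AN (N := N)) h p y * sqd (LN R y - nu') <=
  (1 + 2 * d%:R * L * h) * (\sum_y p y * sqd (LN R y - nu)) +
  h * (d%:R * (6 * e + 2 * BQ / N%:R) + d%:R * C2 * h).
Proof.
move=> N0 e0 Qe h01 [p0 p1] Snu Snu' Hr.
have /andP[h0 h1] := h01.
rewrite mstep_dual.
apply: (@le_trans _ _ (\sum_x p x * ((1 + 2 * d%:R * L * h) * sqd (LN R x - nu) +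
   h * (d%:R * (6 * e + 2 * BQ / N%:R) + d%:R * C2 * h)))); last first.
  under eq_bigr do rewrite mulrDr.
  rewrite big_split /= -mulr_suml p1 mul1r mulr_sumr lerD2r.
  by apply: ler_sum => x _; rewrite mulrCA.
apply: ler_sum => bx _; rewrite ler_wpM2l //.
have Smu : S (LN R bx) by exact: LN_simplex.
set mu := LN R bx in Smu *.
apply: (@le_trans _ _ (sqd (mu - nu') + h * (2 * (\sum_z b mu z * (mu - nu') 0 z) +
   d%:R * (6 * e + 2 * BQ / N%:R)))).
  by rewrite lerD2l ler_wpM2l //; exact: gen_sqd.
pose u := mu - nu; pose r := nu' - nu - h *: (\row_x b nu x).
have wE z : (mu - nu') 0 z = u 0 z - h * b nu z - r 0 z by rewrite /u /r !mxE; ring.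
have cs z : (mu - nu') 0 z ^+ 2 + 2 * h * (b mu z * (mu - nu') 0 z) <=
    u 0 z ^+ 2 + 2 * h * (L * sqd u) + C2 * h ^+ 2.
  rewrite !wE; apply: euler_coord_step => //.
  - by rewrite (le_trans (mxnorm_ge u 0 z)) // simplex_dist.
  - exact: bB.
  - exact: bB.
  - exact: le_trans (mxnorm_ge r 0 z) Hr.
  rewrite (le_trans (ler_norm _)) // normrM.
  apply: (@le_trans _ _ (`|u| * (L * `|u|))).
    by rewrite ler_pM //; [exact: mxnorm_ge | exact: bL].
  by rewrite mulrCA -expr2 ler_wpM2l // norm_sqd.
have := ler_sum (index_enum 'I_d) (fun z (_ : true) => cs z).
rewrite !big_split /= -!/(sqd _) !sumr_const !card_ord -mulr_sumr.
rewrite -[(2 * h * (L * sqd u)) *+ d]mulr_natl -[(C2 * _) *+ d]mulr_natl.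
rewrite -/u; move: (sqd (mu - nu')) (sqd u) (\sum_z _) => a1 a2 a3.
have NV : 0 <= N%:R^-1 :> R by rewrite invr_ge0.
lra.
Qed.

(** The order of choice matters: [M] bounds the exit rates of the N-particle chain and may grow with
    N, so the step is made small after N is fixed, while the bound obtained is free of [M] and of
    the starting configuration. *)
Lemma kurtz_iter (t eta : R) : 0 <= t -> 0 < eta -> \forall N \near \oo,
  forall M, (forall bx bw : config d N, bx != bw -> 0 <= bQN K AN bx bw) ->
    (forall bx : config d N, - M <= bQN K AN bx bx) -> \forall n \near \oo, forall bx : config d N,
  let p := iter n.+1 (mstep (bQN K AN (N := N)) (t / n.+1%:R)) (fun y => (bx == y)%:R) in
  [/\ probN p & \sum_y p y * sqd (LN R y - Phi t (LN R bx)) <= expR (2 * d%:R * L * t) * (t * eta)].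
Proof.
move=> t0 eta0.
(* Makes the rate error [d * 6 * e] at most [eta / 4]; noise and time discretization get [eta / 4]
   each. *)
pose e := eta / 2 / (d%:R * 6 + 1) / 2.
have D6 : 0 < d%:R * 6 + 1 :> R by rewrite ltr_wpDl // mulr_ge0.
have e0 : 0 < e by rewrite /e !divr_gt0.
near=> N.
have N0 : (0 < N)%N by near: N; exact: nbhs_infty_gt.
have NR : 0 < N%:R :> R by rewrite ltr0n.
have Qe : forall mu, S mu -> forall x y, x != y -> `|QN K AN N mu x y - Qlim K A mu x y| < e.
  by near: N; exact: QNQ.
have hN : d%:R * (2 * BQ / N%:R) < eta / 4.
  rewrite !mulrA ltr_pdivrMr // [ltRHS]mulrC -ltr_pdivrMr ?divr_gt0 //.
  by near: N; exact: nbhs_infty_gtr.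
move=> M Qoff QM; near=> n => bx.
pose h := t / n.+1%:R.
have n0 : 0 < n.+1%:R :> R by rewrite ltr0n.
have h0 : 0 <= h by rewrite divr_ge0 // ltW.
have h1 : h <= 1.
  by apply: ltW; rewrite /h; near: n; apply: near_mul_harmonic_lt.
have hM : h * M <= 1.
  rewrite /h mulrAC ltW //; near: n; apply: near_mul_harmonic_lt; exact: ltr01.
have hC : d%:R * C2 * h <= eta / 4.
  rewrite /h mulrA ltW //; near: n; apply: near_mul_harmonic_lt; exact: divr_gt0.
have Smu : S (LN R bx) by exact: LN_simplex.
pose q k := iter k (mstep (bQN K AN (N := N)) h) (fun y => (bx == y)%:R).
have qp k : probN (q k).
  elim: k => [|k [IH1 IH2]].
    split=> [y|]; first by rewrite /q /=.
    by rewrite /q /= (bigD1 bx) //= eqxx big1 ?addr0 // => y; rewrite eq_sym => /negbTE ->.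
  split; first by move=> y; exact: (mstep_ge0 Qoff QM h0 hM IH1).
  by rewrite -IH2; exact: (mstep_mass (bQN_row K AN (N := N)) h (q k)).
pose a := 1 + 2 * d%:R * L * h.
have dL0 : 0 <= 2 * d%:R * L by rewrite !mulr_ge0.
have a1 : 1 <= a by rewrite lerDl mulr_ge0.
have E k : \sum_y q k y * sqd (LN R y - Phi (k%:R * h) (LN R bx)) <= a ^+ k * (k%:R * (h * eta)).
  elim: k => [|k IH].
    rewrite /q /= mul0r Phi0 // mul0r mulr0 big1 // => y _.
    case: eqP => [<-|_]; last by rewrite mul0r.
    by rewrite subrr mul1r /sqd big1 // => z _; rewrite mxE expr0n.
  have kh : 0 <= k%:R * h by rewrite mulr_ge0.
  have -> : k.+1%:R * h = k%:R * h + h by rewrite -natr1 mulrDl mul1r.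
  rewrite /q iterS -/(q k).
  have h01 : 0 <= h <= 1 by rewrite h0.
  have := kurtz_step N0 (ltW e0) Qe h01 (qp k) (PhiS kh Smu)
     (PhiS (addr_ge0 kh h0) Smu) (Phistep kh h0 Smu).
  rewrite -/a => /le_trans; apply.
  have s1 : a * (\sum_y q k y * sqd (LN R y - Phi (k%:R * h) (LN R bx))) <=
      a ^+ k.+1 * (k%:R * (h * eta)).
    by rewrite exprS -mulrA ler_wpM2l // (le_trans ler01).
  have s2 : h * (d%:R * (6 * e + 2 * BQ / N%:R) + d%:R * C2 * h) <= h * eta.
    rewrite ler_wpM2l //.
    have e6 : d%:R * (6 * e) <= eta / 4.
      rewrite /e; have -> : d%:R * (6 * (eta / 2 / (d%:R * 6 + 1) / 2)) =
        eta / 4 * (d%:R * 6 / (d%:R * 6 + 1)) by field; rewrite gt_eqF.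
      apply: ler_piMr; first by rewrite divr_ge0 // ltW.
      by rewrite ler_pdivrMr // mul1r lerDl.
    lra.
  have s3 : h * eta <= a ^+ k.+1 * (h * eta).
    by rewrite ler_peMl ?exprn_ege1 // mulr_ge0 // ltW.
  have -> : a ^+ k.+1 * (k.+1%:R * (h * eta)) = a ^+ k.+1 * (k%:R * (h * eta)) + a ^+ k.+1 * (h * eta).
    by rewrite -natr1; ring.
  lra.
split; first exact: (qp n.+1).
have nh : n.+1%:R * h = t by rewrite mulrCA mulfV ?gt_eqF // mulr1.
have := E n.+1; rewrite [n.+1%:R * (h * eta)]mulrA nh => /le_trans; apply.
apply: ler_wpM2r; first by rewrite mulr_ge0 // ltW.
have -> : 2 * d%:R * L * t = n.+1%:R * (2 * d%:R * L * h) by rewrite -nh; ring.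
rewrite expRM_natl; apply: lerXn2r; rewrite ?nnegrE ?expR_ge0 ?expR_ge1Dx //.
exact: le_trans a1.
Unshelve. all: by end_near. Qed.

Variable x0 : 'I_d.
Variable c : forall N : nat, R -> config d N -> R.
Hypothesis csol : forall N : nat, (0 < N)%N -> master_sol K AN (@c N).

(** A Chebyshev argument: the oscillation of [g] is at most [eps / 2] plus a multiple of the squared
    distance, whose mean is small by [kurtz_iter]. The law at time [t] is a mixture over starting
    configurations, by linearity of the Euler steps. *)
Lemma push_integ_flow_cvg t (g : V -> R) : 0 <= t -> ucS g ->
  push_integ (@c N t) g - push_integ (@c N 0) (fun mu => g (Phi t mu)) @[N --> \oo] --> (0 : R).
Proof.
move=> t0 gu; apply/cvgrPdist_le => eps eps0.
have [Bg Bg0 HBg] := ucS_bounded x0 gu.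
have eps20 : 0 < eps / 2 by rewrite divr_gt0.
have [r r0 Hr] := gu _ eps20.
pose m := 2 * Bg / r ^+ 2.
have m0 : 0 <= m by apply: divr_ge0; [exact: mulr_ge0 | exact: sqr_ge0].
have gsq mu nu : S mu -> S nu -> `|g mu - g nu| <= eps / 2 + m * sqd (mu - nu).
  move=> Smu Snu; have [h|h] := ltP `|mu - nu| r.
    by rewrite (le_trans (ltW (Hr _ _ Snu Smu h))) // lerDl mulr_ge0 // sqd_ge0.
  have h1 : `|g mu - g nu| <= 2 * Bg.
    by rewrite (le_trans (ler_normB _ _)) //; have := HBg _ Smu; have := HBg _ Snu; lra.
  have h2 : 2 * Bg <= m * sqd (mu - nu).
    have r2 : 0 < r ^+ 2 by rewrite exprn_gt0.
    have h3 : r ^+ 2 <= sqd (mu - nu).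
      by rewrite (le_trans _ (norm_sqd _)) // lerXn2r ?nnegrE // ltW.
    by rewrite /m mulrAC ler_pdivlMr // ler_wpM2l // mulr_ge0.
  by rewrite (le_trans h1) // (le_trans h2) // lerDr ltW.
pose E := expR (2 * d%:R * L * t).
have E0 : 0 <= m * (E * t) by apply: mulr_ge0 => //; apply: mulr_ge0 => //; exact: expR_ge0.
pose eta := eps / 2 / (m * (E * t) + 1).
have eta0 : 0 < eta by rewrite divr_gt0 // ltr_wpDl.
have etaE : m * (E * (t * eta)) <= eps / 2.
  have -> : m * (E * (t * eta)) = m * (E * t) * eta by ring.
  rewrite /eta mulrCA; apply: ler_piMr; first exact: ltW.
  by rewrite ler_pdivrMr ?ltr_wpDl // mul1r lerDl.
have K1 := kurtz_iter t0 eta0.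
near=> N.
have N0 : (0 < N)%N by near: N; exact: nbhs_infty_gt.
have [M [Qoff QM ecvg]] := master_sol_euler N0 (ANs N) (csol N0).
have [cp _] := csol N0.
have [c00 c01] := cp 0 (lexx _).
have KN : \forall n \near \oo, forall bx : config d N,
  let p := iter n.+1 (mstep (bQN K AN (N := N)) (t / n.+1%:R)) (fun y => (bx == y)%:R) in
  [/\ probN p & \sum_y p y * sqd (LN R y - Phi t (LN R bx)) <= E * (t * eta)].
  by move: M Qoff QM {ecvg}; near: N; exact: K1.
pose p n := iter n.+1 (mstep (bQN K AN (N := N)) (t / n.+1%:R)) (@c N 0).
have pcvg : `|push_integ (@c N 0) (fun mu => g (Phi t mu)) - push_integ (p n) g| @[n --> \oo] -->
    `|push_integ (@c N 0) (fun mu => g (Phi t mu)) - push_integ (@c N t) g|.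
  apply: cvg_norm; apply: cvgB; first exact: cvg_cst.
  apply: cvg_big => [|y _]; first exact: add_continuous.
  by apply: cvgM; [exact: ecvg | exact: cvg_cst].
rewrite sub0r opprB; apply: (cvgr_to_le pcvg); near=> n.
have Kn : forall bx : config d N,
  let p := iter n.+1 (mstep (bQN K AN (N := N)) (t / n.+1%:R)) (fun y => (bx == y)%:R) in
  [/\ probN p & \sum_y p y * sqd (LN R y - Phi t (LN R bx)) <= E * (t * eta)] by near: n.
pose q bx := iter n.+1 (mstep (bQN K AN (N := N)) (t / n.+1%:R)) (fun y => (bx == y)%:R).
have pE : p n = fun y => \sum_bx @c N 0 bx * q bx y.
  rewrite /p -[X in iter _ _ X = _](_ : (fun y => \sum_bx @c N 0 bx * (bx == y)%:R) = _).
    exact: iter_mstep_lin.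
  apply/funext => y; rewrite (bigD1 y) //= eqxx mulr1 big1 ?addr0 // => bx /negbTE ->.
  by rewrite mulr0.
have -> : push_integ (@c N 0) (fun mu => g (Phi t mu)) - push_integ (p n) g =
   \sum_bx @c N 0 bx * \sum_y q bx y * (g (Phi t (LN R bx)) - g (LN R y)).
  rewrite /push_integ pE.
  have -> : \sum_y (\sum_bx @c N 0 bx * q bx y) * g (LN R y) =
      \sum_bx @c N 0 bx * \sum_y q bx y * g (LN R y).
    under eq_bigr do rewrite mulr_suml.
    rewrite exchange_big /=; apply: eq_bigr => bx _; rewrite mulr_sumr.
    by apply: eq_bigr => y _; rewrite mulrA.
  rewrite -sumrB; apply: eq_bigr => bx _; rewrite -mulrBr; congr (_ * _).
  have [[_ q1] _] := Kn bx.
  under [RHS]eq_bigr do rewrite mulrBr.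
  by rewrite sumrB -mulr_suml q1 mul1r.
rewrite (le_trans (ler_norm_sum _ _ _)) //.
apply: (@le_trans _ _ (\sum_bx @c N 0 bx * eps)); last by rewrite -mulr_suml c01 mul1r.
apply: ler_sum => bx _; rewrite normrM (ger0_norm (c00 bx)) ler_wpM2l //.
have [[q0 q1] qsq] := Kn bx.
have Smu : S (LN R bx) by exact: LN_simplex.
rewrite (le_trans (ler_norm_sum _ _ _)) //.
apply: (@le_trans _ _ (\sum_y (q bx y * (eps / 2) + m * (q bx y * sqd (LN R y - Phi t (LN R bx)))))).
  apply: ler_sum => y _; rewrite normrM (ger0_norm (q0 y)) [m * _]mulrCA -mulrDr ler_wpM2l // distrC.
  by apply: gsq; [exact: LN_simplex | exact: PhiS].
rewrite big_split /= -mulr_suml q1 mul1r -mulr_sumr.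
rewrite [leRHS](splitr eps) lerD2l (le_trans _ etaE) // ler_wpM2l //.
Unshelve. all: by end_near. Qed.

End kurtz.

(** * Transport by the flow *)

Section simplex_integral.
Variables (R : realType) (d : nat).
Local Notation V := (vec R d).
Local Notation S := (@simplex R d).
Local Notation T := (borelT R d).
Variable x0 : 'I_d.
Implicit Types (M : probability T R) (f g : V -> R).

Lemma open_borel_measurable (U : set V) : open U -> measurable (U : set T).
Proof. by move=> oU; apply: sub_sigma_algebra. Qed.

Lemma simplex_measurable : measurable (S : set T).
Proof.
rewrite -[S]setCK; apply: measurableC; apply: open_borel_measurable.
by apply: closed_openC; exact: simplex_closed.
Qed.

Lemma continuous_borel_measurable f : continuous f -> measurable_fun [set: T] (f : T -> R).
Proof.
move=> /continuousP fc; apply: (measurability _ (RGenOpens.measurableE R)).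
move=> _ [_ [a [b ->]] <-]; rewrite setTI; apply: open_borel_measurable.
by apply: fc; exact: itv_open.
Qed.

Lemma ucS_rtrP f : ucS f <-> continuous (f \o rtr x0).
Proof.
split; first exact: ucS_rtr.
move=> fc e e0; have [r r0 Hr] := compact_unif_cont (@simplex_compact R d) (fun mu _ => fc mu) e0.
exists r => // mu nu Smu Snu h.
by have := Hr mu nu Smu h; rewrite /= !rtr_id.
Qed.

Lemma ucS_cst (a : R) : ucS (fun _ : V => a).
Proof. exact/lipS_ucS/lipS_cst. Qed.

Lemma ucS_add f g : ucS f -> ucS g -> ucS (fun mu => f mu + g mu).
Proof.
move=> /ucS_rtrP fc /ucS_rtrP gc; apply/ucS_rtrP.
have gen (X : topologicalType) (a b : X -> R) : continuous a -> continuous b ->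
    continuous (fun x => a x + b x).
  by move=> ac bc x; apply: cvgD; [exact: ac | exact: bc].
exact: gen fc gc.
Qed.

Lemma ucS_mul f g : ucS f -> ucS g -> ucS (fun mu => f mu * g mu).
Proof.
move=> /ucS_rtrP fc /ucS_rtrP gc; apply/ucS_rtrP.
have gen (X : topologicalType) (a b : X -> R) : continuous a -> continuous b ->
    continuous (fun x => a x * b x).
  by move=> ac bc x; apply: cvgM; [exact: ac | exact: bc].
exact: gen fc gc.
Qed.

Lemma ucS_sub f g : ucS f -> ucS g -> ucS (fun mu => f mu - g mu).
Proof.
move=> fu gu; have := ucS_add fu (ucS_mul (ucS_cst (-1)) gu).
by under eq_fun do rewrite mulN1r.
Qed.

Lemma ucS_integrable M f : ucS f -> M.-integrable S (EFin \o f).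
Proof.
move=> fu; apply: measurable_bounded_integrable.
- exact: simplex_measurable.
- by rewrite (le_lt_trans (probability_le1 M simplex_measurable)) // ltry.
- apply: (eq_measurable_fun (f \o rtr x0 : T -> R)).
    by move=> mu; rewrite inE => Smu; rewrite /= rtr_id.
  by apply: measurable_funTS; apply: continuous_borel_measurable; exact: ucS_rtr.
have [B _ HB] := ucS_bounded x0 fu.
exists B; split=> [|C BC mu Smu]; first exact: num_real.
by rewrite /= (le_trans (HB mu Smu)) // ltW.
Qed.

Lemma integ_eq M f g : (forall mu, S mu -> f mu = g mu) -> integ M f = integ M g.
Proof. by move=> E; apply: eq_Rintegral => mu; rewrite inE; exact: E. Qed.

Lemma integ_sub M f g : ucS f -> ucS g ->
  integ M (fun mu => f mu - g mu) = integ M f - integ M g.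
Proof.
by move=> fu gu; apply: RintegralB; [exact: simplex_measurable | exact: ucS_integrable..].
Qed.

Lemma integ_scale M (a : R) f : ucS f -> integ M (fun mu => a * f mu) = a * integ M f.
Proof. by move=> fu; apply: RintegralZl; [exact: simplex_measurable | exact: ucS_integrable]. Qed.

Lemma integ_le M f (e : R) : PP M -> ucS f -> (forall mu, S mu -> `|f mu| <= e) ->
  `|integ M f| <= e.
Proof.
move=> PM fu fe.
have mS := simplex_measurable.
have nf : ucS (fun mu => `|f mu|).
  move=> e' e'0; have [r r0 Hr] := fu e' e'0; exists r => // mu nu Smu Snu h.
  by rewrite (le_lt_trans (ler_dist_dist _ _)) // Hr.
apply: le_trans (le_normr_Rintegral mS (ucS_integrable M fu)) _.
have -> : e = \int[M]_(x in S) e.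
  rewrite Rintegral_cst //; have -> : fine (M S) = 1 by rewrite PM.
  by rewrite mulr1.
apply: le_Rintegral => //; [exact: ucS_integrable | exact/ucS_integrable/ucS_cst].
Qed.

Lemma integ_dist M f g (e : R) : PP M -> ucS f -> ucS g ->
  (forall mu, S mu -> `|f mu - g mu| <= e) -> `|integ M f - integ M g| <= e.
Proof.
by move=> PM fu gu H; rewrite -integ_sub //; apply: integ_le => //; exact: ucS_sub.
Qed.

Lemma PP_integral_setT M f : PP M -> continuous f -> (exists B, forall mu, `|f mu| <= B) ->
  \int[M]_mu f mu = integ M f.
Proof.
move=> PM fc [B HB].
have mS := simplex_measurable.
have mf := continuous_borel_measurable fc.
have mE : measurable_fun [set: T] (fun mu : T => (f mu)%:E) by apply/measurable_EFinP.
have If : M.-integrable [set: T] (EFin \o f).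
  apply: measurable_bounded_integrable => //.
    by rewrite (le_lt_trans (probability_le1 M measurableT)) // ltry.
  exists B; split=> [|C BC mu _]; first exact: num_real.
  by rewrite /= (le_trans (HB mu)) // ltW.
rewrite -(setUv (S : set T)) Rintegral_setU //; last 3 first.
- exact: measurableC.
- by rewrite setUv.
- by apply/disj_setPS; rewrite setICr.
rewrite [X in _ + X](_ : _ = 0) ?addr0 // /Rintegral null_set_integral //.
- exact: measurableC.
- exact: (@measurable_funS _ _ T _ setT _ _ measurableT (@subsetT _ _) mE).
- apply: (etrans (probability_setC M mS)).
  have -> : M S = 1%E by [].
  by rewrite subee.
Qed.

Section push.
Variable psi : V -> V.
Hypothesis psic : continuous psi.
Hypothesis psiS : forall mu, S (psi mu).

Let psi_measurable : measurable_fun [set: T] (psi : T -> T).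
Proof.
apply: (@measurability _ _ T T setT psi open) => //.
move=> _ [U oU <-]; rewrite setTI; apply: open_borel_measurable.
by move/continuousP : psic; exact.
Qed.

Definition push_mfun : {mfun T >-> T} :=
  MeasurableFun.Pack (MeasurableFun.Class (isMeasurableFun.Build _ _ _ _ _ psi_measurable)).

Let psi_preimage : psi @^-1` S = [set: V].
Proof. by apply/seteqP; split=> // mu _; exact: psiS. Qed.

Lemma push_PP M : PP (distribution M push_mfun).
Proof.
have -> : PP (distribution M push_mfun) = (M (psi @^-1` S) = 1%E) by [].
by rewrite psi_preimage; exact: probability_setT.
Qed.

(** [f] may fail to be measurable off the simplex, so it is first replaced by [f \o rtr x0]. *)
Lemma integ_push M f : PP M -> ucS f ->
  integ (distribution M push_mfun) f = integ M (fun mu => f (psi mu)).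
Proof.
move=> PM fu.
have -> : integ (distribution M push_mfun) f = integ (distribution M push_mfun) (f \o rtr x0).
  by apply: integ_eq => mu Smu; rewrite /= rtr_id.
have fpc : continuous (f \o psi) by exact: ucS_comp.
have [B _ HB] := ucS_bounded x0 fu.
rewrite -(PP_integral_setT PM fpc); last by exists B => mu; exact: HB.
rewrite /integ /Rintegral /distribution.
rewrite integral_pushforward //=.
- rewrite psi_preimage; congr fine; apply: eq_integral => mu _ /=.
  by rewrite rtr_id.
- have fr : continuous (f \o rtr x0) by exact: ucS_rtr.
  by apply/measurable_EFinP; exact: (continuous_borel_measurable fr).
- rewrite psi_preimage (_ : _ \o psi = EFin \o (f \o psi)); last first.
    by apply/funext => mu /=; rewrite rtr_id.
  apply: measurable_bounded_integrable => //.
  - by rewrite (le_lt_trans (probability_le1 M measurableT)) // ltry.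
  - exact: (continuous_borel_measurable fpc).
  exists B; split=> [|C BC mu _]; first exact: num_real.
  by rewrite /= (le_trans (HB _ (psiS mu))) // ltW.
- exact: simplex_measurable.
Qed.

End push.

End simplex_integral.

Lemma diff_quotient (R : realType) (h a b c : R) : h != 0 ->
  c - h^-1 *: (a - b) = - h^-1 * (a - b - h * c).
Proof.
move=> h0; transitivity (c - h^-1 * (a - b)); first by [].
by field.
Qed.

(** Only forward increments are controlled. For negative [h] the forward step [- h] starts from
    [t + h], which is why the bound is uniform in the base point and [G] must be continuous at
    [t]. *)
Lemma is_derive_uniform (R : realType) (g G : R -> R) (t T : R) : 0 < t < T ->
  (forall e : R, 0 < e -> exists2 r : R, 0 < r & forall u s, 0 <= u <= T -> 0 <= s < r ->
     `|g (u + s) - g u - s * G u| <= e * s) ->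
  {for t, continuous G} -> is_derive t 1 g (G t).
Proof.
move=> /andP[t0 tT] gG Gc.
have C : (fun h : R => h^-1 *: ((g \o shift t) (h *: 1) - g t)) @ 0^' --> G t.
  apply/cvgrPdist_le => e e0; have e20 : 0 < e / 2 by rewrite divr_gt0.
  have [r r0 Hr] := gG _ e20.
  have Gn : \forall h \near (0 : R), `|G t - G (t + h)| <= e / 2.
    have : G (t + h) @[h --> (0 : R)] --> G t.
      by rewrite -[X in _ --> G X](addr0 t); apply: (@continuous_comp _ _ _ (fun h => t + h) G);
        [exact: (@continuousD _ _ _ (cst t) id _ (cvg_cst _) cvg_id) | rewrite addr0].
    by move/cvgrPdist_le; apply.
  have hr : \forall h \near (0 : R), `|h| < r by exact: nbhs0_lt.
  have ht : \forall h \near (0 : R), `|h| < t by exact: nbhs0_lt.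
  near=> h.
  have h0 : h != 0 by near: h; exact: nbhs_dnbhs_neq.
  have hGn : `|G t - G (t + h)| <= e / 2 by near: h; exact: (@dnbhs_filter _ 0 _ Gn) || exact: nbhs_dnbhs.
  have hhr : `|h| < r by near: h; exact: nbhs_dnbhs.
  have hht : `|h| < t by near: h; exact: nbhs_dnbhs.
  rewrite /= [h *: 1]mulr1 [h + t]addrC.
  rewrite (@diff_quotient R h (g (t + h)) (g t) (G t) h0).
  rewrite normrM normrN normfV ler_pdivrMl ?normr_gt0 //.
  have [hp|hn] := ltP 0 h.
    have tT' : 0 <= t <= T by rewrite (ltW t0) (ltW tT).
    have hr' : 0 <= h < r by rewrite (ltW hp) -(gtr0_norm hp).
    apply: le_trans (Hr t h tT' hr') _; rewrite gtr0_norm // mulrC.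
    by rewrite ler_pM2l //; lra.
  have hn' : 0 <= - h < r by rewrite oppr_ge0 hn -(ler0_norm hn).
  have th : 0 <= t + h <= T.
    by move: hht; rewrite ltr_norml => /andP[? ?]; apply/andP; split; lra.
  have := Hr (t + h) (- h) th hn'; rewrite addrK => H.
  have E : g (t + h) - g t - h * G t = - (g t - g (t + h) - - h * G (t + h)) + - h * (G t - G (t + h)) by ring.
  rewrite E (le_trans (ler_normD _ _)) // normrN normrM normrN.
  have hh : `|h| = - h by rewrite ler0_norm.
  have := ler_wpM2l (normr_ge0 h) hGn; rewrite hh in H *.
  lra.
split; first by apply/cvg_ex; exists (G t).
by rewrite /derive; apply: cvg_lim.
Unshelve. all: by end_near. Qed.

(** * The image of the initial law under the flow and its Liouville equation *)

Section transport.
Variables (R : realType) (d : nat).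
Local Notation V := (vec R d).
Local Notation S := (@simplex R d).
Variable x0 : 'I_d.
Variables (b : 'I_d -> V -> R) (B : R) (Phi : R -> V -> V) (E : R -> R) (C : R).
Hypothesis bu : forall x, ucS (b x).
Hypothesis B0 : 0 <= B.
Hypothesis bB : forall mu x, S mu -> `|b x mu| <= B.
Hypothesis C0 : 0 <= C.
Hypothesis Phi0 : forall mu, S mu -> Phi 0 mu = mu.
Hypothesis PhiS : forall t mu, 0 <= t -> S mu -> S (Phi t mu).
Hypothesis Phistep : forall t s mu, 0 <= t -> 0 <= s -> S mu ->
  `|Phi (t + s) mu - Phi t mu - s *: (\row_x b x (Phi t mu))| <= C * s ^+ 2.
Hypothesis E0 : forall t, 0 < E t.
Hypothesis PhiL : forall t mu nu, 0 <= t -> S mu -> S nu ->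
  `|Phi t mu - Phi t nu| <= E t * `|mu - nu|.

Lemma flow_dist t s mu : 0 <= t -> 0 <= s -> s <= 1 -> S mu ->
  `|Phi (t + s) mu - Phi t mu| <= (B + C) * s.
Proof.
move=> t0 s0 s1 Smu.
rewrite -[X in `|X|](subrK (s *: (\row_x b x (Phi t mu)))) (le_trans (ler_normD _ _)) //.
have h1 := Phistep t0 s0 Smu.
have h2 : `|s *: (\row_x b x (Phi t mu))| <= s * B.
  rewrite normrZ ger0_norm // ler_wpM2l //; apply: ler_mxnorm => // i x.
  by rewrite mxE bB //; exact: PhiS.
have h3 : C * s ^+ 2 <= C * s by rewrite ler_wpM2l // expr2 ler_piMr.
lra.
Qed.

Lemma ucS_flow f t : 0 <= t -> ucS f -> ucS (fun mu => f (Phi t mu)).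
Proof.
move=> t0 fu e e0; have [r r0 Hr] := fu e e0.
exists (r / E t); first by rewrite divr_gt0.
move=> mu nu Smu Snu h; apply: Hr; try exact: PhiS.
by rewrite (le_lt_trans (PhiL t0 Snu Smu)) // mulrC -ltr_pdivlMr.
Qed.

(** Extends the flow to a continuous map on the whole space for every real [t], so that it can push
    measures forward. *)
Definition flow_retract (t : R) (mu : V) : V := Phi (Num.max 0 t) (rtr x0 mu).

Lemma flow_retract_simplex t mu : S (flow_retract t mu).
Proof. by apply: PhiS; [rewrite le_max lexx | exact: rtr_simplex]. Qed.

Lemma flow_retract_continuous t : continuous (flow_retract t).
Proof.
have m0 : 0 <= Num.max 0 t by rewrite le_max lexx.
have gen (X : topologicalType) (f : X -> V) : continuous f -> (forall x, S (f x)) ->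
    continuous (fun x => Phi (Num.max 0 t) (f x)).
  move=> fc fS x; apply/cvgrPdist_lt => e e0.
  have /cvgrPdist_lt/(_ _ (divr_gt0 e0 (E0 (Num.max 0 t)))) := fc x.
  apply: filterS => y h; rewrite (le_lt_trans (PhiL m0 _ _)) //.
  by rewrite mulrC -ltr_pdivlMr.
by apply: gen; [exact: rtr_continuous | exact: rtr_simplex].
Qed.

Variable M0 : probability (borelT R d) R.
Hypothesis PM0 : PP M0.

(** The case distinction makes the law at time 0 equal to [M0] as a measure, as [liouville_weak]
    demands; the push-forward by the retraction would only have the same integrals over the
    simplex. *)
Definition flow_law (t : R) : probability (borelT R d) R :=
  if t <= 0 then M0 else distribution M0 (push_mfun (@flow_retract_continuous t)).

Lemma flow_law0 : flow_law 0 = M0.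
Proof. by rewrite /flow_law lexx. Qed.

Lemma flow_law_PP t : PP (flow_law t).
Proof.
by rewrite /flow_law; case: ifP => // _; apply: push_PP; exact: flow_retract_simplex.
Qed.

Lemma integ_flow_law t f : 0 <= t -> ucS f ->
  integ (flow_law t) f = integ M0 (fun mu => f (Phi t mu)).
Proof.
rewrite le_eqVlt => /predU1P[<-|t0] fu.
  by rewrite flow_law0; apply: integ_eq => mu Smu; rewrite Phi0.
rewrite /flow_law leNgt t0 /= (integ_push x0 _ (flow_retract_simplex t)) //.
apply: integ_eq => mu Smu; rewrite /flow_retract rtr_id //.
by rewrite max_r // ltW.
Qed.

Definition ucTS (F : R -> V -> R) := forall T e : R, 0 < e -> exists2 r : R, 0 < r &
  forall t t' mu mu', 0 <= t <= T -> 0 <= t' <= T -> S mu -> S mu' ->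
    `|t' - t| < r -> `|mu' - mu| < r -> `|F t' mu' - F t mu| < e.

Lemma ucTS_ucS F t : 0 <= t -> ucTS F -> ucS (F t).
Proof.
move=> t0 FU e e0; have [r r0 Hr] := FU t e e0; exists r => // mu nu Smu Snu h.
by apply: Hr => //; rewrite ?t0 ?lexx // subrr normr0.
Qed.

Lemma ucTS_cst f : ucS f -> ucTS (fun _ => f).
Proof.
move=> fu T e e0; have [r r0 Hr] := fu e e0; exists r => // t t' mu mu' _ _ Smu Smu' _.
exact: Hr.
Qed.

Lemma ucTS_joint F : continuous (fun p : R * V => F p.1 (rtr x0 p.2)) -> ucTS F.
Proof.
move=> Fc T e e0.
have cTS : compact (`[0, T]%classic `*` S : set (R * V)).
  by apply: compact_setX; [exact: segment_compact | exact: simplex_compact].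
have [r r0 Hr] := compact_unif_cont cTS (fun p _ => Fc p) e0.
exists r => // t t' mu mu' tT t'T Smu Smu' h1 h2.
have := Hr (t, mu) (t', mu'); rewrite /= !rtr_id //; apply.
  by split => //=; rewrite in_itv.
by rewrite prod_normE /= gt_max h1 h2.
Qed.

Lemma flow_integral_uc F T e : ucTS F -> 0 < e -> exists2 r : R, 0 < r &
  forall t t', 0 <= t <= T -> 0 <= t' <= T -> `|t' - t| < r ->
    `|integ M0 (fun mu => F t' (Phi t' mu)) - integ M0 (fun mu => F t (Phi t mu))| <= e.
Proof.
move=> FU e0; have [r r0 Hr] := FU T e e0.
have BC0 : 0 < B + C + 1 by rewrite ltr_wpDl // addr_ge0.
pose r' := Num.min (Num.min 1 r) (r / (B + C + 1)).
have r'0 : 0 < r' by rewrite !lt_min ltr01 r0 divr_gt0.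
exists r' => // t t' tT t'T h.
have /andP[t0 _] := tT; have /andP[t'0 _] := t'T.
apply: integ_dist => //; try (by apply: ucS_flow => //; exact: ucTS_ucS).
move=> mu Smu; move: h; rewrite !lt_min -andbA => /and3P[h1 h2 h3].
apply/ltW/Hr => //; try exact: PhiS.
have key u v : 0 <= u -> u <= v -> `|v - u| < 1 -> `|Phi v mu - Phi u mu| <= (B + C) * `|v - u|.
  move=> u0 uv; have uv' : 0 <= v - u by rewrite subr_ge0.
  rewrite ger0_norm // => vu1; have := flow_dist u0 uv' (ltW vu1) Smu.
  by rewrite [u + (v - u)]addrC subrK.
have : `|Phi t' mu - Phi t mu| <= (B + C) * `|t' - t|.
  have [tt'|/ltW tt'] := leP t t'; first exact: key.
  by rewrite distrC [`|t' - t|]distrC; apply: key; rewrite // distrC.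
move/le_lt_trans; apply.
rewrite (@le_lt_trans _ _ ((B + C + 1) * `|t' - t|)) //; first by rewrite ler_wpM2r // lerDl.
by rewrite mulrC -ltr_pdivlMr.
Qed.

Lemma flow_integral_continuous F t : ucTS F -> 0 < t ->
  {for t, continuous (fun t => integ M0 (fun mu => F t (Phi t mu)))}.
Proof.
move=> FU t0; apply/cvgrPdist_le => e e0.
have [r r0 Hr] := flow_integral_uc (t + 1) FU e0.
have nt : \forall s \near t, `|t - s| < r.
  by have /cvgrPdist_lt := @cvg_id _ (nbhs t); apply.
near=> s.
have s0 : 0 < s by near: s; exact: lt_nbhsr.
have s1 : s < t + 1 by near: s; apply: lt_nbhsl; rewrite ltrDl.
have sr : `|t - s| < r by near: s.
by apply: Hr => //; [rewrite (ltW s0) ltW | rewrite (ltW t0) lerDl ler01].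
Unshelve. all: by end_near. Qed.

Lemma flow_law_continuous f : test_fun f ->
  {within [set t : R | 0 <= t], continuous (fun t => integ (flow_law t) f)}.
Proof.
move=> [fc _]; have fu : ucS f by apply: ucS_continuous => mu _; exact: fc.
have FU := ucTS_cst fu.
(* Freezing negative times gives a function continuous on the whole line, whose restriction is the
   one wanted. *)
pose J t := integ M0 (fun mu => f (Phi (Num.max 0 t) mu)).
apply: (@subspace_eq_continuous _ _ _ J).
  move=> t; rewrite inE => /= t0; rewrite /J /from_subspace /= integ_flow_law //.
  by rewrite max_r.
apply: continuous_subspaceT => t; apply/cvgrPdist_le => e e0.
have [r r0 Hr] := flow_integral_uc (`|t| + 1) FU e0.
have nt : \forall s \near t, `|t - s| < r.
  by have /cvgrPdist_lt := @cvg_id _ (nbhs t); apply.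
near=> s.
have s1 : s <= `|t| + 1.
  by apply: ltW; near: s; apply: lt_nbhsl; rewrite ltr_pwDr ?ler_norm.
have sr : `|t - s| < r by near: s.
apply: Hr.
- by rewrite le_max lexx ge_max s1 addr_ge0.
- by rewrite le_max lexx ge_max (le_trans (ler_norm t)) ?lerDl // addr_ge0.
apply: le_lt_trans sr; rewrite /Num.max.
case: ltP => h1; case: ltP => h2; rewrite ?subrr ?normr0 //.
- rewrite subr0 ger0_norm ?(ltW h1) // ler_normr; apply/orP; left; lra.
- rewrite sub0r normrN ger0_norm ?(ltW h2) // ler_normr; apply/orP; right; lra.
Unshelve. all: by end_near. Qed.

Variable phi : R -> V -> R.
Hypothesis phiC : C1c phi.

Let F t nu := dtime phi t nu + \sum_x dspace phi x t nu * b x nu.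

Let joint_rtr (f : R * V -> R) : continuous f -> continuous (fun p : R * V => f (p.1, rtr x0 p.2)).
Proof.
have gen (X Y Z W : topologicalType) (u : X -> Y) (v : X -> Z) (g : Y * Z -> W) :
    continuous u -> continuous v -> continuous g -> continuous (fun x => g (u x, v x)).
  move=> uc vc gc x; apply: (@continuous_comp _ _ _ (fun x => (u x, v x)) g); last exact: gc.
  by apply: cvg_pair; [exact: uc | exact: vc].
move=> fc; apply: gen fc => p; first exact: cvg_fst.
apply: (@continuous_comp _ _ _ (fun p : R * V => p.2) (rtr x0)); first exact: cvg_snd.
exact: rtr_continuous.
Qed.

Let phi_uc : ucTS phi.
Proof. by apply: ucTS_joint; have [_ [_ [H _]]] := phiC; apply: (joint_rtr H). Qed.

Let F_uc : ucTS F.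
Proof.
have [_ [_ [_ [dtc [dsc _]]]]] := phiC.
have gen (X : topologicalType) (a : X -> R) (c e : 'I_d -> X -> R) :
    continuous a -> (forall x, continuous (c x)) -> (forall x, continuous (e x)) ->
    continuous (fun p => a p + \sum_x c x p * e x p).
  move=> ac cc ec p; apply: cvgD; first exact: ac.
  apply: cvg_big => [|x _]; first exact: add_continuous.
  by apply: cvgM; [exact: cc | exact: ec].
apply: ucTS_joint; apply: gen => [|x|x]; [exact: (joint_rtr dtc) | exact: (joint_rtr (dsc x)) |].
move=> p; apply: (@continuous_comp _ _ _ (fun p : R * V => p.2) (b x \o rtr x0)).
  exact: cvg_snd.
exact: ucS_rtr.
Qed.

Let box (T : R) : set (R * V) := `[0, T]%classic `*` S.

Let box_compact T : compact (box T).
Proof. by apply: compact_setX; [exact: segment_compact | exact: simplex_compact]. Qed.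

(** The increment is taken first in time at the arrival point, then in space at time [u]. The
    derivatives are compared with those at the starting point, uniformly on the compact [box T], and
    the quadratic defect of the flow is multiplied by a bound on the gradient. *)
Lemma flow_chain_rule (T e : R) : 0 < e -> exists2 r : R, 0 < r & forall u s mu,
  0 <= u <= T -> 0 <= s < r -> S mu ->
  `|phi (u + s) (Phi (u + s) mu) - phi u (Phi u mu) - s * F u (Phi u mu)| <= e * s.
Proof.
move=> e0; have [pdt [pds [_ [dtc [dsc _]]]]] := phiC.
have BC0 : 0 <= B + C by rewrite addr_ge0.
pose D : R := 1 + d%:R * (B + C).
have D0 : 0 < D by rewrite ltr_pwDl // mulr_ge0.
pose e' := e / 2 / D.
have e'0 : 0 < e' by rewrite !divr_gt0.
have [rt rt0 Hrt] := compact_unif_cont (@box_compact T) (fun p _ => dtc p) e'0.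
have /choice [rx Hrx] : forall x, exists r : R, 0 < r /\ forall p q : R * V, box T p -> `|q - p| < r ->
    `|dspace phi x q.1 q.2 - dspace phi x p.1 p.2| < e'.
  by move=> x; have [r r0 Hr] := compact_unif_cont (@box_compact T) (fun p _ => dsc x p) e'0; exists r.
have /choice [m Hm] : forall x, exists m : R, 0 <= m /\ forall p : R * V, box T p -> `|dspace phi x p.1 p.2| <= m.
  move=> x; have [m [r [m0 r0 Hr]]] := compact_bounded_near (@box_compact T) (fun p _ => dsc x p).
  by exists m; split => // p bp; apply: (Hr p) => //; rewrite subrr normr0.
pose M := \sum_x m x.
have M0' : 0 <= M by apply: sumr_ge0 => x _; case: (Hm x).
have mM x : m x <= M by rewrite /M (bigD1 x) //= lerDl; apply: sumr_ge0 => y _; case: (Hm y).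
pose r := \big[Num.min/rt]_x rx x.
have r0 : 0 < r by apply: (big_ind (fun u => 0 < u)) => // [a c a0 c0|x _]; [rewrite lt_min a0 | case: (Hrx x)].
have rrt : r <= rt by exact: bigmin_le_id.
have rrx x : r <= rx x by exact: bigmin_le_cond.
have BC1 : 0 < B + C + 1 by rewrite ltr_wpDl.
have DM : 0 < d%:R * C * M + 1 by rewrite ltr_wpDl // !mulr_ge0.
(* Four constraints on [s]: validity of [flow_dist], displacement below [r], time shift below [r],
   and a defect of the flow within half of the error allowed. *)
pose dl := Num.min (Num.min 1 (r / (B + C + 1))) (Num.min r (e / 2 / (d%:R * C * M + 1))).
have dl0 : 0 < dl by rewrite !lt_min ltr01 r0 !divr_gt0.
exists dl => // u s mu /andP[u0 uT] /andP[s0]; rewrite !lt_min => /andP[/andP[s1 sr] /andP[sr' se]] Smu.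
pose nu := Phi u mu; pose nu' := Phi (u + s) mu; pose v := nu' - nu.
have Snu : S nu by exact: PhiS.
have vs : `|v| <= (B + C) * s by apply: flow_dist => //; exact: ltW.
have vr : `|v| < r.
  apply: (le_lt_trans vs); rewrite (@le_lt_trans _ _ ((B + C + 1) * s)) //.
    by rewrite ler_wpM2r // lerDl.
  by rewrite mulrC -ltr_pdivlMr.
have bp : box T (u, nu) by split => //=; rewrite in_itv /= u0.
have [sg /andP[sg0 sg1] Hsg] := @mvt_dir R R (fun t => phi t nu') u 1 s (fun _ _ => pdt _ _).
have [xi [Hxi Hx]] := @mvt_coord R d (phi u) nu v (fun nu0 _ x => pds u nu0 x).
have -> : phi (u + s) nu' - phi u nu - s * F u nu =
  (phi (u + s) nu' - phi u nu' - s * dtime phi u nu) +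
  \sum_x (v 0 x * (dspace phi x u (xi x) - dspace phi x u nu) + (v 0 x - s * b x nu) * dspace phi x u nu).
  have Hx' : phi u nu' - phi u nu = \sum_x v 0 x * dspace phi x u (xi x).
    by rewrite -Hx /v [nu + _]addrC subrK.
  rewrite (eq_bigr (fun x => v 0 x * dspace phi x u (xi x) - s * (dspace phi x u nu * b x nu))); last first.
    by move=> x _; ring.
  rewrite sumrB -Hx' -mulr_sumr /F; ring.
have h1 : `|phi (u + s) nu' - phi u nu' - s * dtime phi u nu| <= s * e'.
  move: Hsg; rewrite ![_ *: 1]mulr1 => ->.
  rewrite -mulrBr normrM ger0_norm // ler_wpM2l // ltW //.
  apply: (Hrt (u, nu) (u + sg * s, nu')) => //.
  rewrite prod_normE /= gt_max [u + _ - u]addrAC subrr add0r (lt_le_trans vr) // andbT.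
  rewrite ger0_norm ?mulr_ge0 // (le_lt_trans _ (lt_le_trans sr' rrt)) //.
  by rewrite ler_piMl.
have h2 x : `|v 0 x * (dspace phi x u (xi x) - dspace phi x u nu) +
    (v 0 x - s * b x nu) * dspace phi x u nu| <= (B + C) * s * e' + C * s ^+ 2 * M.
  rewrite (le_trans (ler_normD _ _)) // !normrM lerD // ler_pM //.
  - by rewrite (le_trans (mxnorm_ge v 0 x)).
  - apply: ltW; have [_ H] := Hrx x; apply: (H (u, nu) (u, xi x)) => //.
    rewrite prod_normE /= subrr normr0 gt_max (lt_le_trans r0) //=.
    by rewrite (le_lt_trans (Hxi x)) // (lt_le_trans vr).
  - have := Phistep u0 s0 Smu => /(le_trans (mxnorm_ge _ 0 x)).
    by rewrite !mxE.
  by rewrite (le_trans _ (mM x)) //; have [_ H] := Hm x; apply: (H (u, nu)).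
apply: (le_trans (ler_normD _ _)).
have h3 : `|\sum_x (v 0 x * (dspace phi x u (xi x) - dspace phi x u nu) +
    (v 0 x - s * b x nu) * dspace phi x u nu)| <= d%:R * ((B + C) * s * e' + C * s ^+ 2 * M).
  rewrite (le_trans (ler_norm_sum _ _ _)) // (le_trans (ler_sum _ (fun x _ => h2 x))) //.
  by rewrite sumr_const card_ord -[leLHS]mulr_natl.
apply: (le_trans (lerD h1 h3)).
have -> : s * e' + d%:R * ((B + C) * s * e' + C * s ^+ 2 * M) = D * e' * s + d%:R * C * M * s * s.
  by rewrite /D; ring.
have -> : D * e' = e / 2 by rewrite /e' mulrCA mulfV ?mulr1 // gt_eqF.
have h4 : d%:R * C * M * s <= e / 2.
  rewrite (@le_trans _ _ ((d%:R * C * M + 1) * s)) //; first by rewrite ler_wpM2r // lerDl.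
  by rewrite mulrC -ler_pdivlMr // ltW.
have := ler_wpM2r s0 h4; lra.
Qed.

Let g t := integ M0 (fun mu => phi t (Phi t mu)).
Let G t := integ M0 (fun mu => F t (Phi t mu)).

Let g_uniform (T e : R) : 0 < e -> exists2 r : R, 0 < r & forall u s, 0 <= u <= T -> 0 <= s < r ->
     `|g (u + s) - g u - s * G u| <= e * s.
Proof.
move=> e0; have [r r0 Hr] := flow_chain_rule T e0.
exists r => // u s uT sr; have /andP[u0 _] := uT; have /andP[s0 _] := sr.
have us0 : 0 <= u + s by rewrite addr_ge0.
have u1 := ucS_flow us0 (ucTS_ucS us0 phi_uc).
have u2 := ucS_flow u0 (ucTS_ucS u0 phi_uc).
have u3 := ucS_flow u0 (ucTS_ucS u0 F_uc).
have u12 := ucS_sub x0 u1 u2; have u3' := ucS_mul x0 (ucS_cst d s) u3.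
rewrite /g /G -(integ_sub x0 M0 u1 u2) -(integ_scale x0 M0 s u3) -(integ_sub x0 M0 u12 u3').
by apply: (integ_le x0) => //; [exact: (ucS_sub x0) | move=> mu Smu; exact: Hr].
Qed.

Let g_derive (t : R) : 0 < t -> is_derive t 1 g (G t).
Proof.
move=> t0; apply: (@is_derive_uniform _ _ _ _ (t + 1)); first by rewrite t0 ltrDl ltr01.
  exact: g_uniform.
exact: flow_integral_continuous F_uc t0.
Qed.

(** At positive times the integrand is the derivative of [g], so the integral is a difference of
    boundary values; these vanish because the support of [phi] in time is bounded and away from
    0. *)
Lemma flow_liouville :
  (\int[@lebesgue_measure R]_(t in [set t : R | (0 < t)%R])
     (integ (flow_law t) (fun nu => dtime phi t nu + \sum_x dspace phi x t nu * b x nu))%R%:E = 0)%E.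
Proof.
have [_ [_ [_ [_ [_ [a [c [rho [a0 supp]]]]]]]]] := phiC.
have phi0 t nu : (t < a) || (c < t) -> phi t nu = 0.
  move=> tac; apply/eqP; apply: contraTT tac => /supp [/andP[h1 h2] _].
  by rewrite negb_or -!leNgt h1 h2.
have F0 t nu : (t < a) || (c < t) -> F t nu = 0.
  move=> tac; have dt0 : dtime phi t nu = 0.
    rewrite /dtime -[RHS](@derive_cst R R R 0 t 1); apply: near_eq_derive.
    move/orP : tac => [ta|ct].
      by have := lt_nbhsl ta; apply: filterS => s sa; rewrite phi0 ?sa.
    by have := lt_nbhsr ct; apply: filterS => s cs; rewrite phi0 ?cs ?orbT.
  rewrite /F dt0 add0r big1 // => x _.
  have -> : dspace phi x t nu = 0; last by rewrite mul0r.
  rewrite /dspace /pder (_ : phi t = cst 0) ?derive_cst //.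
  by apply/funext => nu'; rewrite phi0.
(* The maximum covers [c < a], where [phi] is identically 0 but the interval must still be
   nondegenerate. *)
pose al := a / 2; pose be := Num.max a c + 1.
have al0 : 0 < al by rewrite divr_gt0.
have ala : al < a by rewrite /al; lra.
have abe : a < be by rewrite /be ltr_pwDr // le_max lexx.
have cbe : c < be by rewrite /be ltr_pwDr // le_max lexx orbT.
have albe : al < be by exact: lt_trans abe.
transitivity (\int[@lebesgue_measure R]_(t in `[al, be]) (G t)%:E)%E.
  rewrite integral_mkcond [RHS]integral_mkcond; congr (integral _ _ _).
  apply/funext => t; rewrite !patchE.
  have [t0|t0] := ltP 0 t; last first.
    rewrite memNset; last by rewrite /= => /(le_lt_trans t0); rewrite ltxx.
    rewrite memNset //= in_itv /= => /andP[h _].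
    by have := lt_le_trans al0 (le_trans h t0); rewrite ltxx.
  rewrite mem_set //= integ_flow_law; [|exact: ltW|exact: (ucTS_ucS (ltW t0) F_uc)].
  case: ifPn => // h.
  have : (t < a) || (c < t).
    move: h; rewrite notin_setE /= in_itv /= => /negP; rewrite negb_and -!ltNge => /orP[h|h].
      by rewrite (lt_trans h).
    by rewrite (lt_trans cbe) ?orbT.
  move=> tac; congr (_%:E); rewrite (@integ_eq _ _ _ _ (fun _ => 0)) => [|mu _].
    by rewrite /integ Rintegral_cst ?mul0r //; exact: simplex_measurable.
  exact: F0.
have gd t : 0 < t -> derivable g t 1 by move=> /g_derive [].
have gcont t : 0 < t -> {for t, continuous g}.
  by move=> /gd /derivable1_diffP /differentiable_continuous.
have be0 : 0 < be by exact: lt_trans albe.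
rewrite (@continuous_FTC2 R G g al be albe).
- have g0 t : (t < a) || (c < t) -> g t = 0.
    move=> tac; rewrite /g (@integ_eq _ _ _ _ (fun _ => 0)) => [|mu _].
      by rewrite /integ Rintegral_cst ?mul0r //; exact: simplex_measurable.
    exact: phi0.
  by rewrite !g0 ?ala ?cbe ?orbT // subee.
- apply: continuous_in_subspaceT => t; rewrite inE /= in_itv /= => /andP[h _].
  by apply: flow_integral_continuous F_uc _; exact: lt_le_trans h.
- split=> [t||]; first by rewrite in_itv /= => /andP[h _]; apply: gd; exact: lt_trans h.
    by apply: cvg_at_right_filter; exact: gcont.
  by apply: cvg_at_left_filter; exact: gcont.
move=> t; rewrite in_itv /= => /andP[h _]; rewrite derive1E.
by have [_ ->] := g_derive (lt_trans al0 h).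
Qed.

End transport.

(* Completeness is only inferred for matrices as uniform spaces, while
   [flow_exists] needs it for the normed module. *)
HB.instance Definition _ (R : realType) (m n : nat) :=
  Uniform_isComplete.Build 'M[R]_(m, n) (@cauchy_cvg 'M[R]_(m, n)).

(** * The flow of the drift, and the conclusion *)

Lemma unif_family (R : realType) (I : finType) (P : I -> R -> Prop) :
  (forall i (a b : R), a <= b -> P i a -> P i b) ->
  (forall i, exists2 a, 0 <= a & P i a) -> exists2 a, 0 <= a & forall i, P i a.
Proof.
move=> mono H.
have /choice [f Hf] : forall i, exists a, 0 <= a /\ P i a.
  by move=> i; have [a a0 Pa] := H i; exists a.
exists (\sum_i f i) => [|i]; first by apply: sumr_ge0 => i _; case: (Hf i).
have [f0 Pf] := Hf i; apply: mono Pf; rewrite (bigD1 i) //= lerDl.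
by apply: sumr_ge0 => j _; case: (Hf j).
Qed.

Section mean_field_flow.
Variables (R : realType) (d : nat).
Local Notation V := (vec R d).
Local Notation S := (@simplex R d).
Variable b : 'I_d -> V -> R.
Hypothesis bl : forall x, lipS (b x).
Hypothesis bsum : forall mu, \sum_x b x mu = 0.
Hypothesis bge : exists2 M, 0 <= M & forall mu x, S mu -> - (M * mu 0 x) <= b x mu.

Lemma drift_unif_lip : exists2 L, 0 <= L & forall x mu nu, S mu -> S nu ->
  `|b x mu - b x nu| <= L * `|mu - nu|.
Proof.
apply: (@unif_family _ _ (fun x L => forall mu nu, S mu -> S nu -> `|b x mu - b x nu| <= L * `|mu - nu|)) => //.
by move=> x a c ac H mu nu Smu Snu; rewrite (le_trans (H _ _ Smu Snu)) // ler_wpM2r.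
Qed.

Lemma drift_unif_bounded : exists2 B, 0 <= B & forall x mu, S mu -> `|b x mu| <= B.
Proof.
apply: (@unif_family _ _ (fun x B => forall mu, S mu -> `|b x mu| <= B)) => [x a c ac H mu Smu|x].
  by rewrite (le_trans (H _ Smu)).
exact: lipS_bounded.
Qed.

Lemma mean_field_flow : exists (L C : R) (Phi : R -> V -> V),
  [/\ 0 <= C, forall mu, S mu -> Phi 0 mu = mu,
    forall t mu, 0 <= t -> S mu -> S (Phi t mu),
    forall t s mu, 0 <= t -> 0 <= s -> S mu ->
      `|Phi (t + s) mu - Phi t mu - s *: (\row_x b x (Phi t mu))| <= C * s ^+ 2 &
    forall t mu nu, 0 <= t -> S mu -> S nu ->
      `|Phi t mu - Phi t nu| <= expR (L * t) * `|mu - nu|].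
Proof.
have [L L0 HL] := drift_unif_lip; have [B B0 HB] := drift_unif_bounded.
have [M M0 HM] := bge.
pose bv mu : V := \row_x b x mu.
(* For steps up to this length the new mass at [x] is at least [(1 - h * M) * mu 0 x], hence
   nonnegative; the total mass is kept because the drift sums to 0. *)
have h00 : 0 < (M + 1)^-1 by rewrite invr_gt0 ltr_wpDl.
have [||h mu /andP[h0 hM] Smu|Phi [c [c0 Phi0 Phic PhiL]]] :=
  @flow_exists R 'rV[R]_d S bv L B _ (@simplex_closed R d) L0 B0 _ _ h00.
- move=> mu nu Smu Snu; apply: ler_mxnorm => [|i x]; first exact: mulr_ge0.
  by rewrite !mxE; exact: HL.
- by move=> mu Smu; apply: ler_mxnorm => // i x; rewrite mxE; exact: HB.
- have [mu0 mu1] := Smu; split=> [x|].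
    rewrite !mxE; have := ler_wpM2l h0 (HM mu x Smu).
    have : h * M * mu 0 x <= 1 * mu 0 x.
      rewrite ler_wpM2r // (@le_trans _ _ (h * (M + 1))) ?ler_wpM2l ?lerDl //.
      by rewrite -ler_pdivlMr ?mul1r // ltr_wpDl.
    lra.
  under eq_bigr do rewrite !mxE.
  by rewrite big_split /= mu1 -mulr_sumr bsum mulr0 addr0.
exists L, c, Phi; split => // [t mu t0 Smu|t s mu t0 s0 Smu].
  by have [H _] := Phic mu Smu; exact: H.
by have [_ /(_ t s t0 s0)] := Phic mu Smu; rewrite addr0.
Qed.

End mean_field_flow.

(** In [relentN_decomp] every other term has a known limit, so the [kl] term vanishes exactly when
    the relative entropy has the expected one. One direction serves at time 0, the other at time
    [t]. *)
Lemma relentN_limit (R : realType) (d : nat) (K : 'I_d -> vec R d -> R)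
    (m : forall N : nat, config d N -> R) (F : R) : 'I_d ->
  (forall mu, simplex mu -> {for mu, continuous (U K)}) ->
  (forall N, (0 < N)%N -> probN (m N)) ->
  push_integ (m N) (freeF K) @[N --> \oo] --> F ->
  N%:R^-1 * kl (m N) (symm (m N)) @[N --> \oo] --> (0 : R) <->
  N%:R^-1 * relentN K (m N) @[N --> \oo] --> F - F0 K.
Proof.
move=> x0 Uc mp Fm.
have Z := lnZ_cvg Uc x0.
pose rem N := N%:R^-1 * relentN K (m N) -
  (N%:R^-1 * kl (m N) (symm (m N)) + push_integ (m N) (freeF K) + N%:R^-1 * lnZ K N).
have rem0 : rem N @[N --> \oo] --> (0 : R).
  apply: norm_cvg0; apply: (@squeeze_cvgr _ _ _ _ (fun=> 0) (fun N => N%:R^-1 * cerr R d N)).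
  - near=> N; rewrite normr_ge0 /=; apply: relentN_decomp; last apply: mp.
      by near: N; exact: nbhs_infty_gt.
    by near: N; exact: nbhs_infty_gt.
  - exact: cvg_cst.
  - exact: cerr_cvg.
split=> H.
  have -> : (fun N => N%:R^-1 * relentN K (m N)) = (fun N =>
     rem N + (N%:R^-1 * kl (m N) (symm (m N)) + push_integ (m N) (freeF K) + N%:R^-1 * lnZ K N)).
    by apply/funext => N; rewrite /rem subrK.
  have -> : F - F0 K = 0 + (0 + F + - F0 K) by rewrite !add0r.
  by apply: cvgD => //; apply: cvgD => //; exact: cvgD.
have -> : (fun N => N%:R^-1 * kl (m N) (symm (m N))) = (fun N =>
   N%:R^-1 * relentN K (m N) - rem N - push_integ (m N) (freeF K) - N%:R^-1 * lnZ K N).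
  by apply/funext => N; rewrite /rem; ring.
have -> : (0 : R) = F - F0 K - 0 - F - - F0 K by ring.
by apply: cvgB => //; apply: cvgB => //; exact: cvgB.
Unshelve. all: by end_near. Qed.

Theorem theorem3p12 (R : realType) (d : nat)
  (K : 'I_d -> vec R d -> R)
  (A : vec R d -> 'M[R]_d) (AN : nat -> vec R d -> 'M[R]_d)
  (c : forall N : nat, R -> config d N -> R)
  (C0 : probability (borelT R d) R) :
  (* K_x twice continuously differentiable on a neighbourhood of P(X) *)
  (exists O : set (vec R d), open O /\ @simplex R d `<=` O /\
     forall x, C2_on O (K x)) ->
  (* A(mu): irreducible symmetric nonnegative, Lipschitz in mu *)
  (forall mu, @simplex R d mu -> irr_sym_nonneg (A mu)) ->
  (exists L : R, forall mu nu, @simplex R d mu -> @simplex R d nu ->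
     forall x y, `|A mu x y - A nu x y| <= L * `|mu - nu|) ->
  (* A^N(mu): irreducible symmetric nonnegative, A^N -> A uniformly *)
  (forall N mu, @simplex R d mu -> irr_sym_nonneg (AN N mu)) ->
  (forall x y (eps : R), 0 < eps ->
     \forall N \near \oo, forall mu, @simplex R d mu ->
       `|AN N mu x y - A mu x y| < eps) ->
  (* c^N solves d/dt c^N = c^N Q^N on [0,oo) *)
  (forall N : nat, (0 < N)%N -> master_sol K AN (c N)) ->
  (* C(0) in P(P(X)) *)
  PP C0 ->
  (* well-prepared initial data *)
  (fun N : nat => N%:R^-1 * relentN K (c N 0)) @ \oo --> bigF K C0 - F0 K ->
  weak_conv (fun N => c N 0) C0 ->
  exists C : R -> probability (borelT R d) R,
    liouville_weak K A C0 C /\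
    forall t : R, 0 < t ->
      weak_conv (fun N => c N t) (C t) /\
      (fun N : nat => N%:R^-1 * relentN K (c N t)) @ \oo --> bigF K (C t) - F0 K.
Proof.
move=> [D [Oo [SO KC2]]] AS Alip ANS ANcvg csol PC0 relc0 wc0.
(* A base point for [rtr]. Without states the simplex is empty and cannot carry the mass 1 of
   [C0]. *)
have x0 : 'I_d.
  case: (pickP (fun _ : 'I_d => true)) => [//|d0]; exfalso.
  move: PC0; rewrite /PP (_ : @simplex R d = set0) ?measure0.
    by move=> /eqP; rewrite eqe eq_sym oner_eq0.
  apply/seteqP; split=> // mu [_]; rewrite big1 => [/eqP|x _]; last by have := d0 x.
  by rewrite eq_sym oner_eq0.
have A0 mu : simplex mu -> forall x y, 0 <= A mu x y by move=> /AS [].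
have Uc := U_continuous SO KC2.
have bl := drift_lipS Oo SO KC2 Alip.
have bge := drift_ge Oo SO KC2 A0 Alip.
have [L [C [Phi [C00 Phi0 PhiS Phistep PhiL]]]] := mean_field_flow bl (drift_sum K A) bge.
have [B B0 HBx] := drift_unif_bounded bl.
have HBr mu x : simplex mu -> `|drift K A mu x| <= B by exact: HBx.
have [L' L'0 HL] := drift_unif_lip bl.
have [BQ BQ0 HBQ] := Qlim_bounded Oo SO KC2 Alip.
have bu x := lipS_ucS (bl x).
pose E t := expR (L * t).
have E0 t : 0 < E t by exact: expR_gt0.
have PhiE t mu nu : 0 <= t -> simplex mu -> simplex nu -> `|Phi t mu - Phi t nu| <= E t * `|mu - nu| by exact: PhiL.
pose Ct := flow_law x0 E0 PhiE C0.
have CtPP t : PP (Ct t) by exact: flow_law_PP.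
have CtI t f : 0 <= t -> ucS f -> integ (Ct t) f = integ C0 (fun mu => f (Phi t mu)).
  by move=> t0 fu; exact: (integ_flow_law x0 Phi0 PhiS E0 PhiE PC0 t0 fu).
have pushE t f N : (0 < N)%N -> push_integ (c N t) (f \o rtr x0) = push_integ (c N t) f.
  by move=> N0; apply: eq_bigr => bx _; rewrite /= rtr_id //; exact: LN_simplex.
(* The index N = 0 is discarded: [LN] of the empty configuration is the zero vector, outside the
   simplex. *)
have cvg_pos (u v : nat -> R) (l : R) : (forall N, (0 < N)%N -> u N = v N) ->
    u @ \oo --> l -> v @ \oo --> l.
  move=> uv; apply: cvg_trans; apply: near_eq_cvg; near=> N; apply: uv.
  by near: N; exact: nbhs_infty_gt.
have wc_ucS0 f : ucS f -> push_integ (c N 0) f @[N --> \oo] --> integ C0 f.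
  move=> fu; have := wc0 _ (test_fun_rtr x0 fu).
  rewrite (@integ_eq _ _ _ (f \o rtr x0) f) => [|mu Smu]; last by rewrite /= rtr_id.
  by apply: cvg_pos => N; exact: pushE.
(* Stated for [ucS] functions so that it covers [freeF] besides the test functions. *)
have wc_ucS t f : 0 <= t -> ucS f -> push_integ (c N t) f @[N --> \oo] --> integ (Ct t) f.
  move=> t0 fu; have fPhi := ucS_flow PhiS E0 PhiE t0 fu.
  rewrite CtI // -[X in _ --> X]add0r.
  have -> : (fun N => push_integ (c N t) f) = (fun N => (push_integ (c N t) f -
     push_integ (c N 0) (fun mu => f (Phi t mu))) + push_integ (c N 0) (fun mu => f (Phi t mu))).
    by apply/funext => N; rewrite subrK.
  apply: cvgD; last exact: wc_ucS0.
  apply: (@push_integ_flow_cvg _ _ _ _ _ L' B BQ _ _ _ _ _ ANS _ _ C _ Phi0 PhiS Phistep x0 c csol) => //.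
  - by move=> mu nu x Smu Snu; exact: HL.
  - by move=> mu x y Smu; exact: Qlim_ge0.
  - exact: (QN_cvg Oo SO KC2 Alip ANcvg).
have freeU : ucS (freeF K) by exact: freeF_ucS.
have cprob t N : 0 <= t -> (0 < N)%N -> probN (c N t).
  by move=> t0 N0; have [H _] := csol N N0; exact: H.
exists Ct; split.
  split; first exact: flow_law0.
  split; first by move=> t _.
  split; first by move=> f; exact: (flow_law_continuous B0 HBr C00 Phi0 PhiS Phistep PC0).
  by move=> phi phiC; exact: (flow_liouville x0 bu B0 HBr C00 Phi0 PhiS Phistep E0 PhiE PC0 phiC).
move=> t t0; split.
  by move=> f [fc _]; apply: wc_ucS; [exact: ltW | apply: ucS_continuous => mu _; exact: fc].
apply/(relentN_limit x0 Uc (fun N => @cprob t N (ltW t0))); first exact: wc_ucS (ltW t0) freeU.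
have kl0 : N%:R^-1 * kl (c N 0) (symm (c N 0)) @[N --> \oo] --> (0 : R).
  by apply/(relentN_limit x0 Uc (fun N => @cprob 0 N (lexx _)) (wc_ucS0 _ freeU)).
apply: (@squeeze_cvgr _ _ _ _ (fun=> 0) (fun N => N%:R^-1 * kl (c N 0) (symm (c N 0)))) => //; last exact: cvg_cst.
near=> N.
have N0 : (0 < N)%N by near: N; exact: nbhs_infty_gt.
have [ct0 _] := cprob t N (ltW t0) N0.
rewrite mulr_ge0 ?invr_ge0 ?kl_symm_ge0 //= ler_wpM2l ?invr_ge0 //.
exact: (kl_symm_decreasing N0 (ANS N) (csol N N0) (ltW t0)).
Unshelve. all: by end_near. Qed.
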